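(* Let $(S_1,\dots,S_n)^T$ be uniformly distributed on $\mathcal{M}_n(\mathbb{R})$ and let $(U_1,\dots,U_n)^T$ be the corresponding vector of symmetric canonical moments (defined almost surely). Then $(U_1,\dots,U_n)^T$ is absolutely continuous with respect to Lebesgue measure on $(\mathcal{S}_p(\mathbb{R}))^n$ with density $$f(U_1,\dots,U_n)=\frac{1}{\mathcal{V}(\mathcal{M}_n(\mathbb{R}))}\prod_{k=1}^n\det\big(U_k(I_p-U_k)\big)^{(p+1)(n-k)/2}\mathbf{1}_{(0_p,I_p)}(U_k).$$ In particular $U_1,\dots,U_n$ are independent and $U_k\sim\mathrm{Beta}_p\big(\tfrac12(n-k+1)(p+1),\tfrac12(n-k+1)(p+1)\big)$.
   Context: $\mathcal{S}_p(\mathbb{R})$: real symmetric $p\times p$ matrices with Lebesgue measure $dX=\prod_{i\le j}dx_{i,j}$; $(0_p,I_p)=\{X\in\mathcal{S}_p(\mathbb{R}):0_p<X<I_p\}$ in the Loewner order. A real matrix measure on $[0,1]$: $p\times p$ matrix of signed Borel measures with $\mu(B)$ symmetric nonnegative definite, $\mu([0,1])=I_p$; moments $S_k=\int_0^1x^kd\mu$, $S_0=I_p$; $\mathcal{M}_n(\mathbb{R})$ is the set of moment vectors, $\mathcal{V}$ its volume, and the uniform distribution has density $\mathcal{V}(\mathcal{M}_n(\mathbb{R}))^{-1}\mathbf{1}_{\mathcal{M}_n(\mathbb{R})}$. With block Hankel matrices $\underline H_{2m}=(S_{i+j})_{i,j=0}^m$, $\overline H_{2m}=(S_{i+j+1}-S_{i+j+2})_{i,j=0}^{m-1}$,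 $\underline H_{2m+1}=(S_{i+j+1})_{i,j=0}^m$, $\overline H_{2m+1}=(S_{i+j}-S_{i+j+1})_{i,j=0}^m$ and block vectors $\underline h_{2m}=(S_{m+1},\dots,S_{2m})^T$, $\underline h_{2m-1}=(S_m,\dots,S_{2m-1})^T$, $\bar h_{2m}=(S_m-S_{m+1},\dots,S_{2m-1}-S_{2m})^T$, $\bar h_{2m-1}=(S_m-S_{m+1},\dots,S_{2m-2}-S_{2m-1})^T$, set $S_1^-=0_p$, $S_1^+=I_p$, $S_2^+=S_1$, $S^-_{n+1}=\underline h_n^T\underline H_{n-1}^{-1}\underline h_n$, $S^+_{n+1}=S_n-\bar h_n^T\overline H_{n-1}^{-1}\bar h_n$. On $\operatorname{Int}(\mathcal{M}_n(\mathbb{R}))=\{S_k^-<S_k<S_k^+\ \forall k\}$ the symmetric canonical moments are $U_k=(S_k^+-S_k^-)^{-1/2}(S_k-S_k^-)(S_k^+-S_k^-)^{-1/2}$. $\mathrm{Beta}_p(a,b)$ ($a,b>\tfrac12(p-1)$) is the law on $\mathcal{S}_p(\mathbb{R})$ with density $B_p(a,b)^{-1}(\det X)^{a-(p+1)/2}\det(I_p-X)^{b-(p+1)/2}\mathbf{1}_{(0_p,I_p)}(X)$, where $B_p(a,b)=\Gamma_p(a)\Gamma_p(b)/\Gamma_p(a+b)$ and $\Gamma_p(a)=\pi^{p(p-1)/4}\prod_{i=1}^p\Gamma(a-\tfrac12(i-1))$. *)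

(* Defs.v *)
From HB Require Import structures.
From mathcomp Require Import all_boot all_order all_algebra.
From mathcomp Require Import all_classical all_reals all_analysis.

Set Implicit Arguments.
Unset Strict Implicit.
Unset Printing Implicit Defensive.

Import Order.TTheory GRing.Theory Num.Theory.
Import numFieldNormedType.Exports.

Local Open Scope classical_set_scope.
Local Open Scope ring_scope.

Section MatrixMoments.
Variable R : realType.
Variable p : nat.
Local Notation mx := 'M[R]_p.

Definition symmetricmx (A : mx) : Prop := A^T = A.
Definition psdmx (A : mx) : Prop :=
  symmetricmx A /\ forall v : 'cV[R]_p, 0 <= (v^T *m A *m v) 0 0.
Definition pdmx (A : mx) : Prop :=
  symmetricmx A /\ forall v : 'cV[R]_p, v != 0 -> 0 < (v^T *m A *m v) 0 0.
Definition loewner_le (A B : mx) : Prop := psdmx (B - A).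
Definition loewner_lt (A B : mx) : Prop := pdmx (B - A).

Definition mx_open01 : set mx :=
  [set X | symmetricmx X /\ loewner_lt 0 X /\ loewner_lt X 1%:M].

Definition sqrtmx (A : mx) : mx := xget 0 [set X | psdmx X /\ X *m X = A].

Definition hankel (r : nat) (F : nat -> mx) : 'M[R]_(\sum_(i < r) p) :=
  @mxblock R r r (fun _ => p) (fun _ => p) (fun i j => F (i + j)%N).
Definition bcol (r : nat) (F : nat -> mx) : 'M[R]_(\sum_(i < r) p, p) :=
  @mxcol R r (fun _ => p) p (fun i => F i).

(* S^-_k for a moment sequence S (with S 0 = I_p):
   S^-_1 = 0, S^-_{n+1} = h_n^T H_{n-1}^{-1} h_n (lower Hankel data). *)
Definition Smin (S : nat -> mx) (k : nat) : mx :=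
  match k with
  | 0 | 1 => 0
  | n.+1 =>
    if odd n then
      let m := n.+1./2 in
      let h := bcol m (fun i => S (m + i)%N) in
      h^T *m invmx (hankel m (fun t => S t)) *m h
    else
      let m := n./2 in
      let h := bcol m (fun i => S (m + i).+1) in
      h^T *m invmx (hankel m (fun t => S t.+1)) *m h
  end.

Definition Smax (S : nat -> mx) (k : nat) : mx :=
  match k with
  | 0 => 0
  | 1 => 1%:M
  | n.+1 =>
    if odd n then
      let m := n.+1./2 in
      let h := bcol m.-1 (fun i => S (m + i)%N - S (m + i).+1) in
      S n - h^T *m invmx (hankel m.-1 (fun t => S t.+1 - S t.+2)) *m h
    else
      let m := n./2 in
      let h := bcol m (fun i => S (m + i)%N - S (m + i).+1) in
      S n - h^T *m invmx (hankel m (fun t => S t - S t.+1)) *m h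
  end.

Definition canon_moment (S : nat -> mx) (k : nat) : mx :=
  let D := invmx (sqrtmx (Smax S k - Smin S k)) in
  D *m (S k - Smin S k) *m D.

(* Coordinates on S_p(R): the entries x_{ij}, i <= j. *)
Definition symidx := {ij : 'I_p * 'I_p | (ij.1 <= ij.2)%N}.
Definition sym_coord (i j : 'I_p) : symidx :=
  insubd (exist (fun ij : 'I_p * 'I_p => (ij.1 <= ij.2)%N) (i, i) (leqnn i))
         (if (i <= j)%N then (i, j) else (j, i)).
Definition dimS := #|{: symidx}|.
Definition mat_of (t : dimS.-tuple R) : mx :=
  \matrix_(i, j) tnth t (enum_rank (sym_coord i j)).
Definition coords_of (A : mx) : dimS.-tuple R :=
  [tuple (let ij := val (enum_val i) in A ij.1 ij.2) | i < dimS].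

Definition momseq (n : nat) (s : n.-tuple (dimS.-tuple R)) (k : nat) : mx :=
  if k is k'.+1 then mat_of (nth (nseq_tuple dimS 0) s k') else 1%:M.

Definition matrix_measure
    (mu : 'I_p -> 'I_p -> {charge set (measurableTypeR R) -> \bar R}) : Prop :=
  (forall i j (A : set R), measurable A -> mu i j A = mu i j (A `&` `[0%R, 1%R]%classic)) /\
  (forall A : set R, measurable A -> psdmx (\matrix_(i, j) fine (mu i j A))) /\
  (\matrix_(i, j) fine (mu i j `[0%R, 1%R]%classic) = 1%:M).

(* x = \int_[0,1] t^k d nu(t) for a (finite) signed measure nu; the integral is
   computed through any decomposition nu = a - b into finite measures. *)
Definition charge_moment (nu : {charge set (measurableTypeR R) -> \bar R})
    (k : nat) (x : R) : Prop :=
  exists a b : {finite_measure set (measurableTypeR R) -> \bar R},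
    (forall A : set R, measurable A -> nu A = (a A - b A)%E) /\
    x%:E = (\int[a]_(t in `[0%R, 1%R]%classic) (t ^+ k)%:E
            - \int[b]_(t in `[0%R, 1%R]%classic) (t ^+ k)%:E)%E.

Definition moment_space (n : nat) : set (n.-tuple (dimS.-tuple R)) :=
  [set s | exists mu, matrix_measure mu /\
     forall (k : 'I_n) (i j : 'I_p),
       charge_moment (mu i j) k.+1 (mat_of (tnth s k) i j)].

Definition moment_interior (n : nat) : set (n.-tuple (dimS.-tuple R)) :=
  [set s | forall k : 'I_n,
     loewner_lt (Smin (momseq s) k.+1) (momseq s k.+1) /\
     loewner_lt (momseq s k.+1) (Smax (momseq s) k.+1)].

Definition canon_vec (n : nat) (s : n.-tuple (dimS.-tuple R))
  : n.-tuple (dimS.-tuple R) :=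
  [tuple coords_of (canon_moment (momseq s) i.+1) | i < n].

Fixpoint iter_int {T : Type} (I : (T -> \bar R) -> \bar R) (N : nat)
  : (N.-tuple T -> \bar R) -> \bar R :=
  match N return (N.-tuple T -> \bar R) -> \bar R with
  | 0 => fun g => g [tuple]
  | N'.+1 => fun g => I (fun x => iter_int I (fun t => g (cons_tuple x t)))
  end.

(* Integral w.r.t. Lebesgue measure on R^N (Tonelli, for nonnegative g). *)
Definition leb_int (N : nat) : (N.-tuple R -> \bar R) -> \bar R :=
  @iter_int _ (fun g => (\int[@lebesgue_measure R]_(x in [set: R]) g x)%E) N.

(* Integral w.r.t. Lebesgue measure dX = prod_{i<=j} dx_{ij} on S_p(R),
   and on (S_p(R))^n. *)
Definition leb_int_S : (dimS.-tuple R -> \bar R) -> \bar R := @leb_int dimS.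
Definition leb_int_Sn (n : nat) : (n.-tuple (dimS.-tuple R) -> \bar R) -> \bar R :=
  @iter_int _ leb_int_S n.

Definition moment_volume (n : nat) : \bar R :=
  @leb_int_Sn n (fun s => (\1_(@moment_space n) s : R)%:E).

Definition Gamma (x : R) : R :=
  fine (\int[@lebesgue_measure R]_(t in [set t : R | (0 < t)%R]) ((t `^ (x - 1) * expR (- t))%R)%:E)%E.
Definition Gamma_p (a : R) : R :=
  pi `^ ((p * p.-1)%:R / 4) * \prod_(i < p) Gamma (a - i%:R / 2).
Definition Beta_p (a b : R) : R := Gamma_p a * Gamma_p b / Gamma_p (a + b).

Definition beta_p_pdf (a b : R) (X : mx) : R :=
  (Beta_p a b)^-1 * (\det X) `^ (a - p.+1%:R / 2)
  * (\det (1%:M - X)) `^ (b - p.+1%:R / 2) * \1_mx_open01 X.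

Definition beta_p_prob (a b : R) (B : set (dimS.-tuple R)) : \bar R :=
  leb_int_S (fun t => (\1_B t * beta_p_pdf a b (mat_of t))%:E).

End MatrixMoments.

(* Main.v *)
(* Given an interior prefix S_1, ..., S_k, the next moment ranges over the Loewner
   interval between S^-_{k+1} and S^+_{k+1}, and X = Q U Q + S^-_{k+1} with
   Q^2 = D_{k+1} = S^+_{k+1} - S^-_{k+1} parametrises it by its canonical moment U, with
   Jacobian (det D_{k+1})^((p+1)/2).  Both ends of the interval are Schur complements of
   block Hankel matrices, that is, minima of quadratic forms on vector polynomials; the
   identity t F^2 + (1-t) G^2 = E^2 + t (1-t) W^2 for W = F - G and E = G + t W identifies
   D_{k+1} with the parallel sum (S_k - S^-_k) D_k^-1 (S^+_k - S_k), whose determinant is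
   det U_k det (1 - U_k) det D_k.  Integrating the moments out one after the other therefore
   produces independent matrix beta factors.  The interior points are moment sequences by a
   Gauss quadrature read off the pencil of two Hankel matrices, and conversely every moment
   sequence stays in the closed intervals; their boundaries are null, so the moment space
   and the interior have the same volume. *)

Require Import Defs.
From HB Require Import structures.
From mathcomp Require Import all_boot all_order all_algebra.
From mathcomp Require Import all_classical all_reals all_analysis.
From mathcomp Require Import measurable_realfun.
From mathcomp Require Import ring lra zify.
From mathcomp Require Import complex.
Import Order.TTheory GRing.Theory Num.Theory.
Import numFieldNormedType.Exports.
Local Open Scope classical_set_scope.
Local Open Scope ring_scope.
Import Defs.
Set Implicit Arguments.
Unset Strict Implicit.
Unset Printing Implicit Defensive.

(** * Real symmetric matrices *)

Section RealSymmetric.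
Variable R : realType.

(** The power (n-k)(p+1)/2 is accumulated step by step: integrating out the last m moments leaves
    (det D_{k+1})^(m(p+1)/2), the determinant recursion turns this into a power of det U_k det (1 -
    U_k) times the same power of det D_k, and the Jacobian at step k raises m to m+1. The parallel
    sum enters because (F, G) and (E, W) determine each other linearly, so that the minima with
    matching leading coefficients coincide. Two encodings shape the analysis. Volume on symmetric
    matrices is an iterated one-dimensional integral, so linear substitution and the Jacobian of X
    -> QXQ are derived from block triangular factorisations and the spectral theorem. Measurability
    of the moment space is nowhere established: its volume is squeezed by inequalities, nonnegative
    integrals being monotone without measurability. The entries of a matrix measure are integrated
    through arbitrary decompositions, so positivity of the moments is obtained as a limit of Riemann
    sums over cells common to all entries. *)

Definition bf m n (A : 'M[R]_(m, n)) (u : 'cV[R]_m) (v : 'cV[R]_n) : R := (u^T *m A *m v) 0 0.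

Lemma bfDl m n (A : 'M[R]_(m, n)) u u' v : bf A (u + u') v = bf A u v + bf A u' v.
Proof. by rewrite /bf [(_ + _)^T]linearD/= !mulmxDl mxE. Qed.

Lemma bfDr m n (A : 'M[R]_(m, n)) u v v' : bf A u (v + v') = bf A u v + bf A u v'.
Proof. by rewrite /bf mulmxDr mxE. Qed.

Lemma bfZl m n (A : 'M[R]_(m, n)) c u v : bf A (c *: u) v = c * bf A u v.
Proof. by rewrite /bf [(_ *: _)^T]linearZ/= -!scalemxAl mxE. Qed.

Lemma bfZr m n (A : 'M[R]_(m, n)) c u v : bf A u (c *: v) = c * bf A u v.
Proof. by rewrite /bf -scalemxAr mxE. Qed.

Lemma bfNl m n (A : 'M[R]_(m, n)) u v : bf A (- u) v = - bf A u v.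
Proof. by rewrite -scaleN1r bfZl mulN1r. Qed.

Lemma bfNr m n (A : 'M[R]_(m, n)) u v : bf A u (- v) = - bf A u v.
Proof. by rewrite -scaleN1r bfZr mulN1r. Qed.

Lemma bf0l m n (A : 'M[R]_(m, n)) v : bf A 0 v = 0.
Proof. by rewrite /bf trmx0 !mul0mx mxE. Qed.

Lemma bf0r m n (A : 'M[R]_(m, n)) u : bf A u 0 = 0.
Proof. by rewrite /bf mulmx0 mxE. Qed.

Lemma bf_suml m n (A : 'M[R]_(m, n)) I r (P : pred I) F v :
  bf A (\sum_(i <- r | P i) F i) v = \sum_(i <- r | P i) bf A (F i) v.
Proof. by elim/big_rec2: _ => [|i ? ? _ <-]; rewrite ?bf0l// bfDl. Qed.

Lemma bf_sumr m n (A : 'M[R]_(m, n)) I r (P : pred I) F u :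
  bf A u (\sum_(i <- r | P i) F i) = \sum_(i <- r | P i) bf A u (F i).
Proof. by elim/big_rec2: _ => [|i ? ? _ <-]; rewrite ?bf0r// bfDr. Qed.

Lemma bfAD m n (A B : 'M[R]_(m, n)) u v : bf (A + B) u v = bf A u v + bf B u v.
Proof. by rewrite /bf mulmxDr mulmxDl mxE. Qed.

Lemma bfAN m n (A : 'M[R]_(m, n)) u v : bf (- A) u v = - bf A u v.
Proof. by rewrite /bf mulmxN mulNmx mxE. Qed.

Lemma bfAZ m n (A : 'M[R]_(m, n)) c u v : bf (c *: A) u v = c * bf A u v.
Proof. by rewrite /bf -scalemxAr -scalemxAl mxE. Qed.

Lemma bfA0 m n (u : 'cV[R]_m) (v : 'cV[R]_n) : bf 0 u v = 0.
Proof. by rewrite /bf mulmx0 mul0mx mxE. Qed.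

Lemma bf_mull m n k (A : 'M[R]_(m, n)) (M : 'M[R]_(m, k)) u v :
  bf A (M *m u) v = bf (M^T *m A) u v.
Proof. by rewrite /bf trmx_mul !mulmxA. Qed.

Lemma bf_mulr m n k (A : 'M[R]_(m, n)) (M : 'M[R]_(n, k)) u v :
  bf A u (M *m v) = bf (A *m M) u v.
Proof. by rewrite /bf !mulmxA. Qed.

Lemma bfT m n (A : 'M[R]_(m, n)) u v : bf A u v = bf A^T v u.
Proof.
rewrite /bf; transitivity ((v^T *m A^T *m u)^T 0 0); last by rewrite mxE.
by rewrite !trmx_mul !trmxK mulmxA.
Qed.

Lemma bfC n (A : 'M[R]_n) u v : A^T = A -> bf A u v = bf A v u.
Proof. by move=> As; rewrite bfT As. Qed.

Lemma bf_delta m n (A : 'M[R]_(m, n)) i j :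
  bf A (delta_mx i 0) (delta_mx j 0) = A i j.
Proof. by rewrite /bf trmx_delta -rowE -colE !mxE. Qed.

(** Polarisation: the form on sums of two basis vectors recovers the entries. *)
Lemma sym_bf_inj n (A B : 'M[R]_n) : A^T = A -> B^T = B ->
  (forall v, bf A v v = bf B v v) -> A = B.
Proof.
move=> As Bs AB; apply/matrixP => i j; rewrite -!bf_delta.
have := AB (delta_mx i 0 + delta_mx j 0); rewrite !bfDl !bfDr !AB.
rewrite (bfC _ (delta_mx j 0) As) (bfC _ (delta_mx j 0) Bs).
set x := bf A _ _; set y := bf B _ _ => H; lra.
Qed.

Lemma bf1_eq0 n (v : 'cV[R]_n) : (bf 1%:M v v == 0) = (v == 0).
Proof.
rewrite /bf mulmx1; apply/idP/eqP => [|->]; last by rewrite mulmx0 mxE.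
rewrite mxE psumr_eq0 => [/allP v0|i _]; last by rewrite mxE -expr2 sqr_ge0.
apply/matrixP => i j; rewrite ord1 mxE; apply/eqP.
by have := v0 i (mem_index_enum _); rewrite mxE -expr2 sqrf_eq0.
Qed.

Lemma bf1_ge0 n (v : 'cV[R]_n) : 0 <= bf 1%:M v v.
Proof. by rewrite /bf mulmx1 mxE sumr_ge0// => i _; rewrite mxE -expr2 sqr_ge0. Qed.

Lemma bf1_gt0 n (v : 'cV[R]_n) : v != 0 -> 0 < bf 1%:M v v.
Proof. by move=> v0; rewrite lt_def bf1_eq0 v0 bf1_ge0. Qed.

(** Over the complex numbers [A] is hermitian, hence unitarily diagonalisable with real spectrum. A
    real eigenvalue makes a real determinant vanish, which gives an eigenvector with real
    entries. *)
Lemma sym_eigenvector n (A : 'M[R]_n.+1) : A^T = A ->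
  exists a (v : 'cV[R]_n.+1), v != 0 /\ A *m v = a *: v.
Proof.
move=> As; pose B := map_mx (real_complex R) A.
have Breal : B \is a mxOver Num.real.
  by apply/mxOverP => i j; rewrite mxE; apply/complex_realP; exists (A i j).
have Bh : B \is @hermitianmx _ n.+1 false Num.conj.
  apply/is_hermitianmxP; rewrite expr0 scale1r; apply/matrixP => i j.
  rewrite [RHS]mxE [X in _ = Num.conj X]mxE.
  have -> : B j i = B i j by rewrite !mxE -{1}As mxE.
  by apply/esym/CrealP; exact: (mxOverP Breal).
have /mxOverP/(_ 0 0)/complex_realP[a da] := hermitian_spectral_diag_real Bh.
have /orthomx_spectralP BE := hermitian_normalmx Bh.
have Pu := spectral_unit B.
have : \det (A - a%:M) == 0.
  apply/eqP/complexI; rewrite -det_map_mx map_mxB map_scalar_mx/= -da -/B.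
  (* A scalar matrix commutes with the unitary factor, so [B] minus the eigenvalue is conjugate to a
     diagonal matrix with a zero entry. *)
  have -> : (spectral_diag B 0 0)%:M = invmx (spectralmx B) *m (spectral_diag B 0 0)%:M *m spectralmx B.
    by rewrite -mulmxA -scalar_mxC mulmxA mulVmx// mul1mx.
  rewrite [X in X - _]BE -mulmxBl -mulmxBr !det_mulmx -diag_const_mx -linearB det_diag/=.
  by rewrite (bigD1 ord0)//= !mxE subrr !(mul0r, mulr0).
case/det0P => w w0 wA; exists a, w^T; split; first by rewrite trmx_eq0.
apply/trmx_inj; rewrite trmx_mul trmxK As linearZ/= trmxK.
by apply/eqP; rewrite -subr_eq0 -mul_mx_scalar -mulmxBr wA.
Qed.

(** The reflection in the hyperplane orthogonal to u - e, with u the unit vector along v and e the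
    first basis vector, exchanges u and e; when u = e the identity serves. *)
Lemma householder n (v : 'cV[R]_n.+1) : v != 0 ->
  exists (H : 'M[R]_n.+1) (c : R),
  [/\ H^T = H, H *m H = 1%:M & H *m delta_mx 0 0 = c *: v].
Proof.
move=> v0; pose c := (Num.sqrt (bf 1%:M v v))^-1.
have [u uE] : exists u, u = c *: v by exists (c *: v).
have [e eE] : exists e : 'cV[R]_n.+1, e = delta_mx 0 0 by eexists.
have uu : bf 1%:M u u = 1.
  rewrite uE bfZl bfZr mulrA -invfM -expr2 sqr_sqrtr ?bf1_ge0//.
  by rewrite mulVf// bf1_eq0.
rewrite -eE; exists (if u == e then 1%:M else 1%:M - (2 / bf 1%:M (u - e) (u - e)) *: ((u - e) *m (u - e)^T)), c.
have ee : bf 1%:M e e = 1 by rewrite eE bf_delta mxE.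
have eu : bf 1%:M e u = bf 1%:M u e by rewrite bfC// trmx1.
rewrite -uE; case: eqVneq => [->|une]; first by rewrite trmx1 !mul1mx.
set w := u - e; set k := bf _ w w.
have k0 : k != 0 by rewrite bf1_eq0 subr_eq0.
have kE : k = 2 - 2 * bf 1%:M u e.
  by rewrite /k /w bfDl !bfDr !(bfNl, bfNr) uu ee eu; lra.
split.
- by rewrite linearB/= linearZ/= trmx_mul trmxK trmx1.
- rewrite mulmxBl !mulmxBr !mulmx1 mul1mx -!scalemxAl -!scalemxAr.
  have -> : w *m w^T *m (w *m w^T) = k *: (w *m w^T).
    have ww : w^T *m w = k%:M by rewrite [LHS]mx11_scalar /k /bf mulmx1.
    rewrite mulmxA -(mulmxA w) ww.
    by rewrite mul_mx_scalar -scalemxAl.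
  rewrite !scalerA -scalerBl -addrA -opprD -scalerDl.
  rewrite (_ : 2 / k + _ = 0) ?scale0r ?subr0//.
  by field.
- rewrite mulmxBl mul1mx -scalemxAl -mulmxA.
  have -> : w^T *m e = (bf 1%:M u e - 1)%:M.
    by rewrite [LHS]mx11_scalar -[w^T]mulmx1 -/(bf _ _ _) /w bfDl bfNl ee.
  rewrite mul_mx_scalar scalerA.
  (* Since |u - e|^2 = 2 - 2 <u, e>, the coefficient of the reflection at e is exactly -1. *)
  have -> : 2 / k * (bf 1%:M u e - 1) = -1.
    by have := k0; rewrite kE => k0'; field.
  by rewrite scaleN1r opprK /w addrC subrK.
Qed.

(** Deflation: conjugating by a reflection that sends the first basis vector to an eigenvector
    clears the first column below the corner, symmetry clears the first row, and induction treats
    the remaining block. *)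
Lemma sym_spectral n (A : 'M[R]_n) : A^T = A ->
  exists (P : 'M[R]_n) d, P *m P^T = 1%:M /\ A = P^T *m diag_mx d *m P.
Proof.
elim: n A => [|n IH] A As.
  by exists 1%:M, 0; split; apply/matrixP; case.
have [a [v [v0 Av]]] := sym_eigenvector As.
have [H [c [Hs HH He]]] := householder v0.
have [B BE0] : exists B : 'M[R]_(1 + n), B = H *m A *m H by eexists.
have Bs : B^T = B by rewrite BE0 !trmx_mul Hs As mulmxA.
have Be : B *m (delta_mx 0 0 : 'cV_n.+1) = a *: delta_mx 0 0.
  rewrite BE0 -!mulmxA He -scalemxAr Av scalerA mulrC -scalerA -He -scalemxAr.
  by rewrite mulmxA HH mul1mx.
have Bl i : B i (lshift n 0) = a * (i == 0)%:R.
  have -> : a * (i == 0)%:R = (a *: (delta_mx 0 0 : 'cV[R]_n.+1)) i 0.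
    by rewrite !mxE andbT.
  by rewrite -Be -colE [RHS]mxE; congr (B _ _); apply/val_inj.
have B00 : ulsubmx B = a%:M.
  by apply/matrixP => i j; rewrite !mxE !ord1 Bl mulr1.
have B10 : dlsubmx B = 0.
  by apply/matrixP => i j; rewrite !mxE !ord1 Bl mulr0.
have B01 : ursubmx B = 0.
  by apply/trmx_inj; rewrite trmx_ursub Bs B10 trmx0.
have [|P1 [d1 [P1P1 AE]]] := IH (drsubmx B); first by rewrite trmx_drsub Bs.
have [P0 P0E] : exists P0 : 'M[R]_(1 + n), P0 = block_mx 1%:M 0 0 P1 by eexists.
have [d0 d0E] : exists d0 : 'rV[R]_(1 + n), d0 = row_mx a%:M d1 by eexists.
have P0P0 : P0 *m P0^T = 1%:M.
  rewrite P0E tr_block_mx !trmx0 trmx1 mulmx_block.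
  by rewrite !(mulmx0, mul0mx, mulmx1, addr0, add0r) P1P1 -scalar_mx_block.
have BE : B = P0^T *m diag_mx d0 *m P0.
  rewrite P0E d0E tr_block_mx diag_mx_row !trmx0 trmx1 !mulmx_block.
  rewrite !(mulmx0, mul0mx, mulmx1, mul1mx, addr0, add0r) -AE -{1}[B]submxK B00 B10 B01.
  congr block_mx; apply/matrixP => i j; rewrite !mxE !ord1 /= mulr1n.
  by rewrite ?mxE ?mulr1n.
exists (P0 *m H), d0; split.
  by rewrite trmx_mul Hs mulmxA -(mulmxA P0) HH mulmx1.
have -> : A = H *m B *m H by rewrite BE0 !mulmxA HH mul1mx -mulmxA HH mulmx1.
by rewrite BE trmx_mul Hs !mulmxA.
Qed.

Lemma pd_psd n (A : 'M[R]_n) : pdmx A -> psdmx A.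
Proof.
move=> [As A0]; split=> // v; have [->|/A0/ltW//] := eqVneq v 0.
by rewrite mulmx0 mxE.
Qed.

Lemma pd_unit n (A : 'M[R]_n) : pdmx A -> A \in unitmx.
Proof.
move=> [As A0]; rewrite unitmxE unitfE; apply/negP => /det0P[w w0 wA].
have := A0 w^T; rewrite trmx_eq0 => /(_ w0).
by rewrite trmxK wA mul0mx mxE ltxx.
Qed.

Lemma pd_congr n (A M : 'M[R]_n) : M \in unitmx ->
  pdmx A -> pdmx (M^T *m A *m M).
Proof.
move=> Mu [As A0]; split; first by rewrite /Defs.symmetricmx !trmx_mul trmxK As mulmxA.
move=> v v0; rewrite -/(bf _ v v) -bf_mulr -bf_mull; apply: A0.
by apply: contra_neq v0 => Mv; rewrite -(mul1mx v) -(mulVmx Mu) -mulmxA Mv mulmx0.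
Qed.

Lemma pd_congrV n (A M : 'M[R]_n) : M \in unitmx ->
  pdmx (M^T *m A *m M) -> pdmx A.
Proof.
move=> Mu /(@pd_congr _ _ (invmx M)); rewrite unitmx_inv => /(_ Mu).
by rewrite trmx_inv !mulmxA mulVmx ?unitmx_tr// mul1mx -mulmxA mulmxV// mulmx1.
Qed.

Lemma pdD n (A B : 'M[R]_n) : pdmx A -> psdmx B -> pdmx (A + B).
Proof.
move=> [As A0] [Bs B0]; split; first by rewrite /Defs.symmetricmx linearD/= As Bs.
by move=> v v0; rewrite -/(bf _ v v) bfAD ltr_wpDr ?A0 ?B0.
Qed.

Lemma pd1 n : pdmx (1%:M : 'M[R]_n).
Proof. by split; [exact: trmx1 | move=> v /bf1_gt0]. Qed.

Lemma spectral_diagE n (P : 'M[R]_n) d i : P *m P^T = 1%:M ->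
  bf (P^T *m diag_mx d *m P) (P^T *m delta_mx i 0) (P^T *m delta_mx i 0) = d 0 i.
Proof.
move=> PP; rewrite bf_mull bf_mulr trmxK !mulmxA PP mul1mx -mulmxA PP mulmx1.
by rewrite bf_delta !mxE eqxx.
Qed.

Lemma psd_sqrt n (A : 'M[R]_n) : psdmx A ->
  exists X, psdmx X /\ X *m X = A.
Proof.
move=> [As A0]; have [P [d [PP AE]]] := sym_spectral As.
have PP' : P^T *m P = 1%:M by apply: mulmx1C.
exists (P^T *m diag_mx (map_mx Num.sqrt d) *m P); split.
  split; first by rewrite /Defs.symmetricmx !trmx_mul trmxK tr_diag_mx mulmxA.
  move=> v; rewrite -/(bf _ v v) -bf_mulr -bf_mull /bf mxE sumr_ge0// => i _.
  by rewrite mul_mx_diag !mxE mulrAC -expr2 mulr_ge0 ?sqr_ge0.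
rewrite !mulmxA -(mulmxA _ P) PP mulmx1 -(mulmxA P^T) AE; congr (_ *m _ *m _).
rewrite mulmx_diag; congr diag_mx; apply/rowP => i; rewrite !mxE -expr2 sqr_sqrtr//.
by rewrite -(spectral_diagE d i PP) -AE; apply: A0.
Qed.

(** Existence of a root unlocks the choice made by [xget]; [sqrtmx] is handled through these two
    properties. *)
Lemma sqrtmxP n (A : 'M[R]_n) : psdmx A ->
  psdmx (sqrtmx A) /\ sqrtmx A *m sqrtmx A = A.
Proof.
by move=> /psd_sqrt[X XA]; rewrite /sqrtmx; case: xgetP => [x _//|/(_ X)/(_ XA)].
Qed.

Lemma psd_unit_pd n (A : 'M[R]_n) : psdmx A -> A \in unitmx -> pdmx A.
Proof.
move=> Ap Au; have [[Xs X0] XX] := sqrtmxP Ap.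
have Xu : sqrtmx A \in unitmx.
  by move: Au; rewrite -{1}XX unitmx_mul andbb.
rewrite -XX -{1}Xs -(mulmx1 (_^T)); exact: pd_congr (pd1 _).
Qed.

Lemma sqrtmx_pd n (A : 'M[R]_n) : pdmx A ->
  pdmx (sqrtmx A) /\ sqrtmx A *m sqrtmx A = A.
Proof.
move=> Ap; have [Xp XX] := sqrtmxP (pd_psd Ap); split=> //.
by apply: psd_unit_pd => //; move: (pd_unit Ap); rewrite -{1}XX unitmx_mul andbb.
Qed.

Lemma pd_det_gt0 n (A : 'M[R]_n) : pdmx A -> 0 < \det A.
Proof.
move=> Ap; have [Xp XX] := sqrtmx_pd Ap.
rewrite -XX det_mulmx -expr2 exprn_even_gt0//=.
by rewrite -unitfE -unitmxE pd_unit.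
Qed.

(** Completing the square in [x]. *)
Lemma schur_form m n (H : 'M[R]_m) (h : 'M[R]_(m, n)) S x v :
  H^T = H -> H \in unitmx ->
  bf H x x + 2 * bf h x v + bf S v v =
  bf H (x + invmx H *m h *m v) (x + invmx H *m h *m v)
  + bf (S - h^T *m invmx H *m h) v v.
Proof.
move=> Hs Hu; rewrite bfDl !bfDr bfAD bfAN.
rewrite (bfC _ x Hs) !bf_mulr bf_mull !mulmxA mulmxV// mul1mx.
rewrite trmx_mul trmx_inv Hs -!mulmxA mulKVmx// !mulmxA; lra.
Qed.

(** [P] is the infimum of the two forms over the decompositions a + b = v. At the minimiser A a = B
    b = P v, and a deviation by c and -c adds the nonnegative term c^T (A + B) c. *)
Lemma parallel_sum n (A B : 'M[R]_n) : pdmx A -> pdmx B ->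
  let P := A *m invmx (A + B) *m B in
  [/\ P^T = P,
      forall a b, bf P (a + b) (a + b) <= bf A a a + bf B b b &
      forall v, exists a b, a + b = v /\ bf A a a + bf B b b = bf P v v].
Proof.
move=> Ap Bp P; have [[As A0] [Bs B0]] := (Ap, Bp).
pose D := A + B; have Du : D \in unitmx by apply/pd_unit/pdD => //; apply: pd_psd.
have Ds : D^T = D by rewrite linearD/= As Bs.
(* The second expression for [P] gives its symmetry and the value of [B] at the minimiser. *)
have PE : P = B *m invmx D *m A.
  rewrite /P -/D; have -> : B = D - A by rewrite /D addrC addKr.
  by rewrite mulmxBr !mulmxBl mulmxV// mul1mx -[A *m _ *m D]mulmxA mulVmx// mulmx1.
have Ps : P^T = P by rewrite {2}PE /P !trmx_mul trmx_inv Ds As Bs mulmxA.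
pose a0 (v : 'cV[R]_n) := invmx D *m B *m v.
pose b0 (v : 'cV[R]_n) := invmx D *m A *m v.
have ab v : a0 v + b0 v = v.
  by rewrite /a0 /b0 -!mulmxDl -mulmxDr addrC -/D mulVmx// mul1mx.
have Aa v w : bf A w (a0 v) = bf P w v by rewrite bf_mulr !mulmxA.
have Bb v w : bf B w (b0 v) = bf P w v by rewrite PE bf_mulr !mulmxA.
have Pab v : bf A (a0 v) (a0 v) + bf B (b0 v) (b0 v) = bf P v v.
  by rewrite Aa Bb -bfDl ab.
split=> //; last by move=> v; exists (a0 v), (b0 v).
move=> a b; set v := a + b.
have [c cE] : exists c, c = a - a0 v by eexists.
have -> : a = a0 v + c by rewrite cE addrC subrK.
have -> : b = b0 v - c.
  by rewrite cE opprB addrA [b0 v + _]addrC ab /v addrC addKr.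
rewrite -Pab !bfDl !bfDr !(bfNl, bfNr) opprK.
rewrite (bfC (a0 v) c As) (bfC (b0 v) c Bs) !Aa !Bb.
have Ac : 0 <= bf A c c := (pd_psd Ap).2 c.
have Bc : 0 <= bf B c c := (pd_psd Bp).2 c.
lra.
Qed.

End RealSymmetric.

(** * Hankel forms and the range of the next moment *)

Section HankelForms.
Variables (R : realType) (p : nat).
Implicit Types (F S : nat -> 'M[R]_p) (x y : nat -> 'cV[R]_p).

(** The moment functional of [F] on the product of the vector polynomials with coefficients x_i and
    y_j. Coefficients are functions on [nat], so that degrees can change without casts. *)
Definition hform r F x y : R := \sum_(i < r) \sum_(j < r) bf (F (i + j)%N) (x i) (y j).

Lemma hformDl r F x x' y :
  hform r F (fun i => x i + x' i) y = hform r F x y + hform r F x' y.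
Proof.
rewrite /hform -big_split; apply: eq_bigr => i _; rewrite -big_split.
by apply: eq_bigr => j _; rewrite bfDl.
Qed.

Lemma hformDr r F x y y' :
  hform r F x (fun i => y i + y' i) = hform r F x y + hform r F x y'.
Proof.
rewrite /hform -big_split; apply: eq_bigr => i _; rewrite -big_split.
by apply: eq_bigr => j _; rewrite bfDr.
Qed.

Lemma hformNr r F x y : hform r F x (fun i => - y i) = - hform r F x y.
Proof.
rewrite /hform -sumrN; apply: eq_bigr => i _; rewrite -sumrN.
by apply: eq_bigr => j _; rewrite bfNr.
Qed.

Lemma hformNl r F x y : hform r F (fun i => - x i) y = - hform r F x y.
Proof.
rewrite /hform -sumrN; apply: eq_bigr => i _; rewrite -sumrN.
by apply: eq_bigr => j _; rewrite bfNl.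
Qed.

Lemma hformB r F F' x y :
  hform r (fun t => F t - F' t) x y = hform r F x y - hform r F' x y.
Proof.
rewrite /hform -sumrB; apply: eq_bigr => i _; rewrite -sumrB.
by apply: eq_bigr => j _; rewrite bfAD bfAN.
Qed.

Lemma hform_widen r N F x y : (r <= N)%N ->
  (forall i, (r <= i)%N -> x i = 0) -> (forall i, (r <= i)%N -> y i = 0) ->
  hform N F x y = hform r F x y.
Proof.
move=> rN x0 y0; rewrite /hform.
rewrite (big_ord_widen N (fun i => \sum_(j < r) bf (F (i + j)%N) (x i) (y j)) rN).
rewrite [RHS]big_mkcond; apply: eq_bigr => i _; case: ltnP => [ir|/x0->]; last first.
  by rewrite big1// => j _; rewrite bf0l.
rewrite (big_ord_widen N (fun j => bf (F (i + j)%N) (x i) (y j)) rN).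
rewrite [RHS]big_mkcond; apply: eq_bigr => j _; case: ltnP => [//|/y0->].
by rewrite bf0r.
Qed.

(** Multiplication of a vector polynomial by t. *)
Definition shift x := fun i => if i is i'.+1 then x i' else 0.

(** Multiplying one argument by t amounts to weighting the functional by t; the vanishing top
    coefficient keeps the product within the truncation. *)
Lemma hform_shiftl N F x y : x N = 0 ->
  hform N.+1 F (shift x) y = hform N.+1 (fun t => F t.+1) x y.
Proof.
move=> xN; rewrite /hform big_ord_recl/= big1 ?add0r; last by move=> j _; rewrite bf0l.
rewrite [RHS]big_ord_recr/= [X in _ = _ + X]big1 ?addr0//.
by move=> j _; rewrite xN bf0l.
Qed.

Lemma hform_shiftr N F x y : y N = 0 ->
  hform N.+1 F x (shift y) = hform N.+1 (fun t => F t.+1) x y.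
Proof.
move=> yN; rewrite /hform; apply: eq_bigr => i _.
rewrite big_ord_recl/= bf0r add0r big_ord_recr/= yN bf0r addr0.
by apply: eq_bigr => j _; rewrite /= /bump/= add1n addnS.
Qed.

Definition posform r F := forall x, (exists2 i, (i < r)%N & x i != 0) -> 0 < hform r F x x.

Definition block r x : 'cV[R]_(\sum_(i < r) p) := \mxcol_(i < r) x i.

Lemma bf_hankel r F x y : bf (hankel r F) (block r x) (block r y) = hform r F x y.
Proof.
rewrite /bf /hankel /block -mulmxA mul_mxblock_mxrow tr_mxcol mul_mxrow_mxcol.
rewrite summxE; apply: eq_bigr => i _; rewrite mulmx_sumr summxE.
by apply: eq_bigr => j _; rewrite /bf mulmxA.
Qed.

Lemma bf_bcol r F x v : bf (bcol r F) (block r x) v = \sum_(i < r) bf (F i) (x i) v.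
Proof.
by rewrite /bf /block /bcol tr_mxcol mul_mxrow_mxcol mulmx_suml summxE.
Qed.

Lemma blockP r (X : 'cV[R]_(\sum_(i < r) p)) : exists x,
  X = block r x /\ forall i, (r <= i)%N -> x i = 0.
Proof.
exists (fun i => if insub i is Some j then submxcol X j else 0); split.
  rewrite -[LHS]submxcolK /block; apply/eq_mxcol => i.
  by rewrite valK.
by move=> i ri; rewrite insubF// ltnNge ri.
Qed.

Lemma hankel_sym r F : (forall t, (F t)^T = F t) -> (hankel r F)^T = hankel r F.
Proof.
by move=> Fs; rewrite /hankel tr_mxblock; apply/eq_mxblock => i j; rewrite Fs addnC.
Qed.

Lemma hankel_pd r F : (forall t, (F t)^T = F t) -> posform r F -> pdmx (hankel r F).
Proof.
move=> Fs Fp; split; first exact: hankel_sym.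
move=> X X0; have [x [XE _]] := blockP X.
rewrite -/(bf _ X X) XE bf_hankel; apply: Fp.
have [/existsP[i xi]|/existsPn x0] := boolP [exists i : 'I_r, x i != 0].
  by exists i.
case/eqP: X0; rewrite XE -[0]submxcolK; apply/eq_mxcol => i.
have /negP/negP := x0 i; rewrite negbK => /eqP->; apply/matrixP => a b; by rewrite !mxE.
Qed.

Lemma hform_recr r F x : (forall t, (F t)^T = F t) -> hform r.+1 F x x =
  bf (hankel r F) (block r x) (block r x)
  + 2 * bf (bcol r (fun i => F (r + i)%N)) (block r x) (x r)
  + bf (F (r + r)%N) (x r) (x r).
Proof.
move=> Fs; rewrite bf_hankel bf_bcol /hform big_ord_recr/=.
under eq_bigr do rewrite big_ord_recr/=.
rewrite big_split/= [X in _ + X = _]big_ord_recr/= !addrA.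
congr (_ + _); rewrite -addrA; congr (_ + _).
rewrite mulr_natl mulr2n; congr (_ + _); apply: eq_bigr => i _.
  by rewrite addnC.
by rewrite (bfC _ _ (Fs _)).
Qed.

(* [A] is the Schur complement of the last block: the minimum of the form over
   vector polynomials of degree [r] with prescribed leading coefficient. *)
Definition hmin r F (A : 'M[R]_p) := [/\ A^T = A,
  forall x, bf A (x r) (x r) <= hform r.+1 F x x &
  forall v, exists x, [/\ x r = v, forall i, (r < i)%N -> x i = 0 &
    hform r.+1 F x x = bf A v v]].

(** The square is completed in the coefficients below the leading one; the minimiser has lower
    coefficients -H^-1 h v. *)
Lemma schur_hmin r F : (forall t, (F t)^T = F t) -> posform r F ->
  let h := bcol r (fun i => F (r + i)%N) in
  hmin r F (F (r + r)%N - h^T *m invmx (hankel r F) *m h).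
Proof.
move=> Fs Fp h; have Hp := hankel_pd Fs Fp; have Hu := pd_unit Hp.
have Hs := hankel_sym r Fs.
split.
- by rewrite linearB/= !trmx_mul trmxK trmx_inv Hs Fs mulmxA.
- move=> x; rewrite hform_recr// schur_form// lerDr.
  exact: (pd_psd Hp).2.
- move=> v; have [x [xE x0]] := blockP (- (invmx (hankel r F) *m h *m v)).
  pose y i := if (i < r)%N then x i else if i == r then v else 0.
  have yx : block r y = block r x.
    by apply/eq_mxcol => i; rewrite /y ltn_ord.
  have yr : y r = v by rewrite /y ltnn eqxx.
  exists y; split=> //.
    by move=> i ri; rewrite /y ltnNge ltnW//= gtn_eqF.
  rewrite hform_recr// schur_form// yx -xE yr addNr bf0l add0r.
  by [].
Qed.

(** Either the leading coefficient is nonzero and the Schur complement bounds the form from below,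
    or the polynomial has smaller degree. *)
Lemma hmin_pos r F A : hmin r F A -> posform r F -> pdmx A -> posform r.+1 F.
Proof.
move=> [As Amin _] Fp [_ Ap] x [i ir xi].
have [xr|xr] := eqVneq (x r) 0; last first.
  by apply: lt_le_trans (Amin x); apply: Ap.
have : hform r.+1 F x x = hform r F x x.
  rewrite /hform big_ord_recr/= [X in _ + X]big1 ?addr0; last first.
    by move=> j _; rewrite xr bf0l.
  by apply: eq_bigr => j _; rewrite big_ord_recr/= xr bf0r addr0.
move=> ->; apply: Fp; exists i => //.
by move: ir; rewrite ltnS leq_eqVlt => /orP[/eqP ir|//]; rewrite ir xr eqxx in xi.
Qed.

Lemma hmin0 F : (forall t, (F t)^T = F t) -> hmin 0 F (F 0).
Proof.
move=> Fs; have E x : hform 1 F x x = bf (F 0%N) (x 0%N) (x 0%N).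
  by rewrite /hform !big_ord1.
split=> // [x|v]; first by rewrite E.
by exists (fun i => if i == 0%N then v else 0); split=> // -[].
Qed.

Lemma posform0 F : posform 0 F.
Proof. by move=> x []. Qed.

(** The lower form carries the weight t for odd k and 1 for even k, the upper one 1 - t and t (1 -
    t): the four Hankel families of [0, 1]. *)
Definition lowF S k := if odd k then fun t => S t.+1 else fun t => S t.
Definition upF S k := if odd k then fun t => S t - S t.+1 else fun t => S t.+1 - S t.+2.

Lemma lowF_sym S k : (forall t, (S t)^T = S t) -> forall t, (lowF S k t)^T = lowF S k t.
Proof. by move=> Ss t; rewrite /lowF; case: ifP. Qed.

Lemma upF_sym S k : (forall t, (S t)^T = S t) -> forall t, (upF S k t)^T = upF S k t.
Proof. by move=> Ss t; rewrite /upF; case: ifP => _; rewrite linearB/= !Ss. Qed.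

Lemma Smin_hmin S k : (forall t, (S t)^T = S t) -> (0 < k)%N ->
  posform k./2 (lowF S k) -> hmin k./2 (lowF S k) (S k - Smin S k).
Proof.
move=> Ss; case: k => [//|[|n]] _ Fp.
  by rewrite subr0; exact: (@hmin0 (lowF S 1) (lowF_sym 1 Ss)).
have := schur_hmin (lowF_sym n.+2 Ss) Fp.
have := odd_double_half n.+2; rewrite -addnn /Smin /lowF.
have -> : odd n.+2 = ~~ odd n.+1 by [].
case on: (odd n.+1); rewrite /= ?add0n ?add1n => kE.
  by rewrite kE.
have on' : odd n by move: on => /=; case: odd.
have -> : uphalf n = n./2.+1 by rewrite uphalf_half on'.
by rewrite kE.
Qed.

(** For even k the degree is one less than that of the lower form, the weight t (1 - t) consuming
    two more moments; [(uphalf k).-1] covers both parities. *)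
Lemma Smax_hmin S k : (forall t, (S t)^T = S t) -> S 0%N = 1%:M -> (0 < k)%N ->
  posform (uphalf k).-1 (upF S k) -> hmin (uphalf k).-1 (upF S k) (Smax S k - S k).
Proof.
move=> Ss S0; case: k => [//|[|n]] _ Fp.
  by rewrite /= -S0; exact: (@hmin0 (upF S 1) (upF_sym 1 Ss)).
have := schur_hmin (upF_sym n.+2 Ss) Fp.
have := odd_double_half n.+1; rewrite -addnn /Smax /upF.
have -> : odd n.+2 = ~~ odd n.+1 by [].
have -> : (uphalf n.+2).-1 = n.+1./2 by [].
case on: (odd n.+1); rewrite /negb ?add0n ?add1n => kE.
  have -> : n.+2./2.-1 = n.+1./2 by rewrite -[n.+2./2]/(uphalf n.+1) uphalf_half on.
  have -> : n.+2./2 = n.+1./2.+1 by rewrite -[n.+2./2]/(uphalf n.+1) uphalf_half on.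
  by rewrite kE addrAC.
by rewrite kE addrAC.
Qed.

(* With [W = F - G] and [E = G + t W] this is the polynomial identity
   [t F^2 + (1 - t) G^2 = E^2 + t (1 - t) W^2] under the moment functional. *)
Lemma hform_even_odd N S x y : (forall i, (N <= i)%N -> x i = 0) ->
  (forall i, (N <= i)%N -> y i = 0) ->
  let w i := x i - y i in let e i := y i + shift w i in
  hform N.+2 (fun t => S t.+1) x x + hform N.+2 (fun t => S t - S t.+1) y y =
  hform N.+2 S e e + hform N.+2 (fun t => S t.+1 - S t.+2) w w.
Proof.
move=> x0 y0 w e; have w0 : w N.+1 = 0 by rewrite /w x0 ?y0 ?subr0.
have y0' : y N.+1 = 0 by rewrite y0.
rewrite !hformB.
rewrite -(@hform_shiftr _ (fun t => S t.+1) w w w0) -(@hform_shiftl _ S w (shift w) w0).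
rewrite {}/e hformDl !hformDr.
rewrite (hform_shiftl S y w0) (hform_shiftr S y w0).
set B := hform N.+2 S (shift w) (shift w).
rewrite /w !hformDl !hformDr !hformNl !hformNr; lra.
Qed.

(** The preceding identity with each form cut to the degree its argument really has. Taking [w] and
    [e] up to equality makes it usable both from (F, G) and from (E, W). *)
Lemma hform_trade N c d S x y w e : w = (fun i => x i - y i) ->
  e = (fun i => y i + shift w i) ->
  (c <= N.+1)%N -> (d <= N)%N ->
  (forall i, (N <= i)%N -> x i = 0) -> (forall i, (N <= i)%N -> y i = 0) ->
  (forall i, (c <= i)%N -> e i = 0) -> (forall i, (d <= i)%N -> w i = 0) ->
  hform N (fun t => S t.+1) x x + hform N (fun t => S t - S t.+1) y y =
  hform c S e e + hform d (fun t => S t.+1 - S t.+2) w w.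
Proof.
move=> wE eE cN dN x0 y0 e0 w0; have := hform_even_odd S x0 y0.
rewrite /= -wE -eE.
have NN : (N <= N.+2)%N by rewrite !leqW.
rewrite (hform_widen _ (leqW cN) e0 e0) (hform_widen _ (leq_trans dN NN) w0 w0).
by rewrite (hform_widen _ NN x0 x0) (hform_widen _ NN y0 y0).
Qed.

(** * Recursion for the length of the moment range *)

Definition gap S k := Smax S k - Smin S k.

(** Quadratic forms are compared by two inequalities: the minimisers of either side become, through
    [hform_trade], competitors for the other. Towards k + 1 both competitors have leading
    coefficient v; on the way back their leading coefficients have difference v, hence the sign
    change [BN]. *)
Lemma gap_rec S k : (forall t, (S t)^T = S t) -> S 0%N = 1%:M -> (0 < k)%N ->
  posform k./2 (lowF S k) -> posform (uphalf k).-1 (upF S k) ->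
  posform k.+1./2 (lowF S k.+1) -> posform (uphalf k.+1).-1 (upF S k.+1) ->
  pdmx (S k - Smin S k) -> pdmx (Smax S k - S k) ->
  gap S k.+1 = (S k - Smin S k) *m invmx (gap S k) *m (Smax S k - S k).
Proof.
move=> Ss S0 k0 lk uk lk1 uk1.
have [_ Amin Aex] := Smin_hmin Ss k0 lk.
have [_ Bmin Bex] := Smax_hmin Ss S0 k0 uk.
have [A1s A1min A1ex] := Smin_hmin Ss (ltn0Sn k) lk1.
have [B1s B1min B1ex] := Smax_hmin Ss S0 (ltn0Sn k) uk1.
have -> : gap S k.+1 = (S k.+1 - Smin S k.+1) + (Smax S k.+1 - S k.+1).
  by rewrite /gap [RHS]addrC addrA subrK.
have -> : gap S k = (S k - Smin S k) + (Smax S k - S k).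
  by rewrite /gap [RHS]addrC addrA subrK.
set A := S k - _ in Amin Aex *; set B := _ - S k in Bmin Bex *.
set A1 := S k.+1 - _ in A1s A1min A1ex *; set B1 := _ - S k.+1 in B1s B1min B1ex *.
move=> Ap Bp; have [Ps Pmin Pex] := parallel_sum Ap Bp.
set P := A *m _ *m _ in Ps Pmin Pex *.
apply: sym_bf_inj => //; first by rewrite linearD/= A1s B1s.
move=> v; rewrite bfAD; apply/eqP; rewrite eq_le; apply/andP.
have kE := odd_double_half k.
have uE : uphalf k = (odd k + k./2)%N by rewrite uphalf_half.
have k1E : k.+1./2 = (odd k + k./2)%N by rewrite -uE.
have u1E : (uphalf k.+1).-1 = k./2 by [].
rewrite uE in Bmin Bex uk.
rewrite k1E in A1min A1ex lk1; rewrite u1E in B1min B1ex uk1.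
have BN w : bf B (- w) (- w) = bf B w w by rewrite bfNl bfNr opprK.
move: Amin Aex Bmin Bex A1min A1ex B1min B1ex; rewrite /lowF /upF /=.
case: (odd k) kE => /= kE; rewrite ?add0n ?add1n /=;
  set m := k./2 in kE *; move=> Amin Aex Bmin Bex A1min A1ex B1min B1ex; split.
(* Odd k: F leads with a and G with -b, so both W = F - G and E = G + t W lead with a + b. *)
- have [a [b [<- <-]]] := Pex v.
  have [x [xm x0 <-]] := Aex a; have [y [ym y0 yE]] := Bex (- b).
  rewrite -(BN b) -yE.
  pose w i := x i - y i; pose e i := y i + shift w i.
  have w0 i : (m.+1 <= i)%N -> w i = 0 by move=> im; rewrite /w x0// y0// subrr.
  rewrite (@hform_trade m.+1 m.+2 m.+1 S x y w e erefl erefl)//; last first.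
    by move=> [//|i] im; rewrite /e /= y0 ?add0r ?w0// ltnW.
  have wm : w m = a + b by rewrite /w xm ym opprK.
  have em : e m.+1 = a + b by rewrite /e /= wm y0// add0r.
  by rewrite -{1 2}em -wm lerD// A1min.
(* The inverse substitution is G = E - t W, F = G + W. The leading terms of E and t W are both v
   t^(m+1) and cancel, so F and G have degree at most m. *)
- have [x [xm x0 <-]] := A1ex v; have [y [ym y0 <-]] := B1ex v.
  pose F i := x i + y i - shift y i; pose G i := x i - shift y i.
  have F0 i : (m.+1 <= i)%N -> F i = 0.
    move=> im; rewrite /F y0// addr0; case: i im => // i.
    rewrite ltnS leq_eqVlt => /orP[/eqP<-/=|im]; first by rewrite xm ym subrr.
    by rewrite x0//= y0// subrr.
  have G0 i : (m.+1 <= i)%N -> G i = 0.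
    by move=> im; rewrite /G -(F0 _ im) /F y0// addr0.
  have w i : F i - G i = y i by rewrite /F /G opprB addrA subrK addrC addKr.
  rewrite -(@hform_trade m.+1 m.+2 m.+1 S F G y x)//; last 2 first.
    by apply/funext => i; rewrite w.
    by apply/funext => i; rewrite /G subrK.
  have -> : v = F m + - G m by rewrite w ym.
  by apply: le_trans (Pmin _ _) _; rewrite BN lerD.
(* Even k: the pair at k is (E, W) and the pair at k + 1 is (F, G). W has degree one less than E,
   and k > 0 rules out m = 0. *)
- have [a [b [<- <-]]] := Pex v.
  case: m => [|m] in kE Amin Aex Bmin Bex A1min A1ex B1min B1ex *; first by rewrite -kE in k0.
  have [x [xm x0 <-]] := Aex a; have [y [ym y0 yE]] := Bex (- b).
  rewrite -(BN b) -yE.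
  pose F i := x i + y i - shift y i; pose G i := x i - shift y i.
  have F0 i : (m.+2 <= i)%N -> F i = 0.
    by case: i => // i im; rewrite /F x0//= !y0// ?addr0 ?subrr// ltnW.
  have G0 i : (m.+2 <= i)%N -> G i = 0.
    by case: i => // i im; rewrite /G x0//= !y0// subrr.
  have w i : F i - G i = y i by rewrite /F /G opprB addrA subrK addrC addKr.
  rewrite -(@hform_trade m.+2 m.+2 m.+1 S F G y x)//; last 2 first.
    by apply/funext => i; rewrite w.
    by apply/funext => i; rewrite /G subrK.
  have Fm : F m.+1 = a + b by rewrite /F /= y0// addr0 xm ym opprK.
  have Gm : G m.+1 = a + b by rewrite /G /= xm ym opprK.
  by rewrite -{1 2}Fm -Gm lerD.
(* F and G share the leading coefficient v, so W drops a degree and the leading coefficients of E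
   and W differ by v. *)
- have [x [xm x0 <-]] := A1ex v; have [y [ym y0 <-]] := B1ex v.
  case: m => [|m] in kE Amin Aex Bmin Bex A1min A1ex B1min B1ex x0 y0 xm ym *; first by rewrite -kE in k0.
  pose w i := x i - y i.
  have w0 i : (m.+1 <= i)%N -> w i = 0.
    rewrite /w leq_eqVlt => /orP[/eqP<-|im]; first by rewrite xm ym subrr.
    by rewrite x0// y0// subrr.
  rewrite (@hform_trade m.+2 m.+2 m.+1 S x y w _ erefl erefl)//; last first.
    by move=> [//|i] im; rewrite y0//= w0// addr0.
  have -> : v = (y m.+1 + shift w m.+1) + - w m by rewrite /= ym addrK.
  by apply: le_trans (Pmin _ _) _; rewrite BN lerD// Amin.
Qed.

Lemma gap_pd S k : pdmx (S k - Smin S k) -> pdmx (Smax S k - S k) -> pdmx (gap S k).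
Proof.
move=> Ap Bp; have -> : gap S k = (S k - Smin S k) + (Smax S k - S k).
  by rewrite /gap [RHS]addrC addrA subrK.
by apply: pdD => //; exact: pd_psd.
Qed.

Definition interior_upto S k := forall j, (0 < j <= k)%N ->
  pdmx (S j - Smin S j) /\ pdmx (Smax S j - S j).

(** Induction in steps of two: k and k + 2 carry the same weights, and the definite Schur
    complements at k + 2 extend both forms by one degree. *)
Lemma interior_pos S k : (forall t, (S t)^T = S t) -> S 0%N = 1%:M ->
  interior_upto S k ->
  posform k./2.+1 (lowF S k) /\ posform (uphalf k) (upF S k).
Proof.
move=> Ss S0; elim/ltn_ind: k => -[_ _|k IH ik].
  split; last exact: posform0.
  by apply: (hmin_pos (hmin0 Ss)); [exact: posform0 | rewrite S0; exact: pd1].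
have [Ap Bp] := ik k.+1 (leqnn _).
have [lk uk] : posform k.+1./2 (lowF S k.+1) /\ posform (uphalf k.+1).-1 (upF S k.+1).
  case: k IH ik {Ap Bp} => [_ _|k IH ik]; first by split; exact: posform0.
  have [lk uk] : posform k./2.+1 (lowF S k) /\ posform (uphalf k) (upF S k).
    by apply: IH => // j /andP[j0 jk]; apply: ik; rewrite j0/= (leq_trans jk)// leqW.
  by rewrite /lowF /upF /= negbK; split.
split; first exact: (hmin_pos (Smin_hmin Ss (ltn0Sn k) lk)).
by have := hmin_pos (Smax_hmin Ss S0 (ltn0Sn k) uk) uk Bp; rewrite prednK.
Qed.

Lemma interior_prev S k : (forall t, (S t)^T = S t) -> S 0%N = 1%:M ->
  interior_upto S k ->
  posform k.+1./2 (lowF S k.+1) /\ posform (uphalf k.+1).-1 (upF S k.+1).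
Proof.
case: k => [|k] Ss S0 ik; first by split; exact: posform0.
have [] := @interior_pos S k Ss S0.
  by move=> j /andP[j0 jk]; apply: ik; rewrite j0 leqW.
by rewrite /lowF /upF /= negbK; split.
Qed.

(** Determinants are taken in [gap_rec]. The parallel sum is nonnegative as a minimum of nonnegative
    forms, and the identity makes its determinant nonzero, hence it is definite. *)
Lemma det_gap S k : (forall t, (S t)^T = S t) -> S 0%N = 1%:M -> (0 < k)%N ->
  interior_upto S k ->
  pdmx (gap S k.+1) /\
  \det (gap S k.+1) * \det (gap S k) = \det (S k - Smin S k) * \det (Smax S k - S k).
Proof.
move=> Ss S0 k0 ik; have [Ap Bp] := ik k (introT andP (conj k0 (leqnn k))).
have [lk uk] : posform k./2 (lowF S k) /\ posform (uphalf k).-1 (upF S k).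
  case: k k0 ik {Ap Bp} => // k _ ik; apply: interior_prev => // j /andP[j0 jk].
  by apply: ik; rewrite j0 leqW.
have [lk1 uk1] := interior_prev Ss S0 ik.
have Gp := gap_pd Ap Bp; have Gu := pd_unit Gp.
have [A1s A1min A1ex] := Smin_hmin Ss (ltn0Sn k) lk1.
have [B1s B1min B1ex] := Smax_hmin Ss S0 (ltn0Sn k) uk1.
have gE := gap_rec Ss S0 k0 lk uk lk1 uk1 Ap Bp.
have dE : \det (gap S k.+1) * \det (gap S k) = \det (S k - Smin S k) * \det (Smax S k - S k).
  rewrite gE !det_mulmx -!mulrA; congr (_ * _).
  by rewrite mulrCA -det_mulmx mulVmx// det1 mulr1.
split=> //; apply: psd_unit_pd; last first.
  rewrite unitmxE unitfE; apply: contraTneq (mulr_gt0 (pd_det_gt0 Ap) (pd_det_gt0 Bp)).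
  by rewrite -dE => ->; rewrite mul0r ltxx.
have gs : gap S k.+1 = (S k.+1 - Smin S k.+1) + (Smax S k.+1 - S k.+1).
  by rewrite /gap [RHS]addrC addrA subrK.
have gE' : gap S k = (S k - Smin S k) + (Smax S k - S k).
  by rewrite /gap [RHS]addrC addrA subrK.
split; first by rewrite /Defs.symmetricmx gs linearD/= A1s B1s.
move=> v; rewrite -/(bf _ v v) gE gE'; have [_ _ /(_ v)[a [b [_ <-]]]] := parallel_sum Ap Bp.
by apply: addr_ge0; [exact: (pd_psd Ap).2|exact: (pd_psd Bp).2].
Qed.

End HankelForms.

(** * Iterated Lebesgue integrals *)

Section Tonelli.
Variable R : realType.
Local Open Scope ereal_scope.
Local Notation mu := (@lebesgue_measure R).

(* A nonnegative functional that behaves like integration against a sigma-finite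
   measure, including exchange with a one-dimensional Lebesgue integral.
   Monotonicity is required of all functions, measurable or not. *)
Record tonelli d (T : measurableType d) (I : (T -> \bar R) -> \bar R) : Prop := {
  ton_le : forall f g : T -> \bar R, (forall x, 0 <= f x) -> (forall x, f x <= g x) -> I f <= I g;
  tonD : forall f g : T -> \bar R, (forall x, 0 <= f x) -> (forall x, 0 <= g x) ->
    measurable_fun setT f -> measurable_fun setT g ->
    I (fun x => f x + g x) = I f + I g;
  tonZ : forall c (f : T -> \bar R), 0 <= c -> (forall x, 0 <= f x) -> measurable_fun setT f ->
    I (fun x => c * f x) = c * I f;
  ton_meas : forall d' (T' : measurableType d') (g : T' * T -> \bar R),
    (forall x, 0 <= g x) -> measurable_fun setT g ->
    measurable_fun setT (fun x => I (fun y => g (x, y)));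
  ton_leb : forall g : R * T -> \bar R,
    (forall x, 0 <= g x) -> measurable_fun setT g ->
    \int[mu]_x I (fun y => g (x, y)) = I (fun y => \int[mu]_x g (x, y)) }.

(** The integral of a nonnegative function is a supremum over the simple functions below it, which
    is monotone without measurability. This admits sets of unknown measurability in the volume
    estimates. *)
Lemma ge0_le_integral_nomeas d (T : measurableType d) (m : {measure set T -> \bar R})
  (f g : T -> \bar R) : (forall x, 0 <= f x) -> (forall x, f x <= g x) ->
  \int[m]_x f x <= \int[m]_x g x.
Proof.
move=> f0 fg; have g0 x : 0 <= g x by exact: le_trans (fg x).
rewrite !ge0_integralTE//; apply: ereal_sup_le => _ [h hf <-].
by exists h => // x; exact: le_trans (hf x) (fg x).
Qed.

Lemma tonelli_lebesgue : tonelli (fun g : R -> \bar R => \int[mu]_x g x).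
Proof.
split.
- by move=> f g f0 fg; exact: ge0_le_integral_nomeas.
- by move=> f g f0 g0 mf mg; rewrite ge0_integralD.
- by move=> c f c0 f0 mf; rewrite ge0_integralZl.
- by move=> d' T' g g0 mg; exact: measurable_fun_fubini_tonelli_F.
- by move=> g g0 mg; rewrite fubini_tonelli.
Qed.

Section TonelliTheory.
Context d (T : measurableType d) (I : (T -> \bar R) -> \bar R).
Hypothesis tI : tonelli I.

Lemma ton_cst0 : I (fun=> 0) = 0.
Proof.
have := tonZ tI (lexx 0) (fun x : T => lexx (0 : \bar R)) (measurable_cst _).
by rewrite !mul0e.
Qed.

Lemma ton_ge0 f : (forall x, 0 <= f x) -> 0 <= I f.
Proof. by move=> f0; rewrite -ton_cst0; apply: (ton_le tI). Qed.

End TonelliTheory.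

Lemma measurable_cons_tuple d d' (T : measurableType d) (T' : measurableType d') N
    (f : T' -> T) (g : T' -> N.-tuple T) :
  measurable_fun setT f -> measurable_fun setT g ->
  measurable_fun setT (fun x => cons_tuple (f x) (g x)).
Proof.
move=> mf mg; have := measurable_cons mf mg.
by apply: eq_measurable_fun => x _; exact/val_inj.
Qed.

Lemma iter_ge0 d (T : measurableType d) (I : (T -> \bar R) -> \bar R) N g :
  tonelli I -> (forall x, 0 <= g x) -> 0 <= iter_int I (N := N) g.
Proof.
move=> tI; elim: N g => [|N IH] g g0 /=; first exact: g0.
by apply: ton_ge0 => // x; apply: IH.
Qed.

(** The parameter space is arbitrary because the induction moves one coordinate after the other into
    it. *)
Lemma iter_meas d (T : measurableType d) (I : (T -> \bar R) -> \bar R) N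
    d' (T' : measurableType d') (g : T' * N.-tuple T -> \bar R) :
  tonelli I -> (forall x, 0 <= g x) -> measurable_fun setT g ->
  measurable_fun setT (fun x => iter_int I (fun y => g (x, y))).
Proof.
move=> tI; elim: N d' T' g => [|N IH] d' T' g g0 mg /=.
  by apply: (measurableT_comp mg).
apply: (ton_meas tI (g := fun xy => iter_int I (fun t => g (xy.1, cons_tuple xy.2 t)))).
  by move=> x; apply: iter_ge0.
apply: (IH _ _ (fun z : (T' * T) * N.-tuple T => g (z.1.1, cons_tuple z.1.2 z.2))) => //.
apply: (measurableT_comp mg); apply: measurable_fun_pair => /=.
  exact: measurableT_comp.
by apply: measurable_cons_tuple => //; exact: measurableT_comp.
Qed.

Lemma iter_le d (T : measurableType d) (I : (T -> \bar R) -> \bar R) N f g :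
  tonelli I -> (forall x, 0 <= f x) -> (forall x, f x <= g x) ->
  iter_int I (N := N) f <= iter_int I g.
Proof.
move=> tI; elim: N f g => [|N IH] f g f0 fg /=; first exact: fg.
by apply: (ton_le tI) => x; [exact: iter_ge0|exact: IH].
Qed.

Lemma measurable_consl d (T : measurableType d) N (x : T) :
  measurable_fun setT (fun t : N.-tuple T => cons_tuple x t).
Proof.
exact: measurable_cons_tuple.
Qed.

Lemma measurable_int_consl d (T : measurableType d) (I : (T -> \bar R) -> \bar R)
    N (g : N.+1.-tuple T -> \bar R) :
  tonelli I -> (forall x, 0 <= g x) -> measurable_fun setT g ->
  measurable_fun setT (fun x => iter_int I (fun t => g (cons_tuple x t))).
Proof.
move=> tI g0 mg; apply: (@iter_meas _ _ _ _ _ _ (fun z => g (cons_tuple z.1 z.2))) => //.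
by apply: (measurableT_comp mg); exact: measurable_cons_tuple.
Qed.

Lemma tonelli_iter d (T : measurableType d) (I : (T -> \bar R) -> \bar R) N :
  tonelli I -> tonelli (iter_int I (N := N)).
Proof.
move=> tI; split.
- by move=> f g; exact: iter_le.
- elim: N => [//|N IH] f g f0 g0 mf mg /=.
  rewrite -(tonD tI); last 4 first.
  + by move=> x; exact: iter_ge0.
  + by move=> x; exact: iter_ge0.
  + exact: measurable_int_consl.
  + exact: measurable_int_consl.
  congr I; apply/funext => x; apply: IH => //;
    by apply: measurableT_comp => //; exact: measurable_consl.
- elim: N => [//|N IH] c f c0 f0 mf /=.
  rewrite -(tonZ tI)//; last 2 first.
  + by move=> x; exact: iter_ge0.
  + exact: measurable_int_consl.
  congr I; apply/funext => x; apply: IH => //.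
  by apply: measurableT_comp => //; exact: measurable_consl.
- by move=> d' T' g g0 mg; exact: iter_meas.
- elim: N => [//|N IH] g g0 mg /=.
  rewrite (ton_leb tI (g := fun xy => iter_int I (fun t => g (xy.1, cons_tuple xy.2 t)))).
  + congr I; apply/funext => y /=.
    apply: (IH (fun z => g (z.1, cons_tuple y z.2))) => //.
    apply: measurableT_comp => //; apply: measurable_fun_pair => //=.
    exact: measurable_cons_tuple.
  + by move=> x; exact: iter_ge0.
  + apply: (@iter_meas _ _ _ _ _ _ (fun z : (R * T) * N.-tuple T => g (z.1.1, cons_tuple z.1.2 z.2))) => //.
    apply: measurableT_comp => //; apply: measurable_fun_pair => /=.
      exact: measurableT_comp.
    by apply: measurable_cons_tuple => //; exact: measurableT_comp.
Qed.

Definition commuting d1 d2 (T1 : measurableType d1) (T2 : measurableType d2)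
    (I : (T1 -> \bar R) -> \bar R) (J : (T2 -> \bar R) -> \bar R) :=
  forall g : T1 * T2 -> \bar R, (forall x, 0 <= g x) -> measurable_fun setT g ->
  I (fun x => J (fun y => g (x, y))) = J (fun y => I (fun x => g (x, y))).

Lemma commuting_iter d1 d2 (T1 : measurableType d1) (T2 : measurableType d2)
    (I : (T1 -> \bar R) -> \bar R) (J : (T2 -> \bar R) -> \bar R) N :
  tonelli I -> tonelli J -> commuting I J -> commuting (iter_int I (N := N)) J.
Proof.
move=> tI tJ cIJ; elim: N => [|N IH] g g0 mg //=.
have mg' : measurable_fun setT (fun z : (T1 * T2) * N.-tuple T1 => g (cons_tuple z.1.1 z.2, z.1.2)).
  apply: measurableT_comp => //; apply: measurable_fun_pair => /=.
    by apply: measurable_cons_tuple => //; exact: measurableT_comp.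
  exact: measurableT_comp.
rewrite -(cIJ (fun xy => iter_int I (fun t => g (cons_tuple xy.1 t, xy.2)))).
- congr I; apply/funext => x /=.
  apply: (IH (fun z => g (cons_tuple x z.1, z.2))) => //.
  apply: measurableT_comp => //; apply: measurable_fun_pair => //=.
  exact: measurable_cons_tuple.
- by move=> x; exact: iter_ge0.
- exact: (@iter_meas _ _ _ _ _ _ _ tI _ mg').
Qed.

Lemma tonelli_leb_int N : tonelli (@leb_int R N).
Proof. exact/tonelli_iter/tonelli_lebesgue. Qed.

Lemma commuting_leb_int N d (T : measurableType d) (J : (T -> \bar R) -> \bar R) :
  tonelli J -> commuting (@leb_int R N) J.
Proof.
move=> tJ; apply: commuting_iter => //; first exact: tonelli_lebesgue.
by move=> g; exact: ton_leb.
Qed.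

Lemma leb_int_swap N (g : N.+1.-tuple R -> \bar R) :
  (forall t, 0 <= g t) -> measurable_fun setT g ->
  leb_int g = leb_int (fun t => \int[mu]_x g (cons_tuple x t)).
Proof.
move=> g0 mg; rewrite [LHS]/leb_int /=.
apply: (ton_leb (tonelli_leb_int N) (g := fun z => g (cons_tuple z.1 z.2))) => //.
by apply: (measurableT_comp mg); exact: measurable_cons_tuple.
Qed.

Lemma leb_int_cat m n (g : (m + n).-tuple R -> \bar R) :
  leb_int g = leb_int (fun s : m.-tuple R => leb_int (fun t : n.-tuple R => g (cat_tuple s t))).
Proof.
elim: m g => [|m IH] g.
  by rewrite [RHS]/leb_int /=; congr leb_int; apply/funext => t; congr g; exact/val_inj.
rewrite /leb_int /=; apply: eq_integral => x _.
have := IH (fun t => g (cons_tuple x t)); rewrite /leb_int => ->.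
congr iter_int; apply/funext => s; congr iter_int; apply/funext => t.
by congr g; exact/val_inj.
Qed.

(** * Affine changes of variables *)

Lemma lebesgue_affine (a b : R) (g : R -> \bar R) : a != 0%R ->
  (forall x, 0 <= g x) -> measurable_fun setT g ->
  \int[mu]_x g (a * x + b)%R = (`|a|^-1)%:E * \int[mu]_x g x.
Proof.
move=> a0 g0 mg; pose phi x : measurableTypeR R := (a * x + b)%R.
have mphi : measurable_fun setT (phi : measurableTypeR R -> _).
  by apply: measurable_funD => //; exact: measurable_funM.
have na : (0 <= `|a|)%R by [].
have [nu nuE] : exists nu : {measure set (measurableTypeR R) -> \bar R},
    forall A, nu A = `|a|%:E * mu (phi @^-1` A).
  by unshelve eexists (mscale (NngNum na) (pushforward mu phi)).
(* |a| times the image of Lebesgue measure under [phi] agrees with Lebesgue measure on half-open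
   intervals, hence on all measurable sets. *)
have muE A : measurable A -> mu A = nu A.
  apply: lebesgue_measure_unique => _ [[u v] _ <-] /=; rewrite nuE.
  have [a_gt0|a_lt0|a00] := ltgtP a 0%R; last by rewrite a00 eqxx in a0.
  (* A negative slope exchanges the open and the closed end. *)
  - have -> : phi @^-1` `]u, v] = `[((v - b) / a)%R, ((u - b) / a)%R[%classic.
      apply/seteqP; split=> x /=; rewrite !in_itv/= /phi.
        by rewrite ler_ndivrMr// ltr_ndivlMr// lerBrDr ltrBlDr ![(x * a)%R]mulrC => /andP[-> ->].
      by rewrite ler_ndivrMr// ltr_ndivlMr// lerBrDr ltrBlDr ![(x * a)%R]mulrC => /andP[-> ->].
    rewrite !lebesgue_measure_itv/= !lte_fin ltr_ndivlMr// divfK//.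
    rewrite ltrD2r; case: ifP => _; last by rewrite mule0.
    by rewrite -!EFinB -EFinM ltr0_norm//; congr EFin; field.
  - have -> : phi @^-1` `]u, v] = `]((u - b) / a)%R, ((v - b) / a)%R]%classic.
      apply/seteqP; split=> x /=; rewrite !in_itv/= /phi.
        by rewrite ler_pdivlMr// ltr_pdivrMr// lerBrDr ltrBlDr ![(x * a)%R]mulrC => /andP[-> ->].
      by rewrite ler_pdivlMr// ltr_pdivrMr// lerBrDr ltrBlDr ![(x * a)%R]mulrC => /andP[-> ->].
    rewrite !lebesgue_measure_itv/= !lte_fin ltr_pdivrMr// divfK//.
    rewrite ltrD2r; case: ifP => _; last by rewrite mule0.
    by rewrite -!EFinB -EFinM gtr0_norm//; congr EFin; field.
have -> : \int[mu]_x g x = `|a|%:E * \int[mu]_x g (phi x).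
  rewrite (@eq_measure_integral _ _ _ _ nu); last by move=> A mA _; exact: muE.
  rewrite (@eq_measure_integral _ _ _ _ (mscale (NngNum na) (pushforward mu phi))); last first.
    by move=> A mA _; rewrite nuE.
  by rewrite ge0_integral_mscale// ge0_integral_pushforward.
by rewrite muleA -EFinM mulVf ?normr_eq0// mul1e.
Qed.

Definition rv N (t : N.-tuple R) : 'cV[R]_N := \col_i tnth t i.
Definition tv N (v : 'cV[R]_N) : N.-tuple R := [tuple v i 0%R | i < N].

Lemma rvK N : cancel (@rv N) (@tv N).
Proof. by move=> t; apply/eq_from_tnth => i; rewrite tnth_mktuple mxE. Qed.

Lemma tvK N : cancel (@tv N) (@rv N).
Proof. by move=> v; apply/colP => i; rewrite mxE tnth_mktuple. Qed.

Definition aff N (M : 'M[R]_N) c (t : N.-tuple R) : N.-tuple R := tv (M *m rv t + c)%R.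

Lemma measurable_aff N (M : 'M[R]_N) c : measurable_fun setT (aff M c).
Proof.
apply/measurable_fun_tnthP => i.
rewrite (_ : _ \o _ = fun t => (\sum_j M i j * tnth t j + c i 0)%R); last first.
  by apply/funext => t /=; rewrite tnth_mktuple !mxE; congr (_ + _)%R; apply: eq_bigr => j _; rewrite mxE.
apply: measurable_funD => //; apply: measurable_sum => j.
by apply: measurable_funM => //; exact: measurable_tnth.
Qed.

Lemma aff_comp N (M M' : 'M[R]_N) c c' t :
  aff M c (aff M' c' t) = aff (M *m M')%R (M *m c' + c)%R t.
Proof. by rewrite /aff tvK mulmxDr mulmxA addrA. Qed.

Lemma rv_cons N (x : R) (t : N.-tuple R) :
  rv (cons_tuple x t) = col_mx x%:M (rv t) :> 'cV[R]_(1 + N).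
Proof.
apply/colP => i; rewrite mxE; case: (split_ordP i) => j ->.
  by rewrite col_mxEu ord1 mxE eqxx (tnth_nth 0%R).
by rewrite col_mxEd mxE !(tnth_nth 0%R).
Qed.

Lemma tv_col N (x : R) (v : 'cV[R]_N) :
  tv (col_mx x%:M v : 'cV[R]_(1 + N)) = cons_tuple x (tv v).
Proof. by apply: (can_inj (@rvK _)); rewrite tvK rv_cons tvK. Qed.

Lemma leb_int_ge0 N (g : N.-tuple R -> \bar R) : (forall t, 0 <= g t) -> 0 <= leb_int g.
Proof. exact: (ton_ge0 (tonelli_leb_int N)). Qed.

(** Quantified over the translation, so that it applies fibrewise with a shift depending on the
    other coordinate. *)
Definition leb_scales N (M : 'M[R]_N) := forall c (g : N.-tuple R -> \bar R),
  (forall t, 0 <= g t) -> measurable_fun setT g ->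
  leb_int (fun t => g (aff M c t)) = (`|\det M|^-1)%:E * leb_int g.

Lemma leb_scalesM N (M M' : 'M[R]_N) : leb_scales M -> leb_scales M' ->
  leb_scales (M *m M')%R.
Proof.
move=> sM sM' c g g0 mg.
have -> : (fun t => g (aff (M *m M')%R c t)) = fun t => g (aff M c (aff M' 0 t)).
  by apply/funext => t; rewrite aff_comp mulmx0 add0r.
rewrite (sM' 0%R (fun t => g (aff M c t)))//; last first.
  by apply: measurableT_comp => //; exact: measurable_aff.
by rewrite sM// det_mulmx normrM invfM EFinM muleA [X in X * _]muleC.
Qed.

Lemma col_split N (c : 'cV[R]_N.+1) :
  exists (c0 : R) (c1 : 'cV[R]_N), c = col_mx c0%:M c1 :> 'cV[R]_(1 + N).
Proof.
exists (usubmx (c : 'cV_(1 + N)) 0 0)%R, (dsubmx (c : 'cV_(1 + N))).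
by rewrite -mx11_scalar vsubmxK.
Qed.

(* [(x, y) |-> (a x + r y, y)] only moves the first coordinate. *)
Lemma leb_scales_up N (a : R) (r : 'rV[R]_N) : a != 0%R ->
  leb_scales (1%:M : 'M[R]_N) ->
  leb_scales (block_mx a%:M r 0 1%:M : 'M[R]_(1 + N)).
Proof.
move=> a0 s1 c g g0 mg; have [c0 [c1 ->]] := col_split c.
set U : 'M[R]_(1 + N) := block_mx _ _ _ _; set c' : 'cV[R]_(1 + N) := col_mx _ _.
have E x t : aff U c' (cons_tuple x t)
    = cons_tuple (a * x + ((r *m rv t) 0 0 + c0))%R (aff 1%:M c1 t).
  rewrite /aff rv_cons mul_block_col add_col_mx mul0mx add0r mul1mx -tv_col.
  congr (tv (col_mx _ _)).
  by rewrite [(r *m _)%R]mx11_scalar -scalar_mxM -!raddfD/= addrA -mx11_scalar.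
rewrite leb_int_swap//; last by apply: measurableT_comp => //; exact: measurable_aff.
pose G t := \int[mu]_x g (cons_tuple x t).
have mG : measurable_fun setT G.
  apply: (@ton_meas _ _ _ tonelli_lebesgue _ _ (fun z => g (cons_tuple z.2 z.1))) => //.
  by apply: measurableT_comp => //; exact: measurable_cons_tuple.
have G0 t : 0 <= G t by exact: integral_ge0.
transitivity (leb_int (fun t => (`|a|^-1)%:E * G (aff 1%:M c1 t))).
  congr leb_int; apply/funext => t; rewrite /G.
  rewrite -(@lebesgue_affine a ((r *m rv t) 0 0 + c0)%R (fun x => g (cons_tuple x (aff 1%:M c1 t))))//.
    by apply: eq_integral => x _; rewrite E.
  by apply: measurableT_comp => //; exact: measurable_cons_tuple.
rewrite (tonZ (tonelli_leb_int N))//; last first.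
  by apply: measurableT_comp => //; exact: measurable_aff.
by rewrite s1// det1 normr1 invr1 mul1e det_ublock det1 mulr1 det_scalar1 -leb_int_swap.
Qed.

Lemma leb_scales_low N (b : 'cV[R]_N) (D : 'M[R]_N) :
  leb_scales D -> leb_scales (block_mx 1%:M 0 b D : 'M[R]_(1 + N)).
Proof.
move=> sD c g g0 mg; have [c0 [c1 ->]] := col_split c.
set L : 'M[R]_(1 + N) := block_mx _ _ _ _; set c' : 'cV[R]_(1 + N) := col_mx _ _.
have E x t : aff L c' (cons_tuple x t)
    = cons_tuple (1 * x + c0)%R (aff D (x *: b + c1)%R t).
  rewrite /aff rv_cons mul_block_col add_col_mx mul0mx addr0 mul1mx -tv_col.
  congr (tv (col_mx _ _)); first by rewrite mul1r raddfD.
  by rewrite mul_mx_scalar addrA [(_ *m _ + _)%R in RHS]addrC.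
pose G x := leb_int (fun t => g (cons_tuple x t)).
have mG : measurable_fun setT G.
  apply: (@ton_meas _ _ _ (tonelli_leb_int N) _ _ (fun z => g (cons_tuple z.1 z.2))) => //.
  by apply: measurableT_comp => //; exact: measurable_cons_tuple.
have G0 x : 0 <= G x by exact: leb_int_ge0.
transitivity (\int[mu]_x ((`|\det D|^-1)%:E * G (1 * x + c0)%R)).
  rewrite [LHS]/leb_int /=; apply: eq_integral => x _; rewrite /G.
  rewrite -(sD (x *: b + c1)%R (fun t => g (cons_tuple (1 * x + c0)%R t)))//.
    by congr leb_int; apply/funext => t; rewrite E.
  by apply: measurableT_comp => //; exact: measurable_cons_tuple.
have mphi : measurable_fun setT (fun x : R => (1 * x + c0)%R).
  by apply: measurable_funD => //; exact: measurable_funM.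
have mGphi : measurable_fun setT (fun x : R => G (1 * x + c0)%R) := measurableT_comp mG mphi.
rewrite ge0_integralZl//.
by rewrite lebesgue_affine// normr1 invr1 mul1e det_lblock det1 mul1r.
Qed.

(** Gaussian elimination with a nonzero pivot: the lower factor moves only the last [N] coordinates,
    through the Schur complement, and the upper factor only the first one. *)
Lemma leb_scales_pivot N (M : 'M[R]_(1 + N)) : M 0%R 0%R != 0%R ->
  (forall D : 'M[R]_N, D \in unitmx -> leb_scales D) ->
  M \in unitmx -> leb_scales M.
Proof.
move=> a0 IH Mu; set a := M 0%R 0%R in a0.
have ME : M = (block_mx 1%:M 0 (a^-1 *: dlsubmx M) (drsubmx M - a^-1 *: dlsubmx M *m ursubmx M)
     *m block_mx a%:M (ursubmx M) 0 1%:M)%R.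
  rewrite mulmx_block !(mul1mx, mul0mx, mulmx0, mulmx1, addr0) -{1}[M]submxK.
  congr block_mx.
  - rewrite [LHS]mx11_scalar; congr (_%:M)%R; rewrite !mxE /a.
    by congr (M _ _); apply/val_inj.
  - by rewrite mul_mx_scalar scalerA mulfV// scale1r.
  - by rewrite addrC subrK.
rewrite ME; apply: leb_scalesM.
  apply: leb_scales_low; apply: IH.
  have : (\det M != 0)%R by rewrite -unitfE -unitmxE.
  rewrite {1}ME det_mulmx det_lblock det1 mul1r mulf_eq0 negb_or => /andP[dD _].
  by rewrite unitmxE unitfE.
by apply: leb_scales_up => //; apply: IH; exact: unitmx1.
Qed.

Lemma shear_pivot N (i : 'I_N) (M : 'M[R]_(1 + N)) :
  (((block_mx 1%:M (1 *: delta_mx 0 i) 0 1%:M : 'M[R]_(1 + N)) *m M)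
     (lshift N 0) (lshift N 0) =
  M (lshift N 0) (lshift N 0) + M (rshift 1 i) (lshift N 0))%R.
Proof.
rewrite -{1}[M]submxK mulmx_block block_mxEul mul1mx scale1r mxE -rowE !mxE.
by [].
Qed.

(** If the pivot is zero, some other entry of the first column is not; the shear [E 1] adds its row
    to the first one, and the inverse shear [E (-1)] has pivot 1 itself. *)
Theorem leb_int_affine N (M : 'M[R]_N) : M \in unitmx -> leb_scales M.
Proof.
elim: N M => [|N IH] M Mu.
  move=> c g g0 mg; rewrite /leb_int /= det_mx00 normr1 invr1 mul1e.
  by rewrite [aff M c _]tuple0.
have [M0|M0] := eqVneq (M 0%R 0%R) 0%R; last exact: leb_scales_pivot.
have [i Mi] : exists i : 'I_N, M (rshift 1 i) 0%R != 0%R.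
  apply/existsP; apply: contraLR Mu => /existsPn M0'.
  rewrite unitmxE unitfE negbK -det_tr; apply/det0P; exists (delta_mx 0%R 0%R).
    by apply/eqP => /matrixP/(_ 0%R 0%R)/eqP; rewrite !mxE oner_eq0.
  apply/rowP => j; rewrite -rowE !mxE.
  by case: (split_ordP (j : 'I_(1 + N))) => k ->;
    [rewrite ord1; apply: etrans M0; congr (M _ _); exact/val_inj
    |have /negP/negP := M0' k; rewrite negbK => /eqP].
pose E (s : R) : 'M[R]_(1 + N) := block_mx 1%:M (s *: delta_mx 0%R i) 0 1%:M.
have EE s s' : (E s *m E s' = E (s + s'))%R.
  rewrite mulmx_block !(mul1mx, mul0mx, mulmx0, mulmx1, addr0, add0r).
  by rewrite -scalerDl addrC.
have E0 : (E 0 = 1%:M)%R by rewrite /E scale0r -scalar_mx_block.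
have Eu s : E s \in unitmx by rewrite unitmxE det_ublock !det1 mulr1 unitr1.
have o0 : 0%R = lshift N (0%R : 'I_1) by exact/val_inj.
have -> : M = (E (-1) *m (E 1 *m M))%R by rewrite mulmxA EE addNr E0 mul1mx.
apply: leb_scalesM.
  apply: leb_scales_pivot => //.
  by rewrite o0 block_mxEul mxE oner_neq0.
apply: leb_scales_pivot => //; last by rewrite unitmx_mul Eu.
have -> : (E 1 *m M)%R 0%R 0%R = (M 0%R 0%R + M (rshift 1 i) 0%R)%R.
  by rewrite o0; exact: shear_pivot.
by rewrite M0 add0r.
Qed.

End Tonelli.

(** * Coordinates on symmetric matrices *)

Section SymmetricCoordinates.
Variables (R : realType) (p : nat).
Implicit Types (Q A : 'M[R]_p).
Local Notation N := (dimS p).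

Lemma val_sym_coord (i j : 'I_p) :
  val (sym_coord i j) = if (i <= j)%N then (i, j) else (j, i).
Proof.
rewrite /sym_coord val_insubd; case: (leqP i j) => ij /=; first by rewrite ij.
by rewrite (ltnW ij).
Qed.

Lemma sym_coordC (i j : 'I_p) : sym_coord i j = sym_coord j i.
Proof.
apply/val_inj; rewrite !val_sym_coord; case: ltngtP => // ij.
by have -> : i = j by apply/val_inj.
Qed.

Lemma sym_coord_val (k : symidx p) : sym_coord (val k).1 (val k).2 = k.
Proof. by apply/val_inj; rewrite val_sym_coord (valP k) -surjective_pairing. Qed.

Lemma mat_of_sym (t : N.-tuple R) : (mat_of t)^T = mat_of t.
Proof. by apply/matrixP => i j; rewrite !mxE sym_coordC. Qed.

Lemma mat_ofK : cancel (@mat_of R p) (@coords_of R p).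
Proof.
by move=> t; apply/eq_from_tnth => k; rewrite tnth_mktuple /= mxE sym_coord_val enum_valK.
Qed.

Lemma coords_ofK A : A^T = A -> mat_of (coords_of A) = A.
Proof.
move=> As; apply/matrixP => i j; rewrite mxE tnth_mktuple enum_rankK val_sym_coord.
by case: ifP => // _; rewrite -[in RHS]As mxE.
Qed.

Lemma mat_ofE (t : N.-tuple R) i j : mat_of t i j = tnth t (enum_rank (sym_coord i j)).
Proof. by rewrite mxE. Qed.

Lemma mat_of_tvD (u v : 'cV[R]_N) : mat_of (tv (u + v)) = mat_of (tv u) + mat_of (tv v).
Proof. by apply/matrixP => i j; rewrite !mxE !tnth_mktuple mxE. Qed.

(** The matrix of X -> Q X Q^T in the coordinates i <= j; an unordered pair collects the
    contributions of (a, b) and (b, a). *)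
Definition sym_act Q : 'M[R]_N := \matrix_(k, l)
  \sum_a \sum_b Q (val (enum_val k)).1 a * Q (val (enum_val k)).2 b
     * (l == enum_rank (sym_coord a b))%:R.

Lemma sym_actP Q (v : 'cV[R]_N) :
  mat_of (tv (sym_act Q *m v)) = Q *m mat_of (tv v) *m Q^T.
Proof.
have Xs : (Q *m mat_of (tv v) *m Q^T)^T = Q *m mat_of (tv v) *m Q^T.
  by rewrite !trmx_mul trmxK mat_of_sym mulmxA.
rewrite -[RHS]coords_ofK//; congr mat_of; apply/eq_from_tnth => k.
rewrite !tnth_mktuple !mxE.
transitivity (\sum_a \sum_b Q (val (enum_val k)).1 a * Q (val (enum_val k)).2 b
   * v (enum_rank (sym_coord a b)) 0).
  under eq_bigr do rewrite mxE big_distrl/=.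
  rewrite exchange_big/=; apply: eq_bigr => a _.
  under eq_bigr do rewrite big_distrl/=.
  rewrite exchange_big/=; apply: eq_bigr => b _.
  rewrite (bigD1 (enum_rank (sym_coord a b)))//= eqxx mulr1 big1 ?addr0// => l /negbTE->.
  by rewrite mulr0 mul0r.
rewrite /= mxE exchange_big; apply: eq_bigr => b _; rewrite !mxE big_distrl/=.
by apply: eq_bigr => a _; rewrite !mxE tnth_mktuple mulrAC.
Qed.

Lemma mat_tv_inj : injective (fun v : 'cV[R]_N => mat_of (tv v)).
Proof. by move=> u v /(can_inj mat_ofK)/(can_inj (@tvK _ _)). Qed.

Lemma sym_actM Q Q' : sym_act (Q *m Q') = sym_act Q *m sym_act Q'.
Proof.
apply/trmx_inj/row_matrixP => i; apply/trmx_inj; rewrite !tr_row !trmxK !colE.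
by apply: mat_tv_inj; rewrite -mulmxA !sym_actP trmx_mul !mulmxA.
Qed.

Lemma sym_act1 : sym_act 1%:M = 1%:M.
Proof.
apply/trmx_inj/row_matrixP => i; apply/trmx_inj; rewrite !tr_row !trmxK !colE.
by apply: mat_tv_inj; rewrite !sym_actP trmx1 !mul1mx mulmx1.
Qed.

(** Each index i occurs p + 1 times: once with every j, and a second time in the pair (i, i). *)
Lemma prod_symidx (f : 'I_p -> R) :
  \prod_(k < N) (f (val (enum_val k)).1 * f (val (enum_val k)).2) = \prod_i f i ^+ p.+1.
Proof.
have <- := @big_enum_val _ 1 *%R (symidx p) predT
  (fun k : symidx p => f (val k).1 * f (val k).2).
transitivity (\prod_(ij : 'I_p * 'I_p | (ij.1 <= ij.2)%N) (f ij.1 * f ij.2)).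
  rewrite [RHS](reindex_omap (val : symidx p -> 'I_p * 'I_p) insub)/=; last first.
    by move=> ij Hij; rewrite insubT.
  by apply: eq_bigl => k; rewrite (valP k) valK eqxx.
rewrite -(pair_big_dep predT (fun i j : 'I_p => i <= j)%N (fun i j => f i * f j))/=.
under eq_bigr do rewrite big_split/=.
rewrite big_split/= [X in _ * X](exchange_big_dep predT)//= -big_split/=.
apply: eq_bigr => i _; rewrite !prodr_const -exprD; congr (_ ^+ _).
rewrite -cardUI -[in RHS](card_ord p) -addn1; congr (_ + _)%N.
  by apply: eq_card => j; rewrite !inE leq_total.
rewrite -(card1 i); apply: eq_card => j; rewrite !inE -eqn_leq.
by rewrite -val_eqE eq_sym.
Qed.

Lemma det_sym_act_diag (d : 'rV[R]_p) :
  \det (sym_act (diag_mx d)) = \det (diag_mx d) ^+ p.+1.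
Proof.
have -> : sym_act (diag_mx d) =
    diag_mx (\row_k (d 0 (val (enum_val k)).1 * d 0 (val (enum_val k)).2)).
  apply/matrixP => k l; rewrite !mxE.
  set i := (val _).1; set j := (val _).2.
  rewrite (bigD1 i)//= [X in _ + X]big1 ?addr0; last first.
    move=> a ai; rewrite big1// => b _; rewrite mxE.
    by rewrite (_ : (_ == _) = false) ?mulr0n ?mul0r//; apply/negbTE; rewrite eq_sym.
  rewrite (bigD1 j)//= [X in _ + X]big1 ?addr0; last first.
    move=> b bj; rewrite ![diag_mx _ _ _]mxE.
    by rewrite [j == b]eq_sym (negbTE bj) mulr0n mulr0 mul0r.
  rewrite ![diag_mx _ _ _]mxE !eqxx !mulr1n sym_coord_val enum_valK eq_sym.
  by rewrite mulr_natr.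
rewrite !det_diag -prodrXl -(prod_symidx (d 0)).
by apply: eq_bigr => k _; rewrite mxE.
Qed.

(** [sym_act] is multiplicative, so the orthogonal factors of the spectral decomposition cancel and
    the diagonal case remains. *)
Lemma det_sym_act Q : Q^T = Q -> \det (sym_act Q) = \det Q ^+ p.+1.
Proof.
move=> /sym_spectral[P [d [PP ->]]].
have PE : \det (sym_act P^T) * \det (sym_act P) = 1.
  by rewrite -det_mulmx -sym_actM (mulmx1C PP) sym_act1 det1.
rewrite !sym_actM !det_mulmx mulrAC PE mul1r.
rewrite det_sym_act_diag; congr (_ ^+ _).
by rewrite mulrAC -det_mulmx (mulmx1C PP) det1 mul1r.
Qed.

Theorem leb_int_S_congr Q C (g : N.-tuple R -> \bar R) : Q^T = Q -> Q \in unitmx -> C^T = C ->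
  (forall t, 0 <= g t)%E -> measurable_fun setT g ->
  leb_int_S (fun t => g (coords_of (Q *m mat_of t *m Q + C)))
  = ((`|\det Q| ^+ p.+1)^-1%:E * leb_int_S g)%E.
Proof.
move=> Qs Qu Cs g0 mg.
have Eu : sym_act Q \in unitmx.
  by rewrite unitmxE det_sym_act// unitrX// -unitmxE.
rewrite -normrX -det_sym_act// -(@leb_int_affine _ _ _ Eu (rv (coords_of C)))//.
congr leb_int; apply/funext => t; congr g.
apply: (can_inj mat_ofK); rewrite coords_ofK; last first.
  by rewrite linearD/= !trmx_mul Qs Cs mat_of_sym mulmxA.
rewrite /aff mat_of_tvD sym_actP !rvK Qs coords_ofK//.
Qed.

End SymmetricCoordinates.

(** * The positive definite cone *)

Section PositiveDefiniteSets.
Variable R : realType.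

Lemma bf_block n (a : R) (b : 'cV[R]_n) (D : 'M[R]_n) x v :
  bf (block_mx a%:M b^T b D : 'M[R]_(1 + n)) (col_mx x%:M v) (col_mx x%:M v)
  = a * x ^+ 2 + 2 * x * bf 1%:M b v + bf D v v.
Proof.
have E1 : b^T *m v = (bf 1%:M b v)%:M by rewrite [LHS]mx11_scalar /bf mulmx1.
have E2 : v^T *m b = (bf 1%:M b v)%:M.
  by rewrite -(trmxK (v^T *m b)) trmx_mul trmxK E1 tr_scalar_mx.
have E3 : v^T *m D *m v = (bf D v v)%:M by rewrite [LHS]mx11_scalar.
rewrite {1}/bf tr_col_mx mul_row_block mul_row_col tr_scalar_mx !mulmxDl.
rewrite E2 E3 -(mulmxA _ b^T) E1 -!scalar_mxM -!raddfD/= mxE eqxx mulr1n; ring.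
Qed.

Lemma bf_rank1 n (b : 'cV[R]_n) v : bf (b *m b^T) v v = bf 1%:M b v ^+ 2.
Proof.
rewrite /bf mulmx1 expr2 mulmxA -mulmxA mxE big_ord1; congr (_ * _).
by rewrite -[in RHS](trmxK v) -trmx_mul [RHS]mxE.
Qed.

Lemma pdZ n (c : R) (A : 'M[R]_n) : 0 < c -> pdmx (c *: A) <-> pdmx A.
Proof.
move=> c0; have H (e : R) (B : 'M[R]_n) : 0 < e -> pdmx B -> pdmx (e *: B).
  move=> e0 [Bs B0]; split; first by rewrite /Defs.symmetricmx linearZ/= Bs.
  by move=> v v0; rewrite -/(bf _ v v) bfAZ mulr_gt0// B0.
split; last exact: H.
by move/(H c^-1); rewrite invr_gt0 scalerA mulVf ?gt_eqF// scale1r; apply.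
Qed.

(** With s the inner product of b and v, the form is a (x + s/a)^2 plus the form of the Schur
    complement at v. *)
Lemma pd_block n (a : R) (b : 'cV[R]_n) (D : 'M[R]_n) :
  pdmx (block_mx a%:M b^T b D : 'M[R]_(1 + n)) <->
  0 < a /\ pdmx (D - a^-1 *: (b *m b^T)).
Proof.
split=> [[Ms M0]|[a0 [Ds D0]]].
- have a0 : 0 < a.
    have := M0 (col_mx 1%:M 0); rewrite -/(bf _ _ _) bf_block expr1n bf0r bf0r !mulr0 !addr0 mulr1.
    apply; apply/eqP => /(congr1 usubmx)/matrixP/(_ 0 0)/eqP.
    by rewrite col_mxKu !mxE oner_eq0.
  split=> //; split.
    rewrite /Defs.symmetricmx linearB/= linearZ/= trmx_mul trmxK.
    have := congr1 drsubmx Ms; rewrite /Defs.symmetricmx tr_block_mx !block_mxKdr => ->.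
    by [].
  move=> v v0; rewrite -/(bf _ v v) bfAD bfAN bfAZ bf_rank1.
  set s := bf 1%:M b v.
  have := M0 (col_mx (- (s / a))%:M v); rewrite -/(bf _ _ _) bf_block -/s.
  have -> : a * (- (s / a)) ^+ 2 + 2 * (- (s / a)) * s + bf D v v = bf D v v - a^-1 * s ^+ 2.
    by field; rewrite gt_eqF.
  apply; apply: contra_neq v0 => /(congr1 dsubmx).
  by rewrite col_mxKd => ->; rewrite linear0.
- have Ds' : D^T = D.
    by have := Ds; rewrite /Defs.symmetricmx linearB/= linearZ/= trmx_mul trmxK => /addIr.
  split; first by rewrite /Defs.symmetricmx tr_block_mx trmxK Ds' tr_scalar_mx.
  move=> z z0; have [x [v zE]] := col_split z.
  rewrite -/(bf _ z z) zE bf_block; set s := bf 1%:M b v.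
  have -> : a * x ^+ 2 + 2 * x * s + bf D v v =
      a * (x + s / a) ^+ 2 + bf (D - a^-1 *: (b *m b^T)) v v.
    by rewrite bfAD bfAN bfAZ bf_rank1 -/s; field; rewrite gt_eqF.
  have [v0|v0] := eqVneq v 0; last first.
    by apply: ltr_wpDl; [rewrite mulr_ge0 ?sqr_ge0// ltW|exact: D0].
  rewrite /s v0 !bf0r mul0r !addr0 mulr_gt0// exprn_even_gt0//=.
  by apply: contra_neq z0 => x0; rewrite zE x0 v0 raddf0 col_mx0.
Qed.

Lemma det_block_schur n (a : R) (b : 'cV[R]_n) (D : 'M[R]_n) : a != 0 ->
  \det (block_mx a%:M b^T b D : 'M[R]_(1 + n)) = a * \det (D - a^-1 *: (b *m b^T)).
Proof.
move=> a0.
have -> : block_mx a%:M b^T b D = block_mx 1%:M 0 (a^-1 *: b) (D - a^-1 *: (b *m b^T))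
    *m block_mx a%:M b^T 0 1%:M :> 'M[R]_(1 + n).
  rewrite mulmx_block !(mul1mx, mul0mx, mulmx0, mulmx1, addr0).
  by rewrite mul_mx_scalar scalerA mulfV// scale1r -scalemxAl addrC subrK.
by rewrite det_mulmx det_lblock det_ublock !det1 mul1r mulr1 det_scalar1 mulrC.
Qed.

Lemma trace_block n (a : R) (b : 'cV[R]_n) (D : 'M[R]_n) :
  \tr (block_mx a%:M b^T b D : 'M[R]_(1 + n)) = a + \tr D.
Proof. by rewrite mxtrace_block mxtrace_scalar mulr1n. Qed.

(** Induction on the size through a scalar pivot. Multiplying the Schur complement by the pivot
    keeps its entries polynomial in those of [F]. *)
Lemma measurable_pd d (T : measurableType d) n (F : T -> 'M[R]_n) :
  (forall i j, measurable_fun setT (fun x => F x i j)) ->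
  (forall x, (F x)^T = F x) -> measurable [set x | pdmx (F x)].
Proof.
elim: n F => [|n IH] F mF Fs.
  rewrite (_ : [set x | _] = setT)//; apply/seteqP; split=> // x _.
  by split=> [|v /eqP[]]; [exact: Fs|apply/matrixP; case].
pose a x := F x 0 0.
pose b x := dlsubmx (F x : 'M[R]_(1 + n)); pose D x := drsubmx (F x : 'M[R]_(1 + n)).
have FE x : F x = block_mx (a x)%:M (b x)^T (b x) (D x).
  have Fs' : (F x : 'M[R]_(1 + n))^T = F x by [].
  rewrite /b /D -{1}[F x](@submxK _ 1 n 1 n) -{2}Fs' trmx_dlsub.
  have -> // : ulsubmx (F x : 'M[R]_(1 + n)) = (a x)%:M.
  rewrite [LHS]mx11_scalar; congr (_ %:M).
  by rewrite !mxE /a; congr (F x _ _); exact/val_inj.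
have -> : [set x | pdmx (F x)] = [set x | 0 < a x] `&` [set x | pdmx (a x *: D x - b x *m (b x)^T)].
  apply/seteqP; split=> x /=; rewrite FE; [case/pd_block=> a0 pD|case=> a0 pD].
    split=> //; rewrite -(pdZ _ (_ : 0 < (a x)^-1)) ?invr_gt0//.
    by rewrite scalerBr scalerA mulVf ?gt_eqF// scale1r.
  apply/pd_block; split=> //; rewrite -(pdZ _ a0).
  by rewrite scalerBr scalerA mulfV ?gt_eqF// scale1r.
apply: measurableI.
  rewrite (_ : [set x | _] = setT `&` a @^-1` `]0, +oo[%classic); last first.
    by rewrite setTI; apply/seteqP; split=> x /=; rewrite in_itv/= andbT.
  exact: mF.
apply: IH => [i j|x].
  rewrite (_ : (fun x => _) = fun x => a x * F x (rshift 1 i) (rshift 1 j)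
     - F x (rshift 1 i) 0 * F x (rshift 1 j) 0).
    by apply: measurable_funB; apply: measurable_funM; exact: mF.
  apply/funext => x; rewrite !mxE big_ord1 !mxE; congr (_ - _ * _);
  by congr (F x _ _); exact/val_inj.
have Fs' : (F x : 'M[R]_(1 + n))^T = F x by [].
have Ds : (D x)^T = D x by rewrite /D trmx_drsub Fs'.
by rewrite linearB/= linearZ/= Ds trmx_mul trmxK.
Qed.

(** This presents the closed cone as a countable intersection of definiteness conditions, to which
    [measurable_pd] applies. *)
Lemma psd_pdP n (A : 'M[R]_n) : A^T = A ->
  psdmx A <-> forall k : nat, pdmx (A + k.+1%:R^-1%:M).
Proof.
move=> As; split=> [Ap k|Ap].
  rewrite addrC; apply: pdD => //; rewrite -scalemx1; apply/pdZ; last exact: pd1.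
  by rewrite invr_gt0.
split=> // v; rewrite -/(bf A v v) leNgt; apply/negP => Av.
have v0 : v != 0 by apply: contraTneq Av => ->; rewrite bf0r ltxx.
have vv := bf1_gt0 v0.
have e0 : 0 < - bf A v v / bf 1%:M v v by rewrite divr_gt0// oppr_gt0.
(* Where the form is negative at v, a multiple of the identity below -A(v,v)/|v|^2 leaves it
   negative. *)
have [k kP] : exists k, k.+1%:R^-1 < - bf A v v / bf 1%:M v v.
  pose x := (- bf A v v / bf 1%:M v v)^-1; exists (Num.truncn x).
  by rewrite invf_plt ?posrE// truncnS_gt.
have [_ /(_ v v0)] := Ap k; rewrite -/(bf _ v v) bfAD -scalemx1 bfAZ.
by move: kP; rewrite ltr_pdivlMr// -[- _]sub0r ltrBrDl => kP /lt_trans/(_ kP); rewrite ltxx.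
Qed.

Lemma measurable_psd d (T : measurableType d) n (F : T -> 'M[R]_n) :
  (forall i j, measurable_fun setT (fun x => F x i j)) ->
  (forall x, (F x)^T = F x) -> measurable [set x | psdmx (F x)].
Proof.
move=> mF Fs; rewrite (_ : [set x | _] = \bigcap_k [set x | pdmx (F x + k.+1%:R^-1%:M)]).
  apply: bigcapT_measurable => k; apply: measurable_pd => [i j|x].
    rewrite (_ : (fun x => _) = fun x => F x i j + (k.+1%:R^-1%:M : 'M[R]_n) i j).
      exact: measurable_funD.
    by apply/funext => x; rewrite !mxE.
  by rewrite linearD/= Fs tr_scalar_mx.
apply/seteqP; split=> x /=.
  by move/(psd_pdP (Fs x)) => H k _; apply: H.
by move=> H; apply/(psd_pdP (Fs x)) => k; exact: H.
Qed.

Lemma measurable_prodr d (T : measurableType d) (I : Type) (s : seq I) (F : I -> T -> R) :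
  (forall i, measurable_fun setT (F i)) -> measurable_fun setT (fun x => \prod_(i <- s) F i x).
Proof.
move=> mF; elim: s => [|i s IH].
  by rewrite (_ : (fun x => _) = cst 1)//; apply/funext => x; rewrite big_nil.
rewrite (_ : (fun x => _) = fun x => F i x * \prod_(j <- s) F j x); last first.
  by apply/funext => x; rewrite big_cons.
exact: measurable_funM.
Qed.

Lemma measurable_det d (T : measurableType d) n (F : T -> 'M[R]_n) :
  (forall i j, measurable_fun setT (fun x => F x i j)) ->
  measurable_fun setT (fun x => \det (F x)).
Proof.
move=> mF; rewrite /determinant; apply: measurable_sum => s.
apply: measurable_funM => //.
by apply: measurable_prodr => i; exact: mF.
Qed.

Lemma measurable_mat_of p i j :
  measurable_fun setT (fun t : (dimS p).-tuple R => mat_of t i j).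
Proof.
rewrite (_ : (fun t => _) = fun t => tnth t (enum_rank (sym_coord i j))).
  exact: measurable_tnth.
by apply/funext => t; rewrite mat_ofE.
Qed.

Lemma tonelli_leb_int_S p : tonelli (@leb_int_S R p).
Proof. exact: tonelli_leb_int. Qed.

Lemma leb_int_S_translate p C (g : (dimS p).-tuple R -> \bar R) : C^T = C ->
  (forall t, 0 <= g t)%E -> measurable_fun setT g ->
  leb_int_S (fun t => g (coords_of (mat_of t + C))) = leb_int_S g.
Proof.
move=> Cs g0 mg; have := leb_int_S_congr (trmx1 _ _) (unitmx1 _ _) Cs g0 mg.
rewrite det1 normr1 expr1n invr1 mul1e => <-.
by congr leb_int_S; apply/funext => t; rewrite mul1mx mulmx1.
Qed.

(* A line [X + x 1%:M] meets the boundary of the positive semidefinite cone at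
   most once, so the boundary is null by translation invariance and Tonelli. *)
Lemma boundary_null p (C : 'M[R]_p) : C^T = C ->
  leb_int_S (fun t : (dimS p).-tuple R =>
    (\1_[set t | psdmx (mat_of t - C) /\ ~ pdmx (mat_of t - C)] t)%:E) = 0%E.
Proof.
move=> Cs; set h := fun t => _.
have h0 t : (0 <= h t)%E by rewrite /h lee_fin.
have Bs (z : R * (dimS p).-tuple R) : (mat_of z.2 + z.1%:M - C)^T = mat_of z.2 + z.1%:M - C.
  by rewrite linearB/= linearD/= mat_of_sym tr_scalar_mx Cs.
have mB i j : measurable_fun setT
    (fun z : R * (dimS p).-tuple R => (mat_of z.2 + z.1%:M - C) i j).
  rewrite (_ : (fun z => _) = fun z => mat_of z.2 i j + z.1 *+ (i == j) - C i j); last first.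
    by apply/funext => z; rewrite !mxE.
  apply: measurable_funB => //; apply: measurable_funD.
    by apply: (measurableT_comp (measurable_mat_of _ _)).
  by case: (i == j); [exact: measurable_fst|exact: measurable_cst].
pose H (z : R * (dimS p).-tuple R) : \bar R := (\1_[set z : R * (dimS p).-tuple R |
  psdmx (mat_of z.2 + z.1%:M - C) /\ ~ pdmx (mat_of z.2 + z.1%:M - C)] z)%:E.
have H0 z : (0 <= H z)%E by rewrite lee_fin.
have mH : measurable_fun setT H.
  apply/measurable_EFinP; apply: measurable_indic.
  rewrite (_ : [set z | _] = [set z | psdmx (mat_of z.2 + z.1%:M - C)]
     `&` ~` [set z | pdmx (mat_of z.2 + z.1%:M - C)])//.
  by apply: measurableI; [exact: measurable_psd|apply: measurableC; exact: measurable_pd].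
have HhE x t : H (x, t) = h (coords_of (mat_of t + x%:M)).
  have XE : mat_of (coords_of (mat_of t + x%:M)) = mat_of t + x%:M.
    by rewrite coords_ofK// linearD/= mat_of_sym tr_scalar_mx.
  rewrite /H /h !indicE; congr ((nat_of_bool _)%:R%:E).
  by apply/idP/idP => /set_mem/= HH; apply/mem_set => /=; move: HH; rewrite XE.
have mh : measurable_fun setT h.
  rewrite (_ : h = fun t => H (0, t)); first exact: measurableT_comp.
  by apply/funext => t; rewrite HhE raddf0 addr0 mat_ofK.
(* A constant of [0, +oo] whose integral over the whole line is 0 must be 0. *)
have : (\int[@lebesgue_measure R]_x leb_int_S h)%E = 0%E.
  transitivity (\int[@lebesgue_measure R]_x leb_int_S (fun t => H (x, t)))%E.
    apply: eq_integral => x _; rewrite -(@leb_int_S_translate _ x%:M)//; last exact: tr_scalar_mx.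
    by congr leb_int_S; apply/funext => t; rewrite HhE.
  rewrite (ton_leb (tonelli_leb_int_S p))// -[RHS](ton_cst0 (tonelli_leb_int_S p)).
  congr leb_int_S; apply/funext => t.
  have [[x0 Hx0]|nox] := pselect (exists x0, H (x0, t) != 0%E); last first.
    apply: integral0_eq => x _; apply/eqP/negP => /negP Hx; apply: nox; by exists x.
  apply/eqP; rewrite eq_le integral_ge0// andbT.
  apply: (@le_trans _ _ (\int[@lebesgue_measure R]_x (\1_[set x0] x)%:E)%E).
    apply: ge0_le_integral_nomeas => // x; rewrite [in X in (_ <= X)%E]indicE.
    have [->|xx0] := eqVneq x x0; first by rewrite mem_set// lee_fin indicE; case: (_ \in _).
    suff -> : H (x, t) = 0%E by rewrite lee_fin.
    apply/eqP; apply: contraNT xx0 => Hx.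
    have HP y : H (y, t) != 0%E -> psdmx (mat_of t + y%:M - C) /\ ~ pdmx (mat_of t + y%:M - C).
      rewrite /H indicE; case: (pselect ([set z : R * (dimS p).-tuple R |
        psdmx (mat_of z.2 + z.1%:M - C) /\ ~ pdmx (mat_of z.2 + z.1%:M - C)] (y, t))) => //= H1.
      by rewrite memNset// eqxx.
    (* A positive multiple of the identity makes a semidefinite matrix definite, so two boundary
       points on the line have the same parameter. *)
    have lt y z : psdmx (mat_of t + y%:M - C) -> ~ pdmx (mat_of t + z%:M - C) -> z <= y.
      move=> Py Nz; rewrite leNgt; apply/negP => yz; apply: Nz.
      rewrite (_ : _ - C = (z - y)%:M + (mat_of t + y%:M - C)); last first.
        by rewrite raddfB/= !addrA; congr (_ - _); rewrite [RHS]addrAC subrK addrC.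
      apply: pdD => //; rewrite -scalemx1; apply/pdZ; [by rewrite subr_gt0|exact: pd1].
    have [[p1 n1] [p2 n2]] := (HP _ Hx, HP _ Hx0).
    by rewrite eq_le (lt _ _ p1 n2) (lt _ _ p2 n1).
  rewrite integral_indic// setIT [X in (X <= _)%E](_ : _ = 0%E)//.
  exact: lebesgue_measure_set1.
rewrite integral_cst// => cT.
have c0 : (0 <= leb_int_S h)%E by apply: (ton_ge0 (tonelli_leb_int_S p)).
have muT : @lebesgue_measure R setT = +oo%E by rewrite -set_itvNyy lebesgue_measure_itv.
have {}cT : (leb_int_S h * +oo = 0)%E by rewrite -muT; exact: cT.
by move: c0; rewrite le_eqVlt => /orP[/eqP//|c0]; move: cT; rewrite gt0_muley.
Qed.

End PositiveDefiniteSets.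

(** * Multivariate gamma and beta integrals *)

Section BlockCoordinates.
Variable R : realType.

(** A permutation matrix has determinant 1 or -1. *)
Lemma leb_int_reindex M N (f : 'I_M -> 'I_N) (g : M.-tuple R -> \bar R) :
  bijective f -> (forall t, 0 <= g t)%E -> measurable_fun setT g ->
  leb_int (fun u : N.-tuple R => g [tuple tnth u (f k) | k < M]) = leb_int g.
Proof.
move=> bf; have MN : M = N by have := bij_eq_card bf; rewrite !card_ord.
subst N; move=> g0 mg; pose s := perm.perm (bij_inj bf).
have su : (perm_mx s : 'M[R]_M) \in unitmx by exact: unitmx_perm.
have := leb_int_affine su 0 g0 mg.
rewrite det_perm normrX normrN1 expr1n invr1 mul1e => <-.
congr leb_int; apply/funext => u; congr g; apply/eq_from_tnth => k.
rewrite !tnth_mktuple addr0 mxE (bigD1 (f k))//= big1 ?addr0.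
  by rewrite !mxE perm.permE eqxx mul1r.
by move=> l lk; rewrite !mxE perm.permE eq_sym (negbTE lk) mul0r.
Qed.

Variable p : nat.

(** The pairs i <= j are enumerated in the order of [enum]; an explicit bijection with the first row
    followed by the pairs of the remaining block frees the integral from that order. *)
Definition block_idx (k : symidx p.+1) : 'I_(p.+1 + dimS p) :=
  if unlift ord0 (val k).1 is Some i then
    if unlift ord0 (val k).2 is Some j then rshift p.+1 (enum_rank (sym_coord i j))
    else lshift (dimS p) ord0
  else lshift (dimS p) (val k).2.

Definition block_idxV (u : 'I_(p.+1 + dimS p)) : symidx p.+1 :=
  match fintype.split u with
  | inl j => sym_coord ord0 j
  | inr k => sym_coord (lift ord0 (val (enum_val k)).1) (lift ord0 (val (enum_val k)).2)
  end.

Lemma val_sym_coord_lift (k : symidx p) :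
  val (sym_coord (lift ord0 (val k).1) (lift ord0 (val k).2))
  = (lift ord0 (val k).1, lift ord0 (val k).2).
Proof. by rewrite val_sym_coord /= /bump !add1n ltnS (valP k). Qed.

Lemma block_idxK : cancel block_idx block_idxV.
Proof.
move=> k; rewrite -[RHS](sym_coord_val k) /block_idx /block_idxV.
have := valP k; case: (val k) => i j /= ij.
case: unliftP => [i' ii|i0]; last first.
  by rewrite -[lshift _ _]/(unsplit (inl _)) unsplitK i0.
case: unliftP => [j' ->|j0].
  rewrite ii -[rshift _ _]/(unsplit (inr _)) unsplitK enum_rankK val_sym_coord.
  by case: ifP => //= _; rewrite sym_coordC.
by rewrite ii j0 in ij.
Qed.

Lemma block_idxVK : cancel block_idxV block_idx.
Proof.
move=> u; rewrite /block_idxV; case: split_ordP => [j ->|k ->].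
  by rewrite /block_idx val_sym_coord /= unlift_none.
by rewrite /block_idx val_sym_coord_lift /= !liftK sym_coord_val enum_valK.
Qed.

Lemma leb_int_S_block (g : (dimS p.+1).-tuple R -> \bar R) :
  (forall t, 0 <= g t)%E -> measurable_fun setT g ->
  leb_int_S g = (\int[@lebesgue_measure R]_x leb_int (fun r : p.-tuple R =>
    leb_int_S (fun s : (dimS p).-tuple R => g (coords_of
      (block_mx x%:M (rv r)^T (rv r) (mat_of s) : 'M[R]_(1 + p))))))%E.
Proof.
move=> g0 mg; have bij : bijective (fun k : 'I_(dimS p.+1) => block_idx (enum_val k)).
  exists (fun u => enum_rank (block_idxV u)) => [k|u] /=.
    by rewrite block_idxK enum_valK.
  by rewrite enum_rankK block_idxVK.
rewrite /leb_int_S -(leb_int_reindex bij g0 mg) leb_int_cat.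
rewrite [LHS]/leb_int /=; apply: eq_integral => x _.
congr leb_int; apply/funext => r; congr leb_int; apply/funext => s; congr g.
apply/eq_from_tnth => k; rewrite !tnth_mktuple.
have := valP (enum_val k); rewrite /block_idx; move: (val (enum_val k)) => [i j] /= ij.
have o0 : ord0 = lshift p (0 : 'I_1) by exact/val_inj.
have ol (l : 'I_p) : lift ord0 l = rshift 1 l by exact/val_inj.
case: unliftP => [i' ii|i0]; last first.
  rewrite tnth_lshift i0 [in RHS]o0; case: (unliftP ord0 j) => [j' ->|->].
    by rewrite ol [RHS]block_mxEur !mxE (tnth_nth 0) [RHS](tnth_nth 0).
  by rewrite [in RHS]o0 block_mxEul mxE (tnth_nth 0).
case: unliftP => [j' jj|j0]; last by rewrite ii j0 in ij.
by rewrite tnth_rshift ii jj !ol [RHS]block_mxEdr mat_ofE.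
Qed.

End BlockCoordinates.

(** * Gamma and beta integrals over the cone *)

Section MultivariateGamma.
Variable R : realType.
Local Notation mu := (@lebesgue_measure R).

(** The matrix gamma density without its exponential and its constant. *)
Definition wishart p (a : R) (X : 'M[R]_p) : R :=
  (\det X) `^ (a - p.+1%:R / 2) * \1_[set X | pdmx X] X.

Lemma wishart_ge0 p a (X : 'M[R]_p) : 0 <= wishart a X.
Proof. by rewrite mulr_ge0 ?powR_ge0. Qed.

Lemma wishart_pd p a (X : 'M[R]_p) : pdmx X ->
  wishart a X = (\det X) `^ (a - p.+1%:R / 2).
Proof. by move=> Xp; rewrite /wishart indicE mem_set ?mulr1. Qed.

Lemma wishart_npd p a (X : 'M[R]_p) : ~ pdmx X -> wishart a X = 0.
Proof. by move=> Xp; rewrite /wishart indicE memNset ?mulr0. Qed.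

Lemma measurable_wishart d (T : measurableType d) p a (F : T -> 'M[R]_p) :
  (forall i j, measurable_fun setT (fun x => F x i j)) ->
  (forall x, (F x)^T = F x) -> measurable_fun setT (fun x => wishart a (F x)).
Proof.
move=> mF Fs; apply: measurable_funM.
  apply: (measurableT_comp (measurable_powR _)); exact: measurable_det.
rewrite (_ : (fun x => _) = \1_[set x | pdmx (F x)]); last first.
  by apply/funext => x; rewrite !indicE.
exact/measurable_indic/measurable_pd.
Qed.

(** Kept in the extended reals, so that the recursion on the size holds for every parameter and
    finiteness is settled afterwards. *)
Definition gamma_int (x : R) : \bar R :=
  (\int[mu]_(t in [set t : R | (0 < t)%R]) ((t `^ (x - 1) * expR (- t))%R)%:E)%E.

Definition wishart_int p (a : R) : \bar R :=
  leb_int_S (fun t : (dimS p).-tuple R =>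
    (wishart a (mat_of t) * expR (- \tr (mat_of t)))%:E).

Lemma leb_int_prod n (f : R -> R) J : (forall x, 0 <= f x) -> measurable_fun setT f ->
  (\int[mu]_x (f x)%:E = J%:E)%E ->
  leb_int (fun t : n.-tuple R => (\prod_i f (tnth t i))%:E) = (J ^+ n)%:E.
Proof.
move=> f0 mf fJ; elim: n => [|n IH]; first by rewrite /leb_int /= big_ord0.
have F0 m (t : m.-tuple R) : (0 <= (\prod_i f (tnth t i))%:E)%E.
  by rewrite lee_fin prodr_ge0.
rewrite [LHS]/leb_int /=.
transitivity (\int[mu]_x ((f x)%:E * leb_int (fun t : n.-tuple R => (\prod_i f (tnth t i))%:E)))%E.
  apply: eq_integral => x _; rewrite -(tonZ (tonelli_leb_int R n)) ?lee_fin//.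
    congr leb_int; apply/funext => t; rewrite -EFinM big_ord_recl; congr (_ * _)%:E.
    by apply: eq_bigr => i _; rewrite tnthS.
  apply/measurable_EFinP; apply: measurable_prodr => i.
  by apply: measurableT_comp => //; exact: measurable_tnth.
rewrite ge0_integralZr//; last 3 first.
- exact/measurable_EFinP.
- by move=> x _; rewrite lee_fin.
- exact: leb_int_ge0.
by rewrite IH fJ exprS EFinM.
Qed.

Lemma integral_gauss_scale (x : R) : 0 < x ->
  (\int[mu]_t (expR (- (t ^+ 2 / x)))%:E = (Num.sqrt (pi * x))%:E)%E.
Proof.
move=> x0; have sx : 0 < Num.sqrt x by rewrite sqrtr_gt0.
have mg : measurable_fun setT (fun t : R => (@gauss_fun R t)%:E).
  by apply/measurable_EFinP; exact: measurable_gauss_fun.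
have := @lebesgue_affine R (Num.sqrt x)^-1 0 _ _ _ mg.
rewrite integralT_gauss gtr0_norm ?invr_gt0// invrK -EFinM mulrC.
rewrite sqrtrM ?pi_ge0// => <-.
- apply: eq_integral => t _; rewrite /gauss_fun addr0 exprMn exprVn sqr_sqrtr ?ltW//.
  by rewrite mulrC.
- by rewrite invr_eq0 gt_eqF.
- by move=> t; rewrite lee_fin gauss_fun_ge0.
Qed.

(** Split X into the corner x, the column r and the block D, and translate D by r r^T / x. Then det
    X = x det D and tr X = x + |r|^2 / x + tr D, so the integral over r is Gaussian. *)
Lemma wishart_intS p (a : R) : wishart_int p.+1 a =
  ((pi `^ (p%:R / 2))%:E * gamma_int a * wishart_int p (a - 2^-1))%E.
Proof.
(* [e] is the exponent of the determinant both in size p + 1 at a and in size p at a - 1/2. *)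
set e := a - p.+2%:R / 2.
have mW q b : measurable_fun setT (fun t : (dimS q).-tuple R =>
    (wishart b (mat_of t) * expR (- \tr (mat_of t)))%:E).
  apply/measurable_EFinP; apply: measurable_funM.
    by apply: measurable_wishart; [exact: measurable_mat_of|exact: mat_of_sym].
  apply: measurableT_comp => //; apply: measurableT_comp => //.
  by apply: measurable_sum => i; exact: measurable_mat_of.
have W0 q b (t : (dimS q).-tuple R) : (0 <= (wishart b (mat_of t) * expR (- \tr (mat_of t)))%:E)%E.
  by rewrite lee_fin mulr_ge0 ?wishart_ge0 ?expR_ge0.
rewrite {1}/wishart_int leb_int_S_block//.
have inner x (r : p.-tuple R) : leb_int_S (fun s : (dimS p).-tuple R =>
     let X := mat_of (coords_of (block_mx x%:M (rv r)^T (rv r) (mat_of s) : 'M[R]_(1 + p))) in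
     (wishart a X * expR (- \tr X))%:E) =
  (if (0 < x)%R then (x `^ e * expR (- x) * \prod_i expR (- ((tnth r i) ^+ 2 / x)))%:E
     * wishart_int p (a - 2^-1) else 0)%E.
  pose B (D : 'M[R]_p) : 'M[R]_(1 + p) := block_mx x%:M (rv r)^T (rv r) D.
  have BK s : mat_of (coords_of (B (mat_of s))) = B (mat_of s).
    by rewrite coords_ofK// /B tr_block_mx trmxK mat_of_sym tr_scalar_mx.
  case: ltP => x0; last first.
    rewrite -(ton_cst0 (tonelli_leb_int_S R p)); congr leb_int_S; apply/funext => s /=.
    rewrite BK wishart_npd ?mul0r// => /pd_block[].
    by rewrite ltNge x0.
  pose C := x^-1 *: (rv r *m (rv r)^T).
  have Cs : C^T = C by rewrite /C linearZ/= trmx_mul trmxK.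
  pose h (s : (dimS p).-tuple R) := (wishart a (B (mat_of s)) * expR (- \tr (B (mat_of s))))%:E.
  have mB i j : measurable_fun setT (fun s : (dimS p).-tuple R => B (mat_of s) i j).
    case: (split_ordP i) => i' ->; case: (split_ordP j) => j' ->.
    - by rewrite (_ : (fun s => _) = cst (x%:M i' j'))//; apply/funext => s; rewrite block_mxEul.
    - by rewrite (_ : (fun s => _) = cst ((rv r)^T i' j'))//; apply/funext => s; rewrite block_mxEur.
    - by rewrite (_ : (fun s => _) = cst ((rv r) i' j'))//; apply/funext => s; rewrite block_mxEdl.
    rewrite (_ : (fun s => _) = (fun s : (dimS p).-tuple R => mat_of s i' j')).
      exact: measurable_mat_of.
    by apply/funext => s; rewrite block_mxEdr.
  have mh : measurable_fun setT h.
    apply/measurable_EFinP; apply: measurable_funM.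
      apply: measurable_wishart => // s.
      by rewrite /B tr_block_mx trmxK mat_of_sym tr_scalar_mx.
    apply: measurableT_comp => //; apply: measurableT_comp => //.
    by apply: measurable_sum => i; exact: mB.
  have h0 s : (0 <= h s)%E by rewrite lee_fin mulr_ge0 ?wishart_ge0 ?expR_ge0.
  have c0 : (0 <= (x `^ e * expR (- x) * \prod_i expR (- (tnth r i ^+ 2 / x)))%:E)%E.
    by rewrite lee_fin !mulr_ge0 ?powR_ge0 ?expR_ge0 ?prodr_ge0// => i _; exact: expR_ge0.
  rewrite /wishart_int -(tonZ (tonelli_leb_int_S R p) c0 (W0 _ _) (mW _ _)).
  transitivity (leb_int_S h).
    by congr leb_int_S; apply/funext => s /=; rewrite BK.
  rewrite -(leb_int_S_translate Cs h0 mh); congr leb_int_S; apply/funext => s.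
  rewrite /h coords_ofK; last by rewrite linearD/= mat_of_sym Cs.
  rewrite -EFinM; congr EFin.
  have BE : (mat_of s + C) - x^-1 *: (rv r *m (rv r)^T) = mat_of s by rewrite addrK.
  have [sp|sp] := pselect (pdmx (mat_of s)); last first.
    by rewrite !wishart_npd ?mul0r ?mulr0// => /pd_block[_]; rewrite BE.
  rewrite !wishart_pd//; last by apply/pd_block; rewrite BE.
  rewrite det_block_schur ?gt_eqF// BE powRM ?(ltW x0)//; last exact/ltW/pd_det_gt0.
  rewrite trace_block mxtraceD /C mxtraceZ.
  have -> : \tr (rv r *m (rv r)^T) = \sum_i tnth r i ^+ 2.
    by apply: eq_bigr => i _; rewrite !mxE big_ord1 !mxE expr2.
  rewrite -/e; have -> : a - 2^-1 - p.+1%:R / 2 = e by rewrite /e -!natr1; field.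
  have -> : \prod_(i < p) expR (- (tnth r i ^+ 2 / x)) = expR (- (x^-1 * \sum_i tnth r i ^+ 2)).
    rewrite -expR_sum; congr expR; rewrite sumrN mulr_sumr; congr (- _).
    by apply: eq_bigr => i _; rewrite mulrC.
  by rewrite !opprD !expRD; ring.
set W := wishart_int p (a - 2^-1).
have W0' : (0 <= W)%E by apply: (ton_ge0 (tonelli_leb_int_S R p)).
transitivity (\int[mu]_x (((pi `^ (p%:R / 2))%:E * W) *
   ((fun x => (x `^ (a - 1) * expR (- x))%:E) \_ [set t : R | (0 < t)%R]) x))%E.
  apply: eq_integral => x _.
  transitivity (leb_int (fun r : p.-tuple R =>
     if (0 < x)%R then (x `^ e * expR (- x) * \prod_i expR (- ((tnth r i) ^+ 2 / x)))%:E * W else 0))%E.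
    by congr leb_int; apply/funext => r; rewrite -inner.
  case: ltP => x0; last first.
    rewrite patchE memNset ?mule0 ?(ton_cst0 (tonelli_leb_int R p))//=.
    by apply/negP; rewrite -leNgt.
  rewrite patchE mem_set//=.
  transitivity (leb_int (fun r : p.-tuple R =>
     (x `^ e * expR (- x))%:E * W * (\prod_i expR (- ((tnth r i) ^+ 2 / x)))%:E))%E.
    by congr leb_int; apply/funext => r; rewrite EFinM muleAC.
  rewrite (tonZ (tonelli_leb_int R p)); last 3 first.
  - by rewrite mule_ge0// lee_fin mulr_ge0 ?powR_ge0 ?expR_ge0.
  - by move=> r; rewrite lee_fin prodr_ge0// => i _; exact: expR_ge0.
  - apply/measurable_EFinP; apply: measurable_prodr => i.
    apply: measurableT_comp => //; apply: measurableT_comp => //.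
    by apply: measurable_funM => //; apply: measurable_funX; exact: measurable_tnth.
  rewrite (leb_int_prod _ _ _ (integral_gauss_scale x0)); last 2 first.
  - by move=> y; exact: expR_ge0.
  - apply: measurableT_comp => //; apply: measurableT_comp => //.
    by apply: measurable_funM => //; exact: measurable_funX.
  rewrite -[RHS]muleA [RHS]muleCA -[LHS]muleA [LHS]muleCA; congr (_ * _)%E.
  rewrite -!EFinM; congr EFin.
  rewrite -powR12_sqrt ?mulr_ge0 ?pi_ge0 ?(ltW x0)// -powR_mulrn ?powR_ge0// -powRrM.
  rewrite powRM ?pi_ge0 ?(ltW x0)//.
  (* The Gaussian integral contributes (pi x)^(p/2), which raises x^e to x^(a-1). *)
  have -> : a - 1 = e + 2^-1 * p%:R by rewrite /e -!natr1; field.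
  rewrite powRD ?(gt_eqF x0) ?implybT// [2^-1 * _]mulrC; ring.
have mD : measurable [set t : R | (0 < t)%R].
  rewrite (_ : [set t | _] = `]0, +oo[%classic)//.
  by apply/seteqP; split=> t /=; rewrite in_itv/= andbT.
have mf : measurable_fun setT (fun x : R => (x `^ (a - 1) * expR (- x))%:E).
  apply/measurable_EFinP; apply: measurable_funM; first exact: measurable_powR.
  by apply: measurableT_comp.
rewrite ge0_integralZl//.
- by rewrite -integral_mkcond muleAC.
- by apply/(measurable_restrictT _ mD); apply: measurable_funTS.
- by move=> x _; rewrite patchE; case: ifP => // _; rewrite lee_fin mulr_ge0 ?powR_ge0 ?expR_ge0.
- by rewrite mule_ge0// lee_fin powR_ge0.
Qed.

Lemma leb_int_dim0 N (g : N.-tuple R -> \bar R) c :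
  N = 0 -> (forall t, g t = c) -> leb_int g = c.
Proof. by move=> N0 gc; subst N; rewrite /leb_int /= gc. Qed.

Lemma wishart_int0 (a : R) : wishart_int 0 a = 1%E.
Proof.
apply: leb_int_dim0 => [|t]; first by apply: eq_card0 => -[[[]]].
rewrite wishart_pd; last first.
  by split=> [|v /eqP[]]; [exact: mat_of_sym|apply/matrixP; case].
by rewrite det_mx00 powR1 mul1r /mxtrace big_ord0 oppr0 expR0.
Qed.

Lemma gamma_int_ge0 (x : R) : (0 <= gamma_int x)%E.
Proof. by apply: integral_ge0 => t _; rewrite lee_fin mulr_ge0 ?powR_ge0 ?expR_ge0. Qed.

(** The exponents of pi add up to 0 + 1/2 + ... + (p-1)/2 = p (p-1) / 4. *)
Theorem wishart_intE p (a : R) : wishart_int p a =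
  ((pi `^ ((p * p.-1)%:R / 4))%:E * \prod_(i < p) gamma_int (a - i%:R / 2))%E.
Proof.
elim: p a => [|p IH] a; first by rewrite big_ord0 wishart_int0 mule1 mul0r powRr0.
rewrite wishart_intS IH big_ord_recl/= mul0r subr0.
under [in RHS]eq_bigr => i _.
  have -> : a - (bump 0 i)%:R / 2 = a - 2^-1 - i%:R / 2 by rewrite /bump/= add1n -natr1; field.
  over.
rewrite muleA [RHS]muleA; congr (_ * _)%E.
rewrite muleAC; congr (_ * _)%E; rewrite -EFinM; congr EFin.
rewrite -powRD ?(gt_eqF (pi_gt0 _)) ?implybT//; congr (_ `^ _).
case: p {IH} => [|p]/=; first by rewrite ?muln0 !mul0r addr0.
by rewrite !natrM -!natr1; field.
Qed.

(** For n above x, t^(x-1) is at most 1 + t^n, and t^n is absorbed by e^(t/2) through s <= e^s at s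
    = t / (2 n). *)
Lemma powR_expR_bound (x : R) : 1 <= x -> exists2 C : R, 0 <= C &
  forall t, 0 < t -> t `^ (x - 1) * expR (- t) <= C * expR (- (2^-1 * t)).
Proof.
move=> x1; pose n := (Num.truncn x).+1.
have n0 : (0 : R) < n%:R by rewrite ltr0n.
exists (1 + (2 * n%:R) ^+ n) => [|t t0]; first by rewrite addr_ge0// exprn_ge0// mulr_ge0// ltW.
have b1 : t `^ (x - 1) <= 1 + t ^+ n.
  have [t1|t1] := leP t 1.
    have : t `^ (x - 1) <= 1 `^ (x - 1).
      by apply: ge0_ler_powR; rewrite ?subr_ge0 ?nnegrE ?ler01 ?(ltW t0).
    by rewrite powR1 => /le_trans; apply; rewrite lerDl exprn_ge0// ltW.
  apply: (@le_trans _ _ (t ^+ n)); last by rewrite lerDr.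
  rewrite -powR_mulrn ?(ltW t0)//; apply: ler_powR; first exact: ltW.
  rewrite lerBlDr (le_trans (ltW (truncnS_gt x)))// lerDl.
  by [].
have b2 : t ^+ n <= (2 * n%:R) ^+ n * expR (2^-1 * t).
  have -> : expR (2^-1 * t) = expR (t / (2 * n%:R)) ^+ n.
    by rewrite -expRM_natl; congr expR; field; rewrite gt_eqF.
  rewrite -exprMn lerXn2r ?nnegrE ?(ltW t0)//.
  rewrite mulrC -ler_pdivrMr ?mulr_gt0//.
  by apply: le_trans (expR_ge1Dx _); rewrite lerDr.
have e0 := expR_gt0 (- t).
have eE : expR (- (2^-1 * t)) = expR (2^-1 * t) * expR (- t).
  by rewrite -expRD; congr expR; field.
have e1 : 1 <= expR (2^-1 * t) by rewrite -expR0 ler_expR mulr_ge0// ltW.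
rewrite eE mulrA ler_pM2r//; apply: le_trans b1 _; rewrite mulrDl mul1r.
exact: lerD.
Qed.

Lemma gamma_int_lty (x : R) : 1 <= x -> (gamma_int x < +oo)%E.
Proof.
move=> x1; have [C C0 Cb] := powR_expR_bound x1.
rewrite /gamma_int integral_mkcond.
(* The bound is 2 C times the exponential density of rate 1/2, whose integral is 1. *)
apply: (@le_lt_trans _ _ (\int[mu]_t ((2 * C)%:E * (exponential_pdf 2^-1 t)%:E))%E).
  apply: ge0_le_integral_nomeas => t.
    by rewrite patchE; case: ifP => // _; rewrite lee_fin mulr_ge0 ?powR_ge0 ?expR_ge0.
  rewrite patchE -EFinM /exponential_pdf patchE.
  case: ifPn => [/set_mem/= t0|t0].
    rewrite mem_set/=; last by rewrite in_itv/= andbT ltW.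
    rewrite lee_fin (_ : 2 * C * _ = C * expR (- (2^-1 * t))) ?Cb//.
    by rewrite mulNr; field.
  by rewrite -[point]/(0%:E) lee_fin !mulr_ge0//; case: ifP => // _; rewrite mulr_ge0 ?expR_ge0.
rewrite ge0_integralZl//.
- by rewrite integral_exponential_pdf ?invr_gt0// mule1 ltry.
- by apply/measurable_EFinP; apply: measurable_exponential_pdf.
- by move=> t _; rewrite lee_fin exponential_pdf_ge0// invr_ge0.
- by rewrite lee_fin mulr_ge0.
Qed.

(** On [1, 2] the integrand is at least e^(-2). *)
Lemma gamma_int_gt0 (x : R) : 1 <= x -> (0 < gamma_int x)%E.
Proof.
move=> x1; apply: (@lt_le_trans _ _ (\int[mu]_t ((expR (- 2))%:E * (\1_`[1, 2] t)%:E))%E).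
  rewrite ge0_integralZl ?lee_fin ?expR_ge0//; last exact/measurable_EFinP/measurable_indic.
  rewrite integral_indic// setIT /= lebesgue_measure_itv/= lte_fin ltr1n -EFinD -EFinM.
  by rewrite lte_fin mulr_gt0 ?expR_gt0//; lra.
rewrite /gamma_int [leRHS]integral_mkcond.
apply: ge0_le_integral_nomeas => t; first by rewrite mule_ge0// lee_fin ?expR_ge0.
rewrite patchE indicE; case: (boolP (t \in `[1, 2]%classic)) => [/set_mem/=|_]; last first.
  by rewrite mule0; case: ifP => // _; rewrite lee_fin mulr_ge0 ?powR_ge0 ?expR_ge0.
rewrite in_itv/= => /andP[t1 t2]; rewrite mem_set/= ?(lt_le_trans _ t1)//.
rewrite mule1 lee_fin -[leLHS]mul1r ler_pM ?expR_ge0//; last by rewrite ler_expR lerN2.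
suff : 1 `^ (x - 1) <= t `^ (x - 1) by rewrite powR1.
by apply: ge0_ler_powR; rewrite ?subr_ge0 ?nnegrE ?(le_trans _ t1).
Qed.

Lemma GammaE (x : R) : 1 <= x -> gamma_int x = (Gamma x)%:E.
Proof.
move=> x1; rewrite -[Gamma x]/(fine (gamma_int x)) fineK//.
by rewrite ge0_fin_numE ?gamma_int_ge0// gamma_int_lty.
Qed.

Lemma Gamma_gt0 (x : R) : 1 <= x -> 0 < Gamma x.
Proof. by move=> x1; rewrite -lte_fin -GammaE// gamma_int_gt0. Qed.

(** The bound (p+1)/2 keeps every argument in the product defining [Gamma_p] in the range where the
    gamma integral was shown finite and positive. *)
Lemma half_shift_ge1 p (a : R) (i : 'I_p) : p.+1%:R / 2 <= a -> 1 <= a - i%:R / 2.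
Proof.
move=> pa; rewrite lerBrDr (le_trans _ pa)// ler_pdivlMr// mulrDl mul1r divfK//.
by rewrite -natrD ler_nat; have := ltn_ord i; lia.
Qed.

Lemma Gamma_p_gt0 p (a : R) : p.+1%:R / 2 <= a -> 0 < Gamma_p p a.
Proof.
move=> pa; rewrite mulr_gt0 ?powR_gt0 ?pi_gt0// prodr_gt0// => i _.
exact/Gamma_gt0/half_shift_ge1.
Qed.

Lemma wishart_int_Gamma_p p (a : R) : p.+1%:R / 2 <= a ->
  wishart_int p a = (Gamma_p p a)%:E.
Proof.
move=> pa; rewrite wishart_intE /Gamma_p EFinM -prodEFin; congr (_ * _)%E.
by apply: eq_bigr => i _; rewrite GammaE//; exact: half_shift_ge1.
Qed.

Lemma powR_sqr_half (d : R) n : 0 <= d -> (d ^+ 2) `^ (n%:R / 2) = d ^+ n.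
Proof.
by move=> d0; rewrite -(powR_mulrn 2)// -powRrM mulrCA mulfV// mulr1 powR_mulrn.
Qed.

Lemma wishart_congr p a (Q X : 'M[R]_p) : Q^T = Q -> Q \in unitmx ->
  wishart a (Q *m X *m Q) = (\det Q ^+ 2) `^ (a - p.+1%:R / 2) * wishart a X.
Proof.
move=> Qs Qu; have [Xp|Xp] := pselect (pdmx X); last first.
  rewrite !wishart_npd ?mulr0// -{1}Qs => H; exact/Xp/(pd_congrV Qu).
rewrite !wishart_pd//; last by rewrite -{1}Qs; exact: pd_congr.
rewrite -powRM ?sqr_ge0// ?(ltW (pd_det_gt0 Xp))//; congr (_ `^ _).
by rewrite !det_mulmx; ring.
Qed.

Definition beta_int p (a b : R) : \bar R := leb_int_S (fun t : (dimS p).-tuple R =>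
  (wishart a (mat_of t) * wishart b (1%:M - mat_of t))%:E).

Lemma measurable_wishart_exp p a : measurable_fun setT (fun t : (dimS p).-tuple R =>
  (wishart a (mat_of t) * expR (- \tr (mat_of t)))%:E).
Proof.
apply/measurable_EFinP; apply: measurable_funM.
  by apply: measurable_wishart; [exact: measurable_mat_of|exact: mat_of_sym].
apply: measurableT_comp => //; apply: measurableT_comp => //.
by apply: measurable_sum => i; exact: measurable_mat_of.
Qed.

Lemma measurable_mat_ofB d (T : measurableType d) p (F G : T -> 'M[R]_p) :
  (forall i j, measurable_fun setT (fun x => F x i j)) ->
  (forall i j, measurable_fun setT (fun x => G x i j)) ->
  forall i j, measurable_fun setT (fun x => (F x - G x) i j).
Proof.
move=> mF mG i j; rewrite (_ : (fun x => _) = fun x => F x i j - G x i j).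
  exact: measurable_funB.
by apply/funext => x; rewrite !mxE.
Qed.

(** For definite Z substitute t = Z^(1/2) u Z^(1/2): the two densities give det Z to the power a + b
    - (p+1), the Jacobian another (p+1)/2. For other Z both sides vanish, a sum of definite matrices
    being definite. *)
Lemma wishart_convolution p a b (Z : 'M[R]_p) : Z^T = Z ->
  leb_int_S (fun t : (dimS p).-tuple R => (wishart a (mat_of t) * wishart b (Z - mat_of t))%:E)
  = (beta_int p a b * (wishart (a + b) Z)%:E)%E.
Proof.
move=> Zs; have [Zp|Zp] := pselect (pdmx Z); last first.
  rewrite (wishart_npd _ Zp) mule0 -(ton_cst0 (tonelli_leb_int_S R p)).
  congr leb_int_S; apply/funext => t; have [tp|tp] := pselect (pdmx (mat_of t)); last first.
    by rewrite wishart_npd ?mul0r.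
  rewrite [X in _ * X]wishart_npd ?mulr0// => ztp; apply: Zp.
  by rewrite -(subrK (mat_of t) Z); apply: pdD => //; exact: pd_psd.
set h := fun t => _.
have h0 t : (0 <= h t)%E by rewrite /h lee_fin mulr_ge0 ?wishart_ge0.
have mh : measurable_fun setT h.
  apply/measurable_EFinP; apply: measurable_funM; apply: measurable_wishart.
  - exact: measurable_mat_of.
  - exact: mat_of_sym.
  - by apply: measurable_mat_ofB; [move=> i j; exact: measurable_cst|exact: measurable_mat_of].
  - by move=> t; rewrite linearB/= Zs mat_of_sym.
have [Qp QQ] := sqrtmx_pd Zp; set Q := sqrtmx Z in Qp QQ.
have Qs : Q^T = Q by case: Qp.
have dQ := pd_det_gt0 Qp.
have := leb_int_S_congr Qs (pd_unit Qp) (trmx0 _ _ _) h0 mh.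
rewrite gtr0_norm// => /(congr1 (fun y => (\det Q ^+ p.+1)%:E * y)%E).
rewrite muleA -EFinM mulfV ?expf_neq0 ?gt_eqF// mul1e => <-.
pose c : R := p.+1%:R / 2.
have hE t : h (coords_of (Q *m mat_of t *m Q + 0)) =
    (((\det Z) `^ (a + b - c - c))%:E *
     (wishart a (mat_of t) * wishart b (1%:M - mat_of t))%:E)%E.
  rewrite /h addr0 coords_ofK; last by rewrite !trmx_mul Qs mat_of_sym mulmxA.
  have -> : Z - Q *m mat_of t *m Q = Q *m (1%:M - mat_of t) *m Q.
    by rewrite mulmxBr mulmx1 mulmxBl QQ.
  rewrite !wishart_congr ?pd_unit// -EFinM; congr EFin.
  have -> : \det Q ^+ 2 = \det Z by rewrite -QQ det_mulmx.
  have -> : a + b - c - c = (a - c) + (b - c) by ring.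
  rewrite [X in _ = X * _]powRD ?(gt_eqF (pd_det_gt0 Zp)) ?implybT// -/c; ring.
under eq_fun do rewrite hE.
rewrite (tonZ (tonelli_leb_int_S R p)); last 3 first.
- by rewrite lee_fin powR_ge0.
- by move=> t; rewrite lee_fin mulr_ge0 ?wishart_ge0.
- apply/measurable_EFinP; apply: measurable_funM; apply: measurable_wishart.
  + exact: measurable_mat_of.
  + exact: mat_of_sym.
  + by apply: measurable_mat_ofB; [move=> i j; exact: measurable_cst|exact: measurable_mat_of].
  + by move=> t; rewrite linearB/= trmx1 mat_of_sym.
rewrite -/(beta_int p a b) muleA muleC; congr (_ * _)%E.
rewrite wishart_pd// -EFinM; congr EFin.
have -> : \det Q ^+ p.+1 = (\det Z) `^ c.
  by rewrite -QQ det_mulmx -expr2 powR_sqr_half// ltW.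
rewrite -powRD ?(gt_eqF (pd_det_gt0 Zp)) ?implybT//; congr (_ `^ _).
by rewrite /c; field.
Qed.

Lemma beta_int_ge0 p a b : (0 <= beta_int p a b)%E.
Proof.
by apply: (ton_ge0 (tonelli_leb_int_S R p)) => t; rewrite lee_fin mulr_ge0 ?wishart_ge0.
Qed.

(** Euler's argument for matrices: in the double integral the second variable is replaced by the sum
    of both, and the inner integral becomes a convolution. *)
Theorem wishart_intM p a b :
  (wishart_int p a * wishart_int p b = beta_int p a b * wishart_int p (a + b))%E.
Proof.
have tI := tonelli_leb_int_S R p.
pose F c (t : (dimS p).-tuple R) : \bar R := (wishart c (mat_of t) * expR (- \tr (mat_of t)))%:E.
have F0 c t : (0 <= F c t)%E by rewrite lee_fin mulr_ge0 ?wishart_ge0 ?expR_ge0.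
have mF c : measurable_fun setT (F c) := @measurable_wishart_exp p c.
have W0 c : (0 <= wishart_int p c)%E by exact: (ton_ge0 tI (F0 c)).
pose K (z : (dimS p).-tuple R * (dimS p).-tuple R) : \bar R :=
  (wishart a (mat_of z.1) * wishart b (mat_of z.2 - mat_of z.1) * expR (- \tr (mat_of z.2)))%:E.
have K0 z : (0 <= K z)%E by rewrite lee_fin mulr_ge0 ?expR_ge0// mulr_ge0 ?wishart_ge0.
have m1 i j : measurable_fun setT (fun z : (dimS p).-tuple R * (dimS p).-tuple R => mat_of z.1 i j).
  exact: (measurableT_comp (measurable_mat_of _ _)).
have m2 i j : measurable_fun setT (fun z : (dimS p).-tuple R * (dimS p).-tuple R => mat_of z.2 i j).
  exact: (measurableT_comp (measurable_mat_of _ _)).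
have mK : measurable_fun setT K.
  apply/measurable_EFinP; apply: measurable_funM; first apply: measurable_funM.
  - by apply: measurable_wishart => // z; exact: mat_of_sym.
  - apply: measurable_wishart; first exact: measurable_mat_ofB.
    by move=> z; rewrite linearB/= !mat_of_sym.
  - apply: measurableT_comp => //; apply: measurableT_comp => //.
    by apply: measurable_sum => i; exact: m2.
transitivity (leb_int_S (fun t => leb_int_S (fun s => K (t, s)))).
  rewrite muleC -[wishart_int p a]/(leb_int_S (F a)) -(tonZ tI)//.
  congr leb_int_S; apply/funext => t.
  rewrite muleC -[wishart_int p b]/(leb_int_S (F b)) -(tonZ tI)//.
  have Ct : (- mat_of t)^T = - mat_of t by rewrite linearN/= mat_of_sym.
  rewrite -(leb_int_S_translate Ct)//; last 2 first.
  - by move=> s; exact: mule_ge0.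
  - by apply: emeasurable_funM => //; exact: measurable_cst.
  congr leb_int_S; apply/funext => s.
  rewrite /F /K coords_ofK; last by rewrite linearB/= !mat_of_sym.
  rewrite -EFinM; congr EFin; rewrite /= mxtraceD.
  have -> : - (\tr (mat_of s) + \tr (- mat_of t)) = \tr (mat_of t) - \tr (mat_of s).
    by rewrite linearN/=; ring.
  rewrite expRD; have := expR_gt0 (\tr (mat_of t)); rewrite expRN => /gt_eqF e0.
  by field; rewrite e0.
have comm : commuting (@leb_int_S R p) (@leb_int_S R p) by exact: commuting_leb_int.
rewrite comm// -[wishart_int p (a + b)]/(leb_int_S (F (a + b))).
rewrite -(tonZ tI) ?beta_int_ge0//; congr leb_int_S; apply/funext => s.
rewrite /F EFinM muleA -wishart_convolution ?mat_of_sym// muleC -(tonZ tI); last 3 first.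
- by rewrite lee_fin expR_ge0.
- by move=> t; rewrite lee_fin mulr_ge0 ?wishart_ge0.
- apply/measurable_EFinP; apply: measurable_funM; apply: measurable_wishart.
  + exact: measurable_mat_of.
  + exact: mat_of_sym.
  + by apply: measurable_mat_ofB; [move=> i j; exact: measurable_cst|exact: measurable_mat_of].
  + by move=> t; rewrite linearB/= !mat_of_sym.
by congr leb_int_S; apply/funext => t; rewrite /K -EFinM mulrC.
Qed.

(** Comparison with the finite positive value [Gamma_p p (a + b)] also excludes an infinite beta
    integral. *)
Corollary beta_intE p a b : p.+1%:R / 2 <= a -> p.+1%:R / 2 <= b ->
  beta_int p a b = (Beta_p p a b)%:E /\ 0 < Beta_p p a b.
Proof.
move=> pa pb; have pab : p.+1%:R / 2 <= a + b.
  by rewrite (le_trans pa)// lerDl (le_trans _ pb)// mulr_ge0.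
have [[ga gb] gab] := (Gamma_p_gt0 pa, Gamma_p_gt0 pb, Gamma_p_gt0 pab).
split; last exact: (divr_gt0 (mulr_gt0 ga gb) gab).
have := wishart_intM p a b; rewrite (wishart_int_Gamma_p pa) (wishart_int_Gamma_p pb).
rewrite (wishart_int_Gamma_p pab) /Beta_p.
move: (Gamma_p p a) (Gamma_p p b) (Gamma_p p (a + b)) gab => x y z z0.
have := beta_int_ge0 p a b; case: (beta_int p a b) => [w w0|_|//].
  by rewrite -!EFinM => -[->]; rewrite mulfK// gt_eqF.
by rewrite gt0_mulye.
Qed.

End MultivariateGamma.

(** * Quadrature for interior moments *)

Section DiscreteCharge.
Variable R : realType.
Local Notation T := (measurableTypeR R).

Definition atoms (n : nat) (c : nat -> {nonneg R}) (d : nat -> T) : set T -> \bar R :=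
  msum (fun l => mscale (c l) (dirac (d l))) n.

HB.instance Definition _ n c d := Measure.on (@atoms n c d).

Lemma atomsE n c d A : @atoms n c d A = (\sum_(l < n) (c l)%:num * \1_A (d l))%:E.
Proof. by rewrite /atoms /msum /mscale /dirac -sumEFin; apply: eq_bigr => l _; rewrite EFinM. Qed.

Lemma atoms_fin n c d : fin_num_fun (@atoms n c d).
Proof. by move=> A _; rewrite atomsE. Qed.

HB.instance Definition _ n c d := @Measure_isFinite.Build _ T R (@atoms n c d) (@atoms_fin n c d).

Lemma integral_atoms n c d (D : set T) (f : T -> R) : measurable D ->
  (forall x, 0 <= f x) -> measurable_fun setT f ->
  (\int[@atoms n c d]_(x in D) (f x)%:E = (\sum_(l < n) (c l)%:num * (\1_D (d l) * f (d l)))%:E)%E.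
Proof.
move=> mD f0 mf.
have mf' : measurable_fun D (fun x => (f x)%:E).
  by apply/measurable_EFinP; exact: measurable_funTS.
rewrite ge0_integral_measure_sum//; last by move=> x _; rewrite lee_fin.
rewrite -sumEFin; apply: eq_bigr => l _.
rewrite ge0_integral_mscale//; last by move=> x _; rewrite lee_fin.
by rewrite integral_dirac// diracE /= EFinM EFinM indicE.
Qed.

(** The weights may be negative; their positive and negative parts provide the two finite measures
    that [charge_moment] asks for. *)
Lemma discrete_charge n (c : nat -> R) (d : nat -> R) : (forall l, 0 <= d l <= 1) ->
  exists nu : {charge set T -> \bar R},
    (forall A, nu A = (\sum_(l < n) c l * \1_A (d l))%:E) /\
    forall k, charge_moment nu k (\sum_(l < n) c l * d l ^+ k).
Proof.
move=> d01.
have cp0 l : 0 <= Num.max (c l) 0 by rewrite le_max lexx orbT.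
have cn0 l : 0 <= Num.max (- c l) 0 by rewrite le_max lexx orbT.
have cE l : c l = Num.max (c l) 0 - Num.max (- c l) 0.
  by have [c0|c0] := leP 0 (c l); have [n0|n0] := leP 0 (- c l); lra.
pose a : {finite_measure set T -> \bar R} := @atoms n (fun l => NngNum (cp0 l)) d.
pose b : {finite_measure set T -> \bar R} := @atoms n (fun l => NngNum (cn0 l)) d.
pose nu : {charge set T -> \bar R} :=
  cadd (charge_of_finite_measure a) (copp (charge_of_finite_measure b)).
have nuE A : nu A = (a A - b A)%E by [].
exists nu; split=> [A|k].
  rewrite nuE [a A]atomsE [b A]atomsE -EFinB -sumrB; congr _%:E; apply: eq_bigr => l _.
  by rewrite -mulrBl -cE.
exists a, b; split=> [A _|]; first exact: nuE.
have xk0 (x : T) : `[0%R, 1%R]%classic x -> 0 <= x ^+ k.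
  by rewrite /= in_itv/= => /andP[x0 _]; rewrite exprn_ge0.
have E c' : (\int[@atoms n c' d]_(t in `[0%R, 1%R]%classic) (t ^+ k)%:E =
    (\sum_(l < n) (c' l)%:num * d l ^+ k)%:E)%E.
  (* The absolute value makes the integrand nonnegative outside [0, 1] too. *)
  transitivity (\int[@atoms n c' d]_(t in `[0%R, 1%R]%classic) (`|t ^+ k|)%:E)%E.
    by apply: eq_integral => x; rewrite inE => /xk0 x0; rewrite ger0_norm.
  rewrite integral_atoms//; last first.
    by apply: measurableT_comp => //; exact: exprn_measurable.
  congr _%:E; apply: eq_bigr => l _; rewrite indicE mem_set ?mul1r.
    by rewrite ger0_norm//; apply: xk0; rewrite /= in_itv/= d01.
  by rewrite /= in_itv/= d01.
rewrite [X in (X - _)%E]E [X in (_ - X)%E]E -EFinB -sumrB; congr _%:E; apply: eq_bigr => l _.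
by rewrite -mulrBl -cE.
Qed.

End DiscreteCharge.

(** * Gauss quadrature from a pencil of Hankel matrices *)

Section Quadrature.
Variables (R : realType) (p : nat).
Implicit Types S : nat -> 'M[R]_p.

(** Diagonalise H^(-1/2) K H^(-1/2) by an orthogonal P and set W = P H^(1/2); definiteness of K and
    of H - K puts the eigenvalues in (0, 1). *)
Lemma pencil_diag n (H K : 'M[R]_n) : pdmx H -> pdmx K -> pdmx (H - K) ->
  exists (W : 'M[R]_n) (d : 'rV[R]_n), [/\ W \in unitmx, H = W^T *m W,
    K = W^T *m diag_mx d *m W & forall l, 0 < d 0 l < 1].
Proof.
move=> Hp Kp HKp; have [Qp QQ] := sqrtmx_pd Hp; set Q := sqrtmx H in Qp QQ.
have Qu := pd_unit Qp; have Qs : Q^T = Q := Qp.1.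
have Vs : (invmx Q)^T = invmx Q by rewrite trmx_inv Qs.
have Np : pdmx (invmx Q *m K *m invmx Q).
  by rewrite -[X in X *m K]Vs; apply: pd_congr => //; rewrite unitmx_inv.
have Np1 : pdmx (1%:M - invmx Q *m K *m invmx Q).
  rewrite (_ : 1%:M - _ = (invmx Q)^T *m (H - K) *m invmx Q).
    by apply: pd_congr => //; rewrite unitmx_inv.
  by rewrite Vs mulmxBr mulmxBl -QQ mulmxA mulVmx// mul1mx mulmxV.
have [P [d [PP NE]]] := sym_spectral Np.1; exists (P *m Q), d.
have PP' := mulmx1C PP; have Pu := (mulmx1_unit PP).1.
split.
- by rewrite unitmx_mul Pu.
- by rewrite trmx_mul Qs mulmxA -(mulmxA Q) PP' mulmx1.
- rewrite trmx_mul Qs !mulmxA -(mulmxA Q P^T) -(mulmxA Q (P^T *m _)) -NE.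
  by rewrite !mulmxA mulmxV// mul1mx mulmxKV.
- move=> l; have e0 : P^T *m delta_mx l 0 != 0 :> 'cV_n.
    apply/eqP => /(congr1 (mulmx P)); rewrite mulmxA PP mul1mx mulmx0.
    by move=> /matrixP/(_ l 0)/eqP; rewrite !mxE !eqxx oner_eq0.
  have := Np.2 _ e0; have := Np1.2 _ e0; rewrite -!/(bf _ _ _) NE bfAD bfAN.
  rewrite spectral_diagE// => h1 h0; rewrite h0 -subr_gt0; move: h1.
  congr (_ < _ - _); rewrite /bf mulmx1 trmx_mul trmxK mulmxA -(mulmxA _ P) PP mulmx1.
  by rewrite trmx_delta mul_delta_mx mxE !eqxx.
Qed.

Definition bunit m j := bcol m (fun i => if i == j then 1%:M else 0 : 'M[R]_p).

Lemma hankel_bunit m F j : (j < m)%N -> hankel m F *m bunit m j = bcol m (fun i => F (i + j)%N).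
Proof.
move=> jm; rewrite /hankel /bunit /bcol mul_mxblock_mxrow; apply/eq_mxcol => i.
rewrite (bigD1 (Ordinal jm))//= eqxx mulmx1 big1 ?addr0// => k /negPf kj.
by rewrite (_ : (k == j :> nat) = false) ?mulmx0.
Qed.

Lemma bunit_bcol m F i : (i < m)%N -> (bunit m i)^T *m bcol m F = F i.
Proof.
move=> im; rewrite /bunit /bcol tr_mxcol mul_mxrow_mxcol.
rewrite (bigD1 (Ordinal im))//= eqxx trmx1 mul1mx big1 ?addr0// => k /negPf kj.
by rewrite (_ : (k == i :> nat) = false) ?trmx0 ?mul0mx.
Qed.

(* The relations [K e_j = H e_(j+1)] between block unit vectors become
   [W e_(j+1) = D W e_j], so the generalised eigenvalues are the nodes. *)
Lemma quadrature m S : (forall t, (S t)^T = S t) -> (0 < m)%N ->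
  posform m S -> posform m (fun t => S t.+1) -> posform m (fun t => S t - S t.+1) ->
  exists (n : nat) (d : 'I_n -> R) (Y : 'M[R]_(n, p)), (forall l, 0 < d l < 1) /\
    forall k, (k < m.*2)%N -> S k = \matrix_(i, j) \sum_l d l ^+ k * (Y l i * Y l j).
Proof.
move=> Ss m0 Hp Kp HKp.
pose H := hankel m S; pose K := hankel m (fun t => S t.+1).
have HK : pdmx (H - K).
  rewrite (_ : H - K = hankel m (fun t => S t - S t.+1)).
    by apply: hankel_pd => // t; rewrite linearB/= !Ss.
  rewrite /H /K /hankel; apply/matrixP => a b; by rewrite !mxE.
have [W [d [Wu HE KE d01]]] := pencil_diag (hankel_pd Ss Hp)
  (hankel_pd (fun t => Ss t.+1) Kp) HK.
have WTu : W^T \in unitmx by rewrite unitmx_tr.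
have step j : (j.+1 < m)%N -> W *m bunit m j.+1 = diag_mx d *m (W *m bunit m j).
  move=> jm; apply: (can_inj (mulKmx WTu)).
  rewrite !mulmxA -HE -KE !hankel_bunit//; last exact: ltnW.
  by apply/eq_mxcol => i; rewrite addnS.
have WE j l a : (j < m)%N -> (W *m bunit m j) l a = d 0 l ^+ j * (W *m bunit m 0) l a.
  elim: j => [|j IH] jm; first by rewrite mul1r.
  by rewrite step// mul_diag_mx mxE IH ?(ltnW jm)// mulrA -exprS.
exists _, (fun l => d 0 l), (W *m bunit m 0); split=> // k km.
have SE i j : (i < m)%N -> (j < m)%N ->
    S (i + j)%N = (W *m bunit m i)^T *m (W *m bunit m j).
  move=> im jm; rewrite trmx_mul -mulmxA (mulmxA W^T) -HE hankel_bunit//.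
  by rewrite bunit_bcol.
have SE1 i j : (i < m)%N -> (j < m)%N ->
    S (i + j).+1 = (W *m bunit m i)^T *m (diag_mx d *m (W *m bunit m j)).
  move=> im jm; rewrite trmx_mul -mulmxA (mulmxA W^T) (mulmxA (W^T *m _)) -KE hankel_bunit//.
  by rewrite bunit_bcol.
(* Indices up to 2 m - 2 are read off H as i + j; the last one, 2 m - 1, sits in the corner block of
   K. *)
have [km1|km1] := ltnP k (m + m.-1).
  have [i [j [im jm ->]]] : exists i j, [/\ (i < m)%N, (j < m)%N & k = (i + j)%N].
    by exists (minn k m.-1), (k - minn k m.-1)%N; split; lia.
  apply/matrixP => a b; rewrite SE// mxE [in RHS]mxE; apply: eq_bigr => l _.
  by rewrite mxE (WE i)// (WE j)// exprD; ring.
have [km2 im] : k = (m.-1 + m.-1).+1 /\ (m.-1 < m)%N by lia.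
apply/matrixP => a b; rewrite km2 SE1// mxE [in RHS]mxE; apply: eq_bigr => l _.
by rewrite mxE mul_diag_mx mxE !(WE m.-1)// exprS exprD; ring.
Qed.

Definition quadrature_upto S k := exists (n : nat) (d : 'I_n -> R) (Y : 'M[R]_(n, p)),
  (forall l, 0 < d l < 1) /\ forall j, (j <= k)%N ->
    S j = \matrix_(a, b) \sum_l d l ^+ j * (Y l a * Y l b).

Lemma quadrature_odd S k : (forall t, (S t)^T = S t) -> S 0%N = 1%:M -> odd k ->
  interior_upto S k -> quadrature_upto S k.
Proof.
move=> Ss S0 ko ik; have [] := interior_pos Ss S0 ik.
have kE := odd_double_half k; rewrite ko in kE.
rewrite /lowF /upF ko uphalf_half ko add1n => low up.
(* The weight 1 belongs to the even index k - 1, whose form has the same degree. *)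
have [low0 _] : posform k./2.+1 S /\ True.
  case: k ko ik kE low up => // k; rewrite [odd _]/= => /negPf ko ik kE low up.
  have /(interior_pos Ss S0)[] : interior_upto S k.
    by move=> j /andP[j0 jk]; apply: ik; rewrite j0 leqW.
  rewrite /lowF ko => + _; rewrite (_ : k./2 = k.+1./2)//.
  by rewrite -[k.+1./2]/(uphalf k) uphalf_half ko.
have [n [d [Y [d01 SE]]]] := quadrature Ss (ltn0Sn _) low0 low up.
by exists n, d, Y; split=> // j jk; apply: SE; lia.
Qed.

Lemma Smin_ext S S' k : (forall j, (j < k)%N -> S j = S' j) -> Smin S k = Smin S' k.
Proof.
case: k => [//|[//|n]] SS; rewrite /Smin.
have := odd_double_half n.+1; have := odd_double_half n.+2.
set m := n.+1./2; set m2 := n.+2./2.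
case: odd => E2; case: odd => E1; try lia.
all: congr (_^T *m invmx _ *m _); first
  [by apply/eq_mxcol => i; apply: SS; have := ltn_ord i; lia
  |by apply/eq_mxblock => i j; apply: SS; have := ltn_ord i; have := ltn_ord j; lia].
Qed.

Lemma Smax_ext S S' k : (forall j, (j < k)%N -> S j = S' j) -> Smax S k = Smax S' k.
Proof.
case: k => [//|[//|n]] SS; rewrite /Smax.
have := odd_double_half n.+1; have := odd_double_half n.+2.
set m := n.+1./2; set m2 := n.+2./2.
case: odd => E2; case: odd => E1; try lia.
all: cbv beta iota delta [negb]; (congr (_ - _); [exact: SS|]).
all: congr (_^T *m invmx _ *m _); first
  [apply/eq_mxcol => i; congr (_ - _); apply: SS; have := ltn_ord i; lia
  |apply/eq_mxblock => i j; congr (_ - _); apply: SS; have := ltn_ord i; have := ltn_ord j; lia].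
Qed.

Lemma interior_ext S S' k : (forall j, (j <= k)%N -> S j = S' j) ->
  interior_upto S k -> interior_upto S' k.
Proof.
move=> SS ik j jP; have /andP[j0 jk] := jP; have := ik j jP.
have SS' i : (i < j)%N -> S i = S' i by move=> ij; apply: SS; lia.
by rewrite (Smin_ext SS') (Smax_ext SS') (SS j jk).
Qed.

Lemma interior_gap S k : (forall t, (S t)^T = S t) -> S 0%N = 1%:M ->
  interior_upto S k -> pdmx (gap S k.+1).
Proof.
case: k => [|k] Ss S0 ik; first by rewrite /gap /= subr0; exact: pd1.
by have [] := det_gap Ss S0 (ltn0Sn k) ik.
Qed.

Lemma interior_Smin_sym S k : (forall t, (S t)^T = S t) -> S 0%N = 1%:M ->
  interior_upto S k -> (Smin S k.+1)^T = Smin S k.+1.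
Proof.
move=> Ss S0 ik; have [lk _] := interior_prev Ss S0 ik.
have [As _ _] := Smin_hmin Ss (ltn0Sn k) lk.
by move: As; rewrite linearB/= Ss => /addrI/oppr_inj.
Qed.

(* An interior moment sequence of even length is prolonged by the midpoint of its next range. *)
Lemma interior_quadrature S k : (forall t, (S t)^T = S t) -> S 0%N = 1%:M ->
  interior_upto S k -> quadrature_upto S k.
Proof.
move=> Ss S0 ik; have [ko|ke] := boolP (odd k); first exact: quadrature_odd.
have Gp := interior_gap Ss S0 ik; have Ms := interior_Smin_sym Ss S0 ik.
pose h : 'M[R]_p := 2^-1 *: gap S k.+1; have hp : pdmx h by apply/pdZ.
pose S' j := if j == k.+1 then Smin S k.+1 + h else S j.
have SS' j : (j <= k)%N -> S j = S' j by move=> jk; rewrite /S' ifN//; lia.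
have S's t : (S' t)^T = S' t.
  by rewrite /S'; case: ifP => // _; rewrite linearD/= Ms hp.1.
have [|||n [d [Y [d01 SE]]]] := @quadrature_odd S' k.+1 S's.
- by rewrite -SS'.
- exact: ke.
- move=> j /andP[j0]; rewrite leq_eqVlt => /orP[/eqP->|jk]; last first.
    by apply: (interior_ext SS' ik); rewrite j0.
  rewrite -(@Smin_ext S S' k.+1 SS') -(@Smax_ext S S' k.+1 SS') /S' eqxx addrAC subrr add0r; split=> //.
  rewrite opprD addrA -/(gap S k.+1) (_ : _ - h = h)//.
  by rewrite /h -[X in X - _]scale1r -scalerBl; congr (_ *: _); lra.
by exists n, d, Y; split=> // j jk; rewrite SS' ?SE//; lia.
Qed.
End Quadrature.

(** * A matrix measure for every interior point *)

Section InteriorInMomentSpace.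
Variables (R : realType) (p n : nat).
Implicit Types s : n.-tuple ((dimS p).-tuple R).

Lemma momseq_sym s t : (momseq s t)^T = momseq s t.
Proof. by case: t => [|t]; rewrite /momseq ?trmx1// mat_of_sym. Qed.

Lemma interior_moment_space s : moment_interior s -> moment_space s.
Proof.
move=> si.
have [N [d [Y [d01 SE]]]] : quadrature_upto (momseq s) n.
  apply: interior_quadrature => //; first exact: momseq_sym.
  move=> [//|j] /andP[_ jn]; exact: (si (Ordinal jn)).
(* Extension by zero to [nat], the index type of [discrete_charge]. *)
pose d' l := if insub l is Some l' then d l' else 0.
pose Y' a l := if insub l is Some l' then Y l' a else 0.
have d'E (l : 'I_N) : d' l = d l by rewrite /d' valK.
have Y'E a (l : 'I_N) : Y' a l = Y l a by rewrite /Y' valK.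
have d'01 l : 0 <= d' l <= 1.
  by rewrite /d'; case: insub => [l'|]; [have /andP[/ltW-> /ltW->] := d01 l'|rewrite lexx ler01].
pose nu a b := cid (discrete_charge N (fun l => Y' a l * Y' b l) d'01).
exists (fun a b => sval (nu a b)).
have nuE a b A : sval (nu a b) A = (\sum_(l < N) Y l a * Y l b * \1_A (d l))%:E.
  rewrite (svalP (nu a b)).1; congr _%:E; apply: eq_bigr => l _; by rewrite d'E !Y'E.
have d1 (l : 'I_N) : d l \in `[0, 1]%classic.
  by rewrite inE /= in_itv/=; have /andP[/ltW-> /ltW->] := d01 l.
split; [split; [|split]|].
- move=> a b A _; rewrite !nuE; congr _%:E; apply: eq_bigr => l _.
  by rewrite indicI/= [X in _ = _ * (_ * X)]indicE d1 mulr1.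
- move=> A _; split.
    apply/matrixP => a b; rewrite !mxE !nuE /=; apply: eq_bigr => l _.
    by rewrite (mulrC (Y l a)).
  (* The measure puts the rank one matrix of row l of [Y] at the node d_l, so its form is a sum of
     squares. *)
  move=> v; rewrite (_ : (_ *m _) 0 0 = \sum_(l < N) \1_A (d l) * (Y *m v) l 0 ^+ 2).
    by apply: sumr_ge0 => l _; rewrite mulr_ge0 ?sqr_ge0.
  rewrite mxE; under eq_bigr do rewrite mxE mulr_suml.
  under [RHS]eq_bigr do rewrite mxE expr2 mulr_suml mulr_sumr.
  rewrite [RHS]exchange_big /=; apply: eq_bigr => b _.
  under [RHS]eq_bigr do rewrite mulr_sumr mulr_sumr.
  rewrite [RHS]exchange_big /=; apply: eq_bigr => a _.
  rewrite !mxE nuE /= mulr_sumr mulr_suml; apply: eq_bigr => l _; ring.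
- apply/matrixP => a b; rewrite mxE nuE /=.
  have := SE 0%N (leq0n n) => /matrixP/(_ a b); rewrite [LHS]/= => ->.
  by rewrite mxE; apply: eq_bigr => l _; rewrite indicE d1 mulr1 mul1r.
- move=> k a b; have := (svalP (nu a b)).2 k.+1.
  rewrite (_ : \sum_(l < N) _ = mat_of (tnth s k) a b)//.
  have := SE k.+1 (ltn_ord k) => /matrixP/(_ a b); rewrite /momseq -tnth_nth => ->.
  rewrite mxE; apply: eq_bigr => l _; by rewrite d'E !Y'E mulrC.
Qed.
End InteriorInMomentSpace.

(** * Moments lie in the closed range *)

Section MomentPositivity.
Variable R : realType.
Local Notation T := (measurableTypeR R).

(** Half-open cells of length 1/(N+1) cut to [0, 1]; the index N + 1 catches the single point 1,
    whence [N.+2] cells in the sums. *)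
Definition cell N r : set T :=
  `[r%:R / N.+1%:R, r.+1%:R / N.+1%:R[%classic `&` `[0%R, 1%R]%classic.

Lemma measurable_cell N r : measurable (cell N r).
Proof. by apply: measurableI; exact: measurable_itv. Qed.

Lemma cellE N r (t : T) : 0 <= t <= 1 ->
  (t \in cell N r) = (r == Num.truncn (t * N.+1%:R)).
Proof.
move=> t01; have /andP[t0 t1] := t01; have N0 : 0 < N.+1%:R :> R by rewrite ltr0n.
rewrite eq_sym truncn_eq ?mulr_ge0//; apply/idP/idP.
  by rewrite inE /cell /= !in_itv/= ler_pdivrMr// ltr_pdivlMr// => -[].
move=> /andP[tr tr1]; rewrite inE; split; rewrite /= in_itv/=.
  by rewrite ler_pdivrMr// ltr_pdivlMr// tr.
by rewrite t0.
Qed.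

Definition stepX N k (t : T) : R :=
  \sum_(r < N.+2) (r%:R / N.+1%:R) ^+ k * \1_(cell N r) t.

Lemma stepXE N k t : 0 <= t <= 1 ->
  stepX N k t = ((Num.truncn (t * N.+1%:R))%:R / N.+1%:R) ^+ k.
Proof.
move=> t01; have /andP[t0 t1] := t01; have N0 : 0 < N.+1%:R :> R by rewrite ltr0n.
have rN : (Num.truncn (t * N.+1%:R) < N.+2)%N.
  rewrite truncn_lt_nat ?mulr_ge0//; apply: le_lt_trans (_ : 1 * N.+1%:R < _).
    by rewrite ler_pM2r.
  by rewrite mul1r ltr_nat.
rewrite /stepX (bigD1 (Ordinal rN))//= indicE cellE// eqxx mulr1 big1 ?addr0// => r rt.
by rewrite indicE cellE// (_ : (_ == _) = false) ?mulr0//; exact: negPf.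
Qed.

(** Both t and the left end of its cell are at most 1, so each further factor adds at most 1/(N+1)
    to the error. *)
Lemma stepX_le N k t : 0 <= t <= 1 ->
  0 <= stepX N k t /\ stepX N k t <= t ^+ k <= stepX N k t + k%:R / N.+1%:R.
Proof.
move=> t01; rewrite stepXE//; have /andP[t0 t1] := t01.
have N0 : 0 < N.+1%:R :> R by rewrite ltr0n.
set y := _ / _; have y0 : 0 <= y by rewrite divr_ge0.
have /andP[yt ty] : y <= t <= y + N.+1%:R^-1.
  have /andP[] : (Num.truncn (t * N.+1%:R))%:R <= t * N.+1%:R
     < (Num.truncn (t * N.+1%:R)).+1%:R by apply: truncn_itv; rewrite mulr_ge0.
  rewrite -ler_pdivrMr// -ltr_pdivlMr// => -> /ltW; rewrite -natr1 mulrDl mul1r.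
  by move=> ->.
split; first exact: exprn_ge0.
rewrite lerXn2r//= ?nnegrE//.
elim: k => [|k IH]; first by rewrite !expr0 mul0r addr0.
rewrite exprS; apply: (@le_trans _ _ (t * (y ^+ k + k%:R / N.+1%:R))).
  by rewrite ler_wpM2l.
have yk1 : y ^+ k <= 1 by rewrite exprn_ile1// (le_trans yt).
have yk0 : 0 <= y ^+ k by rewrite exprn_ge0.
have A : t * y ^+ k <= y ^+ k.+1 + N.+1%:R^-1.
  rewrite exprS; apply: (@le_trans _ _ ((y + N.+1%:R^-1) * y ^+ k)).
    by rewrite ler_wpM2r.
  by rewrite mulrDl lerD2l ler_piMr// invr_ge0 ltW.
have B : t * (k%:R / N.+1%:R) <= k%:R / N.+1%:R by rewrite ler_piMl// divr_ge0.
have C : k.+1%:R / N.+1%:R = k%:R / N.+1%:R + N.+1%:R^-1 :> R.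
  by rewrite -(@natr1 R k) mulrDl mul1r.
by rewrite C mulrDr (addrC (k%:R / _)) addrA lerD.
Qed.

Lemma measurable_stepX N k D : measurable_fun D (stepX N k).
Proof.
apply: measurable_sum => r; apply: measurable_funM => //.
by apply: measurable_indic; exact: measurable_cell.
Qed.

Lemma finite_moment_approx (a : {finite_measure set T -> \bar R}) k :
  exists y : R, (\int[a]_(t in `[0%R, 1%R]%classic) (t ^+ k)%:E = y%:E)%E /\
  forall N, `|y - \sum_(r < N.+2) (r%:R / N.+1%:R) ^+ k * fine (a (cell N r))| <=
    k%:R * fine (a `[0%R, 1%R]%classic) / N.+1%:R.
Proof.
set D := `[0%R, 1%R]%classic; have mD : measurable (D : set T) by exact: measurable_itv.
have Dle (t : T) : D t -> 0 <= t <= 1 by rewrite /D /= in_itv.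
have aD : a D = (fine (a D))%:E by rewrite fineK// fin_num_measure.
have stepI N : (\int[a]_(t in D) (stepX N k t)%:E =
    (\sum_(r < N.+2) (r%:R / N.+1%:R) ^+ k * fine (a (cell N r)))%:E)%E.
  under eq_integral do rewrite /stepX -sumEFin.
  have c0 (r : nat) : 0 <= (r%:R / N.+1%:R) ^+ k :> R by rewrite exprn_ge0// divr_ge0.
  rewrite ge0_integral_sum//; last first.
    move=> r; apply/measurable_EFinP; apply: measurable_funM => //.
    by apply: measurable_indic; exact: measurable_cell.
  rewrite -sumEFin; apply: eq_bigr => r _.
  under eq_integral do rewrite EFinM.
  rewrite ge0_integralZl_EFin//; last first.
    apply/measurable_EFinP; apply: measurable_indic; exact: measurable_cell.
  rewrite integral_indic//; last exact: measurable_cell.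
  rewrite setIidl; last by move=> t [].
  by rewrite EFinM fineK// fin_num_measure//; exact: measurable_cell.
have mX : measurable_fun D (fun t : T => (t ^+ k)%:E).
  by apply/measurable_EFinP; apply: measurable_funTS; exact: exprn_measurable.
have mS N : measurable_fun D (fun t : T => (stepX N k t)%:E).
  by apply/measurable_EFinP; exact: measurable_stepX.
have X0 (t : T) : D t -> (0 <= (t ^+ k)%:E)%E.
  by move=> /Dle/andP[t0 _]; rewrite lee_fin exprn_ge0.
have S0 N (t : T) : D t -> (0 <= (stepX N k t)%:E)%E.
  by move=> /Dle/(stepX_le N k)[t0 _]; rewrite lee_fin.
have lo N : (\int[a]_(t in D) (stepX N k t)%:E <= \int[a]_(t in D) (t ^+ k)%:E)%E.
  apply: ge0_le_integral; [by []|exact: S0|exact: mS|exact: mX|].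
  by move=> t /Dle/(stepX_le N k)[_ /andP[? _]]; rewrite lee_fin.
have hi N : (\int[a]_(t in D) (t ^+ k)%:E <=
    \int[a]_(t in D) (stepX N k t)%:E + (k%:R / N.+1%:R)%:E * a D)%E.
  rewrite -integral_cst// -ge0_integralD; [|by []|exact: S0|exact: mS|by move=> t _;
    rewrite /= lee_fin divr_ge0|exact: measurable_cst].
  apply: ge0_le_integral; [by []|exact: X0|exact: mX|
    by apply: emeasurable_funD; [exact: mS|exact: measurable_cst]|].
  by move=> t /Dle/(stepX_le N k)[_ /andP[_ ?]]; rewrite /= -EFinD lee_fin.
have : (\int[a]_(t in D) (t ^+ k)%:E)%E \is a fin_num.
  rewrite ge0_fin_numE; last by apply: integral_ge0 => t; exact: X0.
  by apply: le_lt_trans (hi 0%N) _; rewrite stepI aD -EFinM -EFinD ltry.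
move=> /fineK E; exists (fine (\int[a]_(t in D) (t ^+ k)%:E)%E); split=> // N.
have h1 := lo N; have h2 := hi N.
rewrite -E stepI lee_fin in h1; rewrite -E stepI aD -EFinM -EFinD lee_fin in h2.
by rewrite ger0_norm ?subr_ge0// lerBlDl mulrAC.
Qed.

(** The sums involve [nu] alone: the entries of a matrix measure share the same cells although their
    decompositions differ. *)
Lemma charge_moment_approx (nu : {charge set T -> \bar R}) k x : charge_moment nu k x ->
  (fun N => \sum_(r < N.+2) (r%:R / N.+1%:R) ^+ k * fine (nu (cell N r))) @ \oo --> x.
Proof.
move=> [a [b [nuE xE]]].
have [y [ya yb]] := finite_moment_approx a k; have [z [za zb]] := finite_moment_approx b k.
have xyz : x = y - z by apply: EFin_inj; rewrite xE ya za EFinB.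
set Da := k%:R * _ in yb; set Db := k%:R * _ in zb.
have E N : \sum_(r < N.+2) (r%:R / N.+1%:R) ^+ k * fine (nu (cell N r)) =
    \sum_(r < N.+2) (r%:R / N.+1%:R) ^+ k * fine (a (cell N r)) -
    \sum_(r < N.+2) (r%:R / N.+1%:R) ^+ k * fine (b (cell N r)).
  rewrite -sumrB; apply: eq_bigr => r _; rewrite -mulrBr nuE; last exact: measurable_cell.
  by rewrite fineB// fin_num_measure//; exact: measurable_cell.
have c0 : (fun N => (Da + Db) / N.+1%:R : R) @ \oo --> (0 : R).
  by rewrite -(mulr0 (Da + Db)); apply: cvgMr; exact: cvg_harmonic.
apply/cvgrPdist_le => e e0; move/cvgrPdist_le: c0 => /(_ _ e0); apply: filterS => N.
rewrite sub0r normrN => h; apply: le_trans h; rewrite E xyz.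
apply: le_trans (ler_norm _); rewrite mulrDl.
have := yb N; have := zb N; set u := \sum_(r < _) _; set v := \sum_(r < _) _ => h1 h2.
rewrite (_ : y - z - _ = (y - v) - (z - u)); last by ring.
by apply: le_trans (ler_normB _ _) _; rewrite lerD.
Qed.

(** Moment vectors start at k = 1; the total mass is recovered as moment 0 through the decomposition
    already at hand. *)
Lemma charge_moment0 (nu : {charge set T -> \bar R}) k x : charge_moment nu k x ->
  charge_moment nu 0 (fine (nu `[0%R, 1%R]%classic)).
Proof.
move=> [a [b [nuE _]]]; exists a, b; split=> //.
have mD : measurable (`[0%R, 1%R]%classic : set T) by exact: measurable_itv.
rewrite fineK; last by rewrite fin_num_measure.
rewrite nuE//; congr (_ - _)%E.
  under eq_integral do rewrite expr0; by rewrite integral_cst// mul1e.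
by under eq_integral do rewrite expr0; rewrite integral_cst// mul1e.
Qed.
End MomentPositivity.

(** * Positivity of the moment forms in the limit *)

Section MomentSpaceClosure.
Variables (R : realType) (p : nat).
Local Notation T := (measurableTypeR R).
Implicit Types (M : nat -> 'M[R]_p) (x : nat -> 'cV[R]_p).

Lemma cvg_ord_sum n (f : 'I_n -> R ^nat) (l : 'I_n -> R) : (forall i, f i @ \oo --> l i) ->
  (fun N => \sum_i f i N) @ \oo --> \sum_i l i.
Proof.
by move=> fl; apply: cvg_big => // i; exact: add_continuous.
Qed.

Lemma cvg_bf (A : nat -> 'M[R]_p) (B : 'M[R]_p) u v : (forall i j, A N i j @[N --> \oo] --> B i j) ->
  bf (A N) u v @[N --> \oo] --> bf B u v.
Proof.
move=> AB.
have E (C : 'M[R]_p) : bf C u v = \sum_j (\sum_i u i 0 * C i j) * v j 0.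
  by rewrite /bf mxE; apply: eq_bigr => j _; rewrite mxE; congr (_ * _);
    apply: eq_bigr => i _; rewrite mxE.
rewrite E; under eq_cvg do rewrite E.
apply: cvg_ord_sum => j; apply: cvgM; last exact: cvg_cst.
by apply: cvg_ord_sum => i; apply: cvgM => //; exact: cvg_cst.
Qed.

Lemma bf_sumA I r (P : pred I) (F : I -> 'M[R]_p) u v :
  bf (\sum_(i <- r | P i) F i) u v = \sum_(i <- r | P i) bf (F i) u v.
Proof. by elim/big_rec2: _ => [|i ? ? _ <-]; rewrite ?bfA0// bfAD. Qed.

(** With q_r the value of the vector polynomial at t_r, the form is the sum of w_r V_r(q_r, q_r). *)
Lemma hform_atoms_ge0 m n (w t : 'I_n -> R) (V : 'I_n -> 'M[R]_p) x :
  (forall r, 0 <= w r) -> (forall r, psdmx (V r)) ->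
  0 <= hform m (fun k => \sum_r (w r * t r ^+ k) *: V r) x x.
Proof.
move=> w0 Vp; pose q r := \sum_(i < m) t r ^+ i *: x i.
rewrite (_ : hform _ _ _ _ = \sum_r w r * bf (V r) (q r) (q r)).
  by apply: sumr_ge0 => r _; rewrite mulr_ge0// (Vp r).2.
under [RHS]eq_bigr do rewrite bf_suml mulr_sumr.
rewrite [RHS]exchange_big; apply: eq_bigr => i _ /=.
under [RHS]eq_bigr do rewrite bf_sumr mulr_sumr.
rewrite [RHS]exchange_big; apply: eq_bigr => j _ /=.
rewrite bf_sumA; apply: eq_bigr => r _.
by rewrite bfAZ bfZl bfZr exprD; ring.
Qed.

Section MomentForms.
Variables (mu : 'I_p -> 'I_p -> {charge set T -> \bar R}) (n : nat) (M : nat -> 'M[R]_p).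
Hypothesis mmu : matrix_measure mu.
Hypothesis Mmu : forall k, (k <= n)%N -> forall i j, charge_moment (mu i j) k (M k i j).

Let V N r : 'M[R]_p := \matrix_(i, j) fine (mu i j (cell N r)).
(** Moments of the atomic matrix measure with mass [V N r] at the left end of each cell. *)
Let A N k := \sum_(r < N.+2) (r%:R / N.+1%:R) ^+ k *: V N r.

Let Vp N r : psdmx (V N r).
Proof. by have [_ []] := mmu => + _; apply; exact: measurable_cell. Qed.

Let cvgA k u v : (k <= n)%N -> bf (A N k) u v @[N --> \oo] --> bf (M k) u v.
Proof.
move=> kn; apply: cvg_bf => i j; have := charge_moment_approx (Mmu kn i j).
apply: cvg_trans; apply: near_eq_cvg; apply: nearW => N.
by rewrite /A summxE; apply: eq_bigr => r _; rewrite !mxE.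
Qed.

Let A_low N k m x : 0 <= hform m (lowF (A N) k) x x.
Proof.
rewrite /lowF; case: ifP => _.
  rewrite [X in hform _ X](_ : _ = fun t => \sum_(r < N.+2)
      ((r%:R / N.+1%:R) * (r%:R / N.+1%:R) ^+ t) *: V N r).
    by apply: hform_atoms_ge0 => // r; rewrite divr_ge0.
  by apply/funext => t; apply: eq_bigr => r _; rewrite exprS.
rewrite [X in hform _ X](_ : _ = fun t => \sum_(r < N.+2)
    (1 * (r%:R / N.+1%:R) ^+ t) *: V N r).
  exact: hform_atoms_ge0.
by apply/funext => t; apply: eq_bigr => r _; rewrite mul1r.
Qed.

Let A_up N k m x : 0 <= hform m (upF (A N) k) x x.
Proof.
have t1 (r : 'I_N.+2) : 0 <= 1 - r%:R / N.+1%:R :> R.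
  by rewrite subr_ge0 ler_pdivrMr ?ltr0n// mul1r ler_nat -ltnS.
rewrite /upF; case: ifP => _.
  rewrite [X in hform _ X](_ : _ = fun t => \sum_(r < N.+2)
      ((1 - r%:R / N.+1%:R) * (r%:R / N.+1%:R) ^+ t) *: V N r).
    exact: hform_atoms_ge0.
  apply/funext => t; rewrite /A -sumrB; apply: eq_bigr => r _.
  by rewrite -scalerBl; congr (_ *: _); rewrite exprS; ring.
rewrite [X in hform _ X](_ : _ = fun t => \sum_(r < N.+2)
    ((r%:R / N.+1%:R) * (1 - r%:R / N.+1%:R) * (r%:R / N.+1%:R) ^+ t) *: V N r).
  by apply: hform_atoms_ge0 => // r; rewrite mulr_ge0// divr_ge0.
apply/funext => t; rewrite /A -sumrB; apply: eq_bigr => r _.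
by rewrite -scalerBl; congr (_ *: _); rewrite !exprS; ring.
Qed.

Lemma moment_lowF_ge0 k x : (k <= n)%N -> 0 <= hform k./2.+1 (lowF M k) x x.
Proof.
move=> kn; have kE := odd_double_half k.
suff : hform k./2.+1 (lowF (A N) k) x x @[N --> \oo] --> hform k./2.+1 (lowF M k) x x.
  move=> h; apply: (@cvgr_to_ge _ _ _ _ _ _ _ h); apply: nearW => N; exact: A_low.
apply: cvg_ord_sum => i; apply: cvg_ord_sum => j.
have := ltn_ord i; have := ltn_ord j; rewrite /lowF; case: odd kE => kE ik jk; apply: cvgA; lia.
Qed.

Lemma moment_upF_ge0 k h x : (k <= n)%N -> h = uphalf k -> 0 <= hform h (upF M k) x x.
Proof.
move=> kn; have kE := odd_double_half k; rewrite uphalf_half => hE.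
suff : hform h (upF (A N) k) x x @[N --> \oo] --> hform h (upF M k) x x.
  move=> c; apply: (@cvgr_to_ge _ _ _ _ _ _ _ c); apply: nearW => N; exact: A_up.
apply: cvg_ord_sum => i; apply: cvg_ord_sum => j.
have := ltn_ord i; have := ltn_ord j; rewrite /upF; case: odd kE hE => kE hE ik jk.
all: rewrite bfAD bfAN; under eq_cvg do rewrite bfAD bfAN.
all: by apply: cvgB; apply: cvgA; lia.
Qed.
End MomentForms.

(** A Schur complement is the value of the form at its minimiser, and the form is a limit of
    nonnegative ones. The interior prefix makes the complement such a minimum. *)
Lemma moment_space_closed n (s : n.-tuple ((dimS p).-tuple R)) k : (k < n)%N ->
  moment_space s -> interior_upto (momseq s) k ->
  psdmx (momseq s k.+1 - Smin (momseq s) k.+1) /\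
  psdmx (Smax (momseq s) k.+1 - momseq s k.+1).
Proof.
move=> kn [mu [mmu sm]] ik; set M := momseq s.
have Mmu j : (j <= n)%N -> forall a b, charge_moment (mu a b) j (M j a b).
  case: j => [_|j jn] a b; last first.
    by rewrite /M /momseq -[nth _ _ _](tnth_nth _ s (Ordinal jn)); exact: sm.
  have -> : M 0%N a b = fine (mu a b `[0%R, 1%R]%classic).
    by have [_ [_ /matrixP/(_ a b)]] := mmu; rewrite mxE => ->.
  exact: (charge_moment0 (sm (Ordinal (leq_ltn_trans (leq0n k) kn)) a b)).
have Ms := momseq_sym s.
have [lk uk] := interior_prev Ms erefl ik.
have [As _ Aex] := Smin_hmin Ms (ltn0Sn k) lk.
have [Bs _ Bex] := Smax_hmin Ms erefl (ltn0Sn k) uk.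
split; split=> // v; rewrite -/(bf _ v v).
  by have [x [_ _ <-]] := Aex v; exact: (moment_lowF_ge0 mmu Mmu).
by have [x [_ _ <-]] := Bex v; exact: (moment_upF_ge0 mmu Mmu _ kn).
Qed.
End MomentSpaceClosure.

(** * Canonical moments as coordinates *)

Section CanonicalCoordinates.
Variables (R : realType) (p : nat).
Local Notation T := ((dimS p).-tuple R).
Implicit Types (l : seq T) (x u : T).

(** [j] counts the moments from the current one to the last; the exponents of the determinants are
    (j-1)(p+1)/2. *)
Definition beta_weight (j : nat) u : R :=
  wishart (j%:R * p.+1%:R / 2) (mat_of u) * wishart (j%:R * p.+1%:R / 2) (1%:M - mat_of u).

Lemma beta_weight_ge0 j u : 0 <= beta_weight j u.
Proof. by rewrite mulr_ge0 ?wishart_ge0. Qed.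

Lemma measurable_beta_weight j : measurable_fun setT (beta_weight j).
Proof.
apply: measurable_funM; apply: measurable_wishart.
- exact: measurable_mat_of.
- exact: mat_of_sym.
- by apply: measurable_mat_ofB; [move=> a b; exact: measurable_cst|exact: measurable_mat_of].
- by move=> u; rewrite linearB/= trmx1 mat_of_sym.
Qed.

(** [momseq] for lists, whose length grows along the induction. *)
Definition prefix_moments l (k : nat) : 'M[R]_p :=
  if k is k'.+1 then mat_of (nth (nseq_tuple (dimS p) 0) l k') else 1%:M.

Lemma prefix_moments_sym l k : (prefix_moments l k)^T = prefix_moments l k.
Proof. by case: k => [|k]; rewrite /prefix_moments ?trmx1// mat_of_sym. Qed.

Lemma prefix_moments_cat l l' k : (k <= size l)%N ->
  prefix_moments l k = prefix_moments (l ++ l') k.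
Proof. by case: k => //= k kl; rewrite nth_cat kl. Qed.

Lemma prefix_moments_last l x : prefix_moments (rcons l x) (size l).+1 = mat_of x.
Proof. by rewrite /= nth_rcons ltnn eqxx. Qed.

(** * Change of variables for one moment *)

Section NextMoment.
Variable l : seq T.
Hypothesis li : interior_upto (prefix_moments l) (size l).

Let k := (size l).+1.
Let S := prefix_moments l.
Let Q := sqrtmx (gap S k).

Let Gp : pdmx (gap S k).
Proof. exact: (interior_gap (prefix_moments_sym l) erefl li). Qed.

Let Qp : pdmx Q. Proof. by have [] := sqrtmx_pd Gp. Qed.
Let QQ : Q *m Q = gap S k. Proof. by have [] := sqrtmx_pd Gp. Qed.
Let Qu : Q \in unitmx := pd_unit Qp.
Let Qs : Q^T = Q := Qp.1.
Let Vs : (invmx Q)^T = invmx Q. Proof. by rewrite trmx_inv Qs. Qed.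

Let As : (Smin S k)^T = Smin S k.
Proof. exact: (interior_Smin_sym (prefix_moments_sym l) erefl li). Qed.

Definition in_range x := pdmx (mat_of x - Smin S k) /\ pdmx (Smax S k - mat_of x).

Definition next_canon x : T := coords_of (invmx Q *m (mat_of x - Smin S k) *m invmx Q).

Let canonE x : mat_of (next_canon x) = invmx Q *m (mat_of x - Smin S k) *m invmx Q.
Proof.
by rewrite coords_ofK// !trmx_mul Vs [(_ - _)^T]linearB/= mat_of_sym As mulmxA.
Qed.

Let lowE x : mat_of x - Smin S k = Q *m mat_of (next_canon x) *m Q.
Proof. by rewrite canonE !mulmxA mulmxV// mul1mx mulmxKV. Qed.

Let upE x : Smax S k - mat_of x = Q *m (1%:M - mat_of (next_canon x)) *m Q.
Proof.
by rewrite mulmxBr mulmxBl -lowE mulmx1 QQ /gap opprB addrA subrK.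
Qed.

Lemma in_rangeP x : in_range x <->
  pdmx (mat_of (next_canon x)) /\ pdmx (1%:M - mat_of (next_canon x)).
Proof.
have H (A : 'M[R]_p) : pdmx (Q *m A *m Q) <-> pdmx A.
  by rewrite -{1}Qs; split=> Ap; [exact: (pd_congrV Qu)|exact: pd_congr].
by rewrite /in_range lowE upE !H.
Qed.

(** The factors in [det_gap] are congruent through [Q] to u and 1 - u, and (det Q)^2 is the
    determinant of the current gap, one copy of which cancels. *)
Lemma next_gap x : in_range x ->
  let l' := rcons l x in
  interior_upto (prefix_moments l') (size l') /\
  \det (gap (prefix_moments l') (size l').+1) =
    \det (mat_of (next_canon x)) * \det (1%:M - mat_of (next_canon x)) * \det (gap S k).
Proof.
move=> xr l'.
have E j : (j < k)%N -> S j = prefix_moments l' j.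
  by move=> jk; rewrite /l' -cats1; apply: prefix_moments_cat.
have Ek : prefix_moments l' k = mat_of x := prefix_moments_last l x.
have li' : interior_upto (prefix_moments l') (size l').
  move=> j /andP[j0]; rewrite size_rcons leq_eqVlt => /orP[/eqP->|jk].
    by rewrite -/k -(Smin_ext E) -(Smax_ext E) Ek.
  by apply: (interior_ext (S := S) (k := size l)); rewrite ?j0.
split=> //; have l'0 : (0 < size l')%N by rewrite size_rcons.
have [_ D] := det_gap (prefix_moments_sym l') erefl l'0 li'.
have gE : gap (prefix_moments l') k = gap S k by rewrite /gap -(Smin_ext E) -(Smax_ext E).
rewrite size_rcons -/k gE -(Smin_ext E) -(Smax_ext E) Ek lowE upE in D *.
have G0 := pd_det_gt0 Gp; apply: (mulIf (negbT (gt_eqF G0))).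
by rewrite D !det_mulmx -QQ det_mulmx; ring.
Qed.

Let affE x : next_canon x = coords_of (invmx Q *m mat_of x *m invmx Q -
  invmx Q *m Smin S k *m invmx Q).
Proof. by rewrite /next_canon mulmxBr mulmxBl. Qed.

Lemma measurable_next_canon : measurable_fun setT next_canon.
Proof.
apply/measurable_fun_tnthP => i; rewrite (_ : _ \o _ = fun x =>
  (\sum_b (\sum_a invmx Q (val (enum_val i)).1 a * mat_of x a b)
     * invmx Q b (val (enum_val i)).2)
  - (invmx Q *m Smin S k *m invmx Q) (val (enum_val i)).1 (val (enum_val i)).2); last first.
  apply/funext => x; rewrite [LHS]/= affE tnth_mktuple [LHS]mxE [X in _ + X = _]mxE; congr (_ - _).
  by rewrite mxE; apply: eq_bigr => b _; rewrite mxE.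
apply: measurable_funB => //; apply: measurable_sum => b; apply: measurable_funM => //.
by apply: measurable_sum => a; apply: measurable_funM => //; exact: measurable_mat_of.
Qed.

(** The factor left by m later moments times a function of the canonical moment, written in the
    latter throughout; [beta_weight] supplies the indicator of the range. *)
Definition pulled_back m (K : T -> \bar R) x : \bar R :=
  ((\det (gap S k) `^ ((m * p.+1)%:R / 2) * beta_weight m.+1 (next_canon x))%:E
   * K (next_canon x))%E.

Lemma pulled_back_in_range m K x : in_range x ->
  pulled_back m K x =
  ((\det (gap (prefix_moments (rcons l x)) k.+1) `^ ((m * p.+1)%:R / 2))%:E * K (next_canon x))%E.
Proof.
move=> xr; have [u0 u1] := (in_rangeP x).1 xr.
have [_] := next_gap xr; rewrite size_rcons -/k => ->.
rewrite /pulled_back /beta_weight !wishart_pd//; congr (_%:E * _)%E.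
have d0 := ltW (pd_det_gt0 u0); have d1 := ltW (pd_det_gt0 u1); have g0 := ltW (pd_det_gt0 Gp).
have -> : m.+1%:R * p.+1%:R / 2 - p.+1%:R / 2 = (m * p.+1)%:R / 2 :> R.
  by rewrite natrM -natr1; field.
by rewrite powRM ?mulr_ge0// powRM// mulrC.
Qed.

Lemma pulled_back_out m K x : ~ in_range x -> pulled_back m K x = 0%E.
Proof.
move=> xr; rewrite /pulled_back /beta_weight.
have [u0|u0] := pselect (pdmx (mat_of (next_canon x))); last first.
  by rewrite wishart_npd// mul0r mulr0 mul0e.
rewrite [X in _ * (_ * X)]wishart_npd ?mulr0 ?mul0e// => u1.
by apply: xr; apply/in_rangeP.
Qed.

Lemma measurable_pulled_back m K : measurable_fun setT K -> measurable_fun setT (pulled_back m K).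
Proof.
move=> mK; apply: emeasurable_funM; last exact: measurableT_comp measurable_next_canon.
apply/measurable_EFinP; apply: measurable_funM => //.
exact: measurableT_comp (measurable_beta_weight _) measurable_next_canon.
Qed.

Lemma pulled_back_ge0 m K x : (forall u, 0 <= K u)%E -> (0 <= pulled_back m K x)%E.
Proof. by move=> K0; rewrite mule_ge0// lee_fin mulr_ge0 ?powR_ge0 ?beta_weight_ge0. Qed.

(** The Jacobian is the determinant of the current gap to the power (p+1)/2, which raises m to m +
    1. *)
Lemma leb_int_S_pulled_back m K : (forall u, 0 <= K u)%E -> measurable_fun setT K ->
  leb_int_S (pulled_back m K) =
  ((\det (gap S k) `^ ((m.+1 * p.+1)%:R / 2))%:E *
   leb_int_S (fun u => (beta_weight m.+1 u)%:E * K u))%E.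
Proof.
move=> K0 mK; have tI := tonelli_leb_int_S R p; have g0 := pd_det_gt0 Gp.
pose F u : \bar R := ((beta_weight m.+1 u)%:E * K u)%E.
have F0 u : (0 <= F u)%E by rewrite mule_ge0// lee_fin beta_weight_ge0.
have mF : measurable_fun setT F.
  by apply: emeasurable_funM => //; apply/measurable_EFinP; exact: measurable_beta_weight.
set c := \det _ `^ _; have c0 : (0 <= c%:E)%E by rewrite lee_fin powR_ge0.
pose H u : \bar R := ((\det (gap S k) `^ ((m * p.+1)%:R / 2))%:E * F u)%E.
have H0 u : (0 <= H u)%E by rewrite mule_ge0// lee_fin powR_ge0.
have mH : measurable_fun setT H by exact: emeasurable_funM.
rewrite (_ : pulled_back m K = fun x => H (coords_of (invmx Q *m mat_of x *m invmx Q +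
  (- (invmx Q *m Smin S k *m invmx Q))))); last first.
  by apply/funext => x; rewrite -affE /H /F muleA -EFinM.
rewrite leb_int_S_congr//; last 2 first.
- by rewrite unitmx_inv.
- by rewrite linearN/= !trmx_mul Vs As mulmxA.
rewrite /H (tonZ tI) ?lee_fin ?powR_ge0// muleA -EFinM; congr (_%:E * _)%E.
rewrite /c det_inv normrV -?unitmxE// exprVn invrK ger0_norm ?ltW ?pd_det_gt0//.
rewrite -(@powR_sqr_half _ (\det Q)) ?ltW ?pd_det_gt0// expr2 -det_mulmx QQ.
rewrite -powRD ?(gt_eqF g0) ?implybT//; congr (_ `^ _).
by rewrite !natrM -natr1; field.
Qed.

End NextMoment.

(** * Change of variables for all remaining moments *)

Section Iteration.
Local Notation I := (@leb_int_S R p).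
Let tI : tonelli I := tonelli_leb_int_S R p.

Definition tail_interior l m (s : m.-tuple T) := forall j, (size l < j <= size l + m)%N ->
  let S := prefix_moments (l ++ s) in pdmx (S j - Smin S j) /\ pdmx (Smax S j - S j).

Definition canon_tail l m (s : m.-tuple T) : m.-tuple T :=
  [tuple coords_of (canon_moment (prefix_moments (l ++ s)) (size l + i).+1) | i < m].

Definition weight m (u : m.-tuple T) : R := \prod_(i < m) beta_weight (m - i) (tnth u i).

Lemma weight_ge0 m (u : m.-tuple T) : 0 <= weight u.
Proof. by apply: prodr_ge0 => i _; exact: beta_weight_ge0. Qed.

Lemma measurable_weight m : measurable_fun setT (@weight m).
Proof.
apply: measurable_prodr => i.
by apply: (measurableT_comp (measurable_beta_weight _)); exact: measurable_tnth.
Qed.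

Lemma weight_cons m x (u : m.-tuple T) :
  weight (cons_tuple x u) = beta_weight m.+1 x * weight u.
Proof.
rewrite /weight big_ord_recl subn0; congr (_ * _).
by apply: eq_bigr => i _; rewrite tnthS.
Qed.

Lemma prefix_moments_next l x l' : prefix_moments (l ++ x :: l') (size l).+1 = mat_of x.
Proof. by rewrite -cat_rcons -prefix_moments_cat ?size_rcons// prefix_moments_last. Qed.

Lemma Smin_prefix l l' :
  Smin (prefix_moments (l ++ l')) (size l).+1 = Smin (prefix_moments l) (size l).+1.
Proof. by symmetry; apply: Smin_ext => j jl; exact: prefix_moments_cat. Qed.

Lemma Smax_prefix l l' :
  Smax (prefix_moments (l ++ l')) (size l).+1 = Smax (prefix_moments l) (size l).+1.
Proof. by symmetry; apply: Smax_ext => j jl; exact: prefix_moments_cat. Qed.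

Lemma tail_interior_cons l m x (t : m.-tuple T) :
  tail_interior l (cons_tuple x t) <-> in_range l x /\ tail_interior (rcons l x) t.
Proof.
set S := prefix_moments (l ++ x :: t); set k := (size l).+1.
have H : (pdmx (S k - Smin S k) /\ pdmx (Smax S k - S k)) <-> in_range l x.
  by rewrite /in_range /S Smin_prefix Smax_prefix prefix_moments_next.
split=> [xt|[xr tt] j].
  split; first by apply/H; apply: xt; rewrite ltnS leqnn/= addnS ltnS leq_addr.
  move=> j; rewrite size_rcons cat_rcons => /andP[lj jm]; apply: xt.
  by rewrite (ltnW lj)/= addnS -addSn.
rewrite leq_eqVlt => /andP[/orP[/eqP<- _|lj jm]]; first exact/H.
by have := tt j; rewrite size_rcons cat_rcons; apply; rewrite lj/= addSn -addnS.
Qed.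

Lemma canon_tail_cons l m x (t : m.-tuple T) :
  canon_tail l (cons_tuple x t) = cons_tuple (next_canon l x) (canon_tail (rcons l x) t).
Proof.
apply: eq_from_tnth => i; case: (unliftP ord0 i) => [i' ->|->]; rewrite tnth_mktuple.
  by rewrite tnthS tnth_mktuple size_rcons cat_rcons /= /bump /= add1n addnS.
rewrite tnth0 addn0 /canon_moment [val _]/= prefix_moments_next Smin_prefix Smax_prefix.
by [].
Qed.

Lemma measurable_weighted m d (T' : measurableType d) (f : T' -> m.-tuple T) G :
  measurable_fun setT f -> measurable_fun setT G ->
  measurable_fun setT (fun z => (weight (f z))%:E * G z)%E.
Proof.
move=> mf mG; apply: emeasurable_funM => //; apply/measurable_EFinP.
exact: measurableT_comp (@measurable_weight m) mf.
Qed.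

Lemma iter_weightS m (G : m.+1.-tuple T -> \bar R) :
  (forall v, 0 <= G v)%E -> measurable_fun setT G ->
  I (fun x => (beta_weight m.+1 x)%:E *
    iter_int I (fun v : m.-tuple T => (weight v)%:E * G (cons_tuple x v)))%E
  = iter_int I (fun v => (weight v)%:E * G v)%E.
Proof.
move=> G0 mG; rewrite [RHS]/=; congr leb_int_S; apply/funext => x.
rewrite -(tonZ (tonelli_iter m tI)).
- congr iter_int; apply/funext => u; by rewrite weight_cons EFinM muleA.
- by rewrite lee_fin beta_weight_ge0.
- by move=> u; rewrite mule_ge0// lee_fin weight_ge0.
- apply: (@measurable_weighted m _ (m.-tuple T) id) => //.
  by apply: (measurableT_comp mG); exact: measurable_consl.
Qed.

(* The first of the remaining moments is an affine image of its canonical moment, and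
   [next_gap] turns the factor left by the inner integrals into a function of the latter. *)
Lemma iter_canon m l (G : m.-tuple T -> \bar R) :
  interior_upto (prefix_moments l) (size l) ->
  (forall v, 0 <= G v)%E -> measurable_fun setT G ->
  iter_int I (fun s => (\1_[set s | tail_interior l s] s)%:E * G (canon_tail l s))%E =
  ((\det (gap (prefix_moments l) (size l).+1) `^ ((m * p.+1)%:R / 2))%:E *
   iter_int I (fun v => (weight v)%:E * G v))%E.
Proof.
elim: m l G => [|m IH] l G li G0 mG.
  rewrite /= mul0n mul0r powRr0 mul1e /weight big_ord0 !mul1e indicE mem_set ?mul1e.
    by congr G; exact: tuple0.
  by move=> j /andP[lj]; rewrite addn0 leqNgt lj.
pose K x := iter_int I (fun u : m.-tuple T => (weight u)%:E * G (cons_tuple x u))%E.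
have mGc : measurable_fun setT (fun z : T * m.-tuple T => G (cons_tuple z.1 z.2)).
  by apply: (measurableT_comp mG); exact: measurable_cons_tuple.
have K0 x : (0 <= K x)%E.
  by apply: (iter_ge0 tI) => u; rewrite mule_ge0// lee_fin weight_ge0.
have mK : measurable_fun setT K.
  apply: (iter_meas (g := fun z => ((weight z.2)%:E * G (cons_tuple z.1 z.2))%E)) => //.
    by move=> z; rewrite mule_ge0// lee_fin weight_ge0.
  exact: (@measurable_weighted m _ (T * m.-tuple T)%type snd).
(* Off the range both sides vanish; on it the induction hypothesis applies to the lengthened
   prefix. *)
rewrite [LHS]/= [X in I X](_ : _ = pulled_back l m K); last first.
  apply/funext => x; have [xr|xr] := pselect (in_range l x); last first.
    rewrite pulled_back_out// -[RHS](ton_cst0 (tonelli_iter m tI)).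
    congr iter_int; apply/funext => t; rewrite indicE memNset ?mul0e//.
    by move=> /tail_interior_cons[].
  rewrite pulled_back_in_range//; have [li' _] := next_gap li xr.
  rewrite -(size_rcons l x) -IH//.
    congr iter_int; apply/funext => t; rewrite canon_tail_cons; congr (_%:E * _)%E.
    rewrite !indicE; congr (_%:R); congr nat_of_bool; apply/idP/idP; rewrite !inE /=.
      by move=> /tail_interior_cons[].
    by move=> tt; apply/tail_interior_cons.
  by apply: (measurableT_comp mG); exact: measurable_consl.
by rewrite leb_int_S_pulled_back// iter_weightS.
Qed.

End Iteration.
End CanonicalCoordinates.

(** * The volume of the moment space *)

Section MomentVolume.
Variables (R : realType) (p : nat).
Local Notation T := ((dimS p).-tuple R).
Local Notation I := (@leb_int_S R p).
Let tI : tonelli I := tonelli_leb_int_S R p.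

(** In coordinates the linear part is -1, of determinant 1 or -1. *)
Lemma leb_int_S_reflect C (g : T -> \bar R) : C^T = C ->
  (forall t, 0 <= g t)%E -> measurable_fun setT g ->
  I (fun t => g (coords_of (C - mat_of t))) = I g.
Proof.
move=> Cs g0 mg.
have Mu : (- 1%:M : 'M[R]_(dimS p)) \in unitmx.
  by rewrite unitmxE -scaleN1r detZ det1 mulr1 unitrX// unitrN1.
have := @leb_int_affine _ _ _ Mu (rv (coords_of C)) g g0 mg.
rewrite -scaleN1r detZ det1 mulr1 normrX normrN1 expr1n invr1 mul1e => H.
apply: etrans H; congr leb_int; apply/funext => t; congr g.
apply: (can_inj (@mat_ofK R p)); rewrite coords_ofK; last by rewrite linearB/= mat_of_sym Cs.
rewrite /aff mat_of_tvD scaleN1r mulNmx mul1mx !rvK coords_ofK// addrC; congr (_ + _).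
by apply/matrixP => i j; rewrite !mxE !tnth_mktuple !mxE.
Qed.

Definition cone_boundary (X : 'M[R]_p) := psdmx X /\ ~ pdmx X.

Lemma measurable_cone_boundary (F : T -> 'M[R]_p) :
  (forall i j, measurable_fun setT (fun t => F t i j)) -> (forall t, (F t)^T = F t) ->
  measurable [set t | cone_boundary (F t)].
Proof.
move=> mF Fs; apply: (measurableI [set t | psdmx (F t)] (~` [set t | pdmx (F t)])).
  exact: measurable_psd.
by apply: measurableC; exact: measurable_pd.
Qed.

Lemma boundary_null_up C : C^T = C ->
  I (fun t => (\1_[set t | cone_boundary (C - mat_of t)] t)%:E) = 0%E.
Proof.
move=> Cs; have := boundary_null (trmx0 R p p).
set g := fun t => _; move=> <-; rewrite -[RHS](leb_int_S_reflect Cs).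
- congr leb_int_S; apply/funext => t; rewrite /g !indicE; congr ((nat_of_bool _)%:R%:E).
  have XE : mat_of (coords_of (C - mat_of t)) - 0 = C - mat_of t.
    by rewrite subr0 coords_ofK// linearB/= mat_of_sym Cs.
  by apply/idP/idP => /set_mem/= H; apply/mem_set => /=; move: H; rewrite XE.
- by move=> t; rewrite lee_fin.
- apply/measurable_EFinP/measurable_indic; apply: measurable_cone_boundary.
    by move=> i j; rewrite (_ : (fun t => _) = fun t : T => mat_of t i j);
      [exact: measurable_mat_of|apply/funext => t; rewrite subr0].
  by move=> t; rewrite subr0 mat_of_sym.
Qed.

(** Closed conditions are imposed only behind an interior prefix, where the Hankel matrices to be
    inverted are definite. *)
Definition tail_closed l m (s : m.-tuple T) := forall j, (size l < j <= size l + m)%N ->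
  let S := prefix_moments (l ++ s) in interior_upto S j.-1 ->
  psdmx (S j - Smin S j) /\ psdmx (Smax S j - S j).

Lemma tail_closed_cons l m x (t : m.-tuple T) :
  interior_upto (prefix_moments l) (size l) -> tail_closed l (cons_tuple x t) ->
  (psdmx (mat_of x - Smin (prefix_moments l) (size l).+1) /\
   psdmx (Smax (prefix_moments l) (size l).+1 - mat_of x)) /\ tail_closed (rcons l x) t.
Proof.
move=> li xt; split.
  have := xt (size l).+1; rewrite ltnS leqnn addnS ltnS leq_addr.
  rewrite -(Smin_prefix l (x :: t)) -(Smax_prefix l (x :: t)) -(prefix_moments_next l x t).
  apply=> //; apply: (interior_ext _ li) => j; exact: prefix_moments_cat.
move=> j; rewrite size_rcons cat_rcons => /andP[lj jm]; apply: xt.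
by rewrite (ltnW lj)/= addnS -addSn.
Qed.

(** The counterpart of [iter_canon] for the closed ranges; an inequality, since it rests on
    monotonicity for sets of unknown measurability. *)
Lemma iter_closed m l : interior_upto (prefix_moments l) (size l) ->
  (iter_int I (fun s : m.-tuple T => (\1_[set s | tail_closed l s] s)%:E) <=
   (\det (gap (prefix_moments l) (size l).+1) `^ ((m * p.+1)%:R / 2))%:E *
   iter_int I (fun v : m.-tuple T => (weight v)%:E * 1))%E.
Proof.
elim: m l => [|m IH] l li.
  rewrite /= mul0n mul0r powRr0 mul1e /weight big_ord0 !mul1e lee_fin indicE.
  by case: (_ \in _).
set S := prefix_moments l; set k := (size l).+1.
have As : (Smin S k)^T = Smin S k := interior_Smin_sym (prefix_moments_sym l) erefl li.
have Bs : (Smax S k)^T = Smax S k.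
  have -> : Smax S k = gap S k + Smin S k by rewrite /gap subrK.
  by rewrite linearD/= As (interior_gap (prefix_moments_sym l) erefl li).1.
pose K (x : T) := iter_int I (fun v : m.-tuple T => (weight v)%:E * 1)%E.
have K0 x : (0 <= K x)%E by apply: (iter_ge0 tI) => v; rewrite mule1 lee_fin weight_ge0.
pose b1 (x : T) : \bar R := (\1_[set x | cone_boundary (mat_of x - Smin S k)] x)%:E.
pose b2 (x : T) : \bar R := (\1_[set x | cone_boundary (Smax S k - mat_of x)] x)%:E.
have b10 x : (0 <= b1 x)%E by rewrite lee_fin.
have b20 x : (0 <= b2 x)%E by rewrite lee_fin.
have mb1 : measurable_fun setT b1.
  apply/measurable_EFinP/measurable_indic.
  apply: (@measurable_cone_boundary (fun x => mat_of x - Smin S k)).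
    apply: measurable_mat_ofB; first exact: measurable_mat_of.
    by move=> i j; exact: (measurable_cst (Smin S k i j)).
  by move=> x; rewrite linearB/= mat_of_sym As.
have mb2 : measurable_fun setT b2.
  apply/measurable_EFinP/measurable_indic.
  apply: (@measurable_cone_boundary (fun x => Smax S k - mat_of x)).
    apply: measurable_mat_ofB; last exact: measurable_mat_of.
    by move=> i j; exact: (measurable_cst (Smax S k i j)).
  by move=> x; rewrite linearB/= mat_of_sym Bs.
have mK : measurable_fun setT K by exact: measurable_cst.
have mP := measurable_pulled_back l m mK.
(* On the boundary the induction gives no bound for the inner integral, so the weight +oo is put
   there; the boundary being null, this adds nothing. *)
apply: (@le_trans _ _ (I (fun x => pulled_back l m K x + +oo * (b1 x + b2 x))%E)).
  rewrite [X in (X <= _)%E]/=; apply: (ton_le tI) => x.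
    by apply: (iter_ge0 tI) => t; rewrite lee_fin.
  have [xr|xr] := pselect (in_range l x).
    apply: (@le_trans _ _ (pulled_back l m K x)); last first.
      by rewrite leeDl// mule_ge0// adde_ge0.
    rewrite pulled_back_in_range//; have [li' _] := next_gap li xr.
    rewrite -(size_rcons l x); apply: le_trans (IH _ li').
    apply: (iter_le tI) => t; first by rewrite lee_fin.
    rewrite lee_fin !indicE; case: (boolP (_ \in _)) => // /set_mem/= /(tail_closed_cons li)[_ H].
    by rewrite mem_set.
  have [c|nc] := pselect (psdmx (mat_of x - Smin S k) /\ psdmx (Smax S k - mat_of x)).
    rewrite pulled_back_out// add0e gt0_mulye ?leey//.
    have [h1|h1] := pselect (cone_boundary (mat_of x - Smin S k)).
      have -> : b1 x = 1%E by rewrite /b1 indicE mem_set.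
      exact: lt_le_trans lte01 (leeDl _ (b20 x)).
    have [h2|h2] := pselect (cone_boundary (Smax S k - mat_of x)).
      have -> : b2 x = 1%E by rewrite /b2 indicE mem_set.
      exact: lt_le_trans lte01 (leeDr _ (b10 x)).
    exfalso; apply: xr; split; apply: contrapT => n.
      by apply: h1; split=> //; exact: c.1.
    by apply: h2; split=> //; exact: c.2.
  rewrite [X in (X <= _)%E](_ : _ = 0%E).
    by rewrite adde_ge0 ?pulled_back_ge0// mule_ge0// adde_ge0.
  rewrite -[RHS](ton_cst0 (tonelli_iter m tI)).
  congr iter_int; apply/funext => t; rewrite indicE memNset//= => /(tail_closed_cons li)[].
  by move=> /nc.
have mb : measurable_fun setT (fun x => b1 x + b2 x)%E by exact: emeasurable_funD.
rewrite (tonD tI)//; last 3 first.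
- by move=> x; rewrite pulled_back_ge0.
- by move=> x; rewrite mule_ge0// adde_ge0.
- exact: emeasurable_funM.
rewrite (tonZ tI)//; last by move=> x; rewrite adde_ge0.
rewrite (tonD tI)// /b1 boundary_null// boundary_null_up// adde0 mule0 adde0.
by rewrite leb_int_S_pulled_back// -(iter_weightS (G := fun=> 1%E)).
Qed.

Lemma open01P (u : T) :
  mx_open01 (mat_of u) <-> pdmx (mat_of u) /\ pdmx (1%:M - mat_of u).
Proof.
rewrite /mx_open01 /loewner_lt /= subr0; split=> [[_]//|H]; split=> //.
exact: mat_of_sym.
Qed.

Lemma beta_weightE j (u : T) : let e := j%:R * p.+1%:R / 2 - p.+1%:R / 2 in
  beta_weight j u = \det (mat_of u) `^ e * \det (1%:M - mat_of u) `^ e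
    * \1_(@mx_open01 R p) (mat_of u).
Proof.
move=> e; rewrite /beta_weight indicE.
have [H|H] := pselect (mx_open01 (mat_of u)).
  by have [u0 u1] := (open01P u).1 H; rewrite mem_set// mulr1 !wishart_pd.
rewrite memNset// mulr0; have [u0|u0] := pselect (pdmx (mat_of u)); last first.
  by rewrite wishart_npd ?mul0r.
by rewrite [X in _ * X]wishart_npd ?mulr0// => u1; apply: H; apply/open01P.
Qed.

Lemma iter_prod n d (T' : measurableType d) (J : (T' -> \bar R) -> \bar R)
    (f : 'I_n -> T' -> R) : tonelli J ->
  (forall i x, 0 <= f i x) -> (forall i, measurable_fun setT (f i)) ->
  iter_int J (fun v : n.-tuple T' => (\prod_i f i (tnth v i))%:E) =
  (\prod_i J (fun x => (f i x)%:E))%E.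
Proof.
move=> tJ; elim: n f => [|n IH] f f0 mf; first by rewrite /= !big_ord0.
rewrite big_ord_recl /= -IH//; set C := iter_int J _.
have C0 : (0 <= C)%E by apply: (iter_ge0 tJ) => v; rewrite lee_fin prodr_ge0.
have mprod : measurable_fun setT
    (fun v : n.-tuple T' => (\prod_i f (lift ord0 i) (tnth v i))%:E).
  apply/measurable_EFinP; apply: measurable_prodr => i.
  by apply: (measurableT_comp (mf _)); exact: measurable_tnth.
rewrite [RHS]muleC -(tonZ tJ)//; last exact/measurable_EFinP.
congr J; apply/funext => x; rewrite [RHS]muleC -(tonZ (tonelli_iter n tJ))//.
- congr iter_int; apply/funext => v; rewrite big_ord_recl EFinM; congr (_ * _%:E)%E.
  by apply: eq_bigr => i _; rewrite tnthS.
- by rewrite lee_fin.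
- by move=> v; rewrite lee_fin prodr_ge0.
- by move=> x; rewrite lee_fin.
Qed.

Lemma gap_nil : gap (prefix_moments ([::] : seq T)) 1 = 1%:M.
Proof. by rewrite /gap /= subr0. Qed.

Lemma interior_nil : interior_upto (prefix_moments ([::] : seq T)) 0.
Proof. by move=> [|j]. Qed.

Variable n : nat.
Implicit Types s : n.-tuple T.

Lemma tail_interior_nil s : tail_interior [::] s <-> moment_interior s.
Proof.
split=> [si k|si [//|j] /andP[_ jn]]; first by apply: (si k.+1) => /=; exact: ltn_ord.
exact: (si (Ordinal jn)).
Qed.

Lemma moment_space_tail_closed s : moment_space s -> tail_closed [::] s.
Proof. by move=> sm [//|j] /andP[_ jn] S ji; exact: (moment_space_closed jn sm ji). Qed.

(** The empty prefix has gap 1, whose determinant contributes no factor. *)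
Lemma leb_int_Sn_canon (G : n.-tuple T -> \bar R) :
  (forall v, 0 <= G v)%E -> measurable_fun setT G ->
  leb_int_Sn (fun s => (\1_(@moment_interior R p n) s)%:E * G (canon_vec s))%E =
  leb_int_Sn (fun v => (weight v)%:E * G v)%E.
Proof.
move=> G0 mG; have := iter_canon interior_nil G0 mG.
rewrite gap_nil det1 powR1 mul1e => H; apply: etrans H; congr iter_int; apply/funext => s.
congr (_%:E * _)%E; rewrite !indicE; congr ((nat_of_bool _)%:R).
by apply/idP/idP => /set_mem/= /tail_interior_nil si; exact: mem_set.
Qed.

(** The closed conditions bound the volume from above and the interior bounds it from below by the
    same integral of [weight], a product of beta integrals. *)
Lemma moment_volumeE :
  @moment_volume R p n = (\prod_(k < n) Beta_p p ((n - k)%:R * p.+1%:R / 2 : R)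
    ((n - k)%:R * p.+1%:R / 2))%:E.
Proof.
transitivity (leb_int_Sn (fun v : n.-tuple T => (weight v)%:E)).
  rewrite (_ : (fun v => (weight v)%:E) = fun v : n.-tuple T => ((weight v)%:E * 1)%E); last first.
    by apply/funext => v; rewrite mule1.
  apply/eqP; rewrite eq_le; apply/andP; split.
    have := iter_closed n interior_nil; rewrite gap_nil det1 powR1 mul1e.
    apply: le_trans; apply: (iter_le tI) => s; rewrite lee_fin ?indicE//.
    case: (boolP (_ \in _)) => // /set_mem sm; rewrite mem_set//.
    exact: moment_space_tail_closed.
  rewrite -(@leb_int_Sn_canon (fun=> 1%E) (fun _ => lee01) (measurable_cst _)).
  apply: (iter_le tI) => s; rewrite mule1 lee_fin ?indicE//.
  case: (boolP (_ \in _)) => // /set_mem si; rewrite mem_set//.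
  exact: interior_moment_space.
rewrite /leb_int_Sn (iter_prod tI (f := fun i : 'I_n => beta_weight (n - i)))//; last 2 first.
- by move=> i x; exact: beta_weight_ge0.
- by move=> i; exact: measurable_beta_weight.
rewrite -prodEFin; apply: eq_bigr => i _.
set a := _ * _ / 2.
(* As n - i is at least 1, the parameter lies in the range where the beta integral was evaluated. *)
have ap : p.+1%:R / 2 <= a.
  by rewrite /a ler_pM2r// ler_peMl// ler1n subn_gt0.
by have [<- _] := beta_intE ap ap.
Qed.

End MomentVolume.

(** * Density and independence of the canonical moments *)

Theorem theorem3p5 (R : realType) (p n : nat) :
  (0 < p)%N -> (0 < n)%N ->
  let V : \bar R := @moment_volume R p n in
  let Mn := @moment_space R p n in
  let Int := @moment_interior R p n in
  let U := @canon_vec R p n in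
  let f := fun u : n.-tuple ((dimS p).-tuple R) =>
    (fine V)^-1 * \prod_(k < n)
      ((\det (mat_of (tnth u k) *m (1%:M - mat_of (tnth u k))))
         `^ ((p.+1 * (n - k.+1))%:R / 2)
       * \1_(@mx_open01 R p) (mat_of (tnth u k))) in
  ((0 < V)%E /\ (V < +oo)%E) /\
  (forall A : set (n.-tuple ((dimS p).-tuple R)), measurable A ->
     @leb_int_Sn R p n
       (fun s => ((fine V)^-1 * \1_(Mn `&` Int `&` (U @^-1` A)) s)%:E)
     = @leb_int_Sn R p n (fun u => (\1_A u * f u)%:E)) /\
  (forall B : 'I_n -> set ((dimS p).-tuple R), (forall k, measurable (B k)) ->
     @leb_int_Sn R p n
       (fun s => ((fine V)^-1 *
          \1_(Mn `&` Int `&` [set s | forall k, B k (tnth (U s) k)]) s)%:E)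
     = (\prod_(k < n)
          @beta_p_prob R p ((n - k)%:R * p.+1%:R / 2) ((n - k)%:R * p.+1%:R / 2) (B k))%E).
Proof.
move=> _ _ V Mn Int U f.
(* [k] is zero-based here, so n - k stands for the n - k + 1 of one-based indexing. *)
pose a (k : 'I_n) : R := (n - k)%:R * p.+1%:R / 2.
have ap k : p.+1%:R / 2 <= a k by rewrite /a ler_pM2r// ler_peMl// ler1n subn_gt0.
have B0 k : 0 < Beta_p p (a k) (a k) by have [] := beta_intE (ap k) (ap k).
have VE : V = (\prod_k Beta_p p (a k) (a k))%:E by exact: moment_volumeE.
have V0 : 0 < fine V by rewrite VE; apply: prodr_gt0 => k _.
have Vi0 : 0 <= (fine V)^-1 by rewrite invr_ge0 ltW.
have bw k (u : (dimS p).-tuple R) : (\det (mat_of u *m (1%:M - mat_of u)))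
    `^ ((p.+1 * (n - (k : 'I_n).+1))%:R / 2) * \1_(@mx_open01 R p) (mat_of u) =
    beta_weight (n - k) u.
  have -> : (p.+1 * (n - k.+1))%:R / 2 = a k - p.+1%:R / 2 :> R.
    have nk : (n - k = (n - k.+1).+1)%N by rewrite subnSK.
    by rewrite /a nk natrM -(@natr1 R (n - k.+1)%N); field.
  rewrite beta_weightE -/(a k) indicE.
  have [H|H] := pselect (mx_open01 (mat_of u)); last by rewrite memNset ?mulr0.
  have [u0 u1] := (open01P u).1 H.
  by rewrite mem_set// det_mulmx powRM// ltW// pd_det_gt0.
have fE v : f v = (fine V)^-1 * weight v.
  by congr (_ * _); apply: eq_bigr => k _; rewrite bw.
have change (A : set (n.-tuple ((dimS p).-tuple R))) : measurable A ->
    leb_int_Sn (fun s => ((fine V)^-1 * \1_(Mn `&` Int `&` (U @^-1` A)) s)%:E)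
    = leb_int_Sn (fun u => (\1_A u * f u)%:E).
  (* The change of variables is applied to the normalised indicator of [A], over the interior, which
     [Mn] contains. *)
  move=> mA; pose G v : \bar R := ((fine V)^-1 * \1_A v)%:E.
  have G0 v : (0 <= G v)%E by rewrite lee_fin mulr_ge0.
  have mG : measurable_fun setT G.
    by apply/measurable_EFinP; apply: measurable_funM => //; exact: measurable_indic.
  transitivity (leb_int_Sn (fun s => (\1_Int s)%:E * G (U s))%E).
    congr iter_int; apply/funext => s; rewrite /G -EFinM mulrCA; congr (_ * _)%:E.
    have -> : Mn `&` Int = Int by apply: setIidr => t; exact: interior_moment_space.
    by rewrite indicI.
  rewrite leb_int_Sn_canon//; congr iter_int; apply/funext => v.
  by rewrite /G -EFinM fE; congr _%:E; ring.
split; first by split; [rewrite VE lte_fin prodr_gt0|rewrite VE ltry].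
(* Independence is the density formula on a product set: the density factors, and 1/V is the product
   of the reciprocal beta constants. *)
split=> // B mB; pose A : set (n.-tuple ((dimS p).-tuple R)) := [set v | forall k, B k (tnth v k)].
have mA : measurable A.
  rewrite (_ : A = \bigcap_(k in [set: 'I_n]) (fun v => tnth v k) @^-1` B k); last first.
    by apply/seteqP; split=> [v H k _|v H k]; exact: H.
  apply: fin_bigcap_measurable => // k _.
  by rewrite -[X in measurable X]setTI; exact: measurable_tnth.
rewrite -[LHS]/(leb_int_Sn (fun s => ((fine V)^-1 * \1_(Mn `&` Int `&` (U @^-1` A)) s)%:E)).
rewrite change//.
have mw k b : measurable_fun setT (fun x => b * \1_(B k) x * beta_weight (n - k) x : R).
  apply: measurable_funM; last exact: measurable_beta_weight.
  by apply: measurable_funM => //; exact: measurable_indic.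
rewrite (_ : (fun u => (\1_A u * f u)%:E) = fun v => (\prod_k
    ((Beta_p p (a k) (a k))^-1 * \1_(B k) (tnth v k) * beta_weight (n - k) (tnth v k)))%:E); last first.
  apply/funext => v; rewrite fE VE [fine _]/= [X in _ = X%:E]big_split [X in _ = (X * _)%:E]big_split.
  rewrite prodfV mulrCA -mulrA; congr (_ * (_ * _))%:E.
  rewrite indicE; have [H|H] := pselect (A v).
    by rewrite mem_set// big1// => k _; rewrite indicE mem_set//; exact: H.
  rewrite memNset//; have /existsNP[k Hk] := H.
  by rewrite (bigD1 k)//= indicE memNset// mul0r.
rewrite /leb_int_Sn (iter_prod (tonelli_leb_int_S R p)
  (f := fun k x => (Beta_p p (a k) (a k))^-1 * \1_(B k) x * beta_weight (n - k) x))//; last first.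
  move=> k x; apply: mulr_ge0; last exact: beta_weight_ge0.
  by apply: mulr_ge0 => //; rewrite invr_ge0 ltW.
apply: eq_bigr => k _; congr leb_int_S; apply/funext => x; congr _%:E.
rewrite beta_weightE /beta_p_pdf -/(a k); ring.
Qed.
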